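(* Consider the periodic initial boundary value problem $$u_{xt}+uu_{xx}-\lambda u_x^2=I(t),\quad u(x,0)=u_0(x),\quad I(t)=-(\lambda+1)\int_0^1u_x^2\,dx,\quad u(0,t)=u(1,t),\ u_x(0,t)=u_x(1,t),$$ for $x\in[0,1]$, $t>0$, with smooth, mean-zero, periodic initial data $u_0$. 1. Suppose $u_0''$ has a zero of order $k\ge1$ at every $\overline\alpha_i$, $i=1,\dots,m$. Then: (a) For $0\le\lambda\le\frac{1+k}{2}$, solutions exist globally in time. More particularly, they vanish as $t\uparrow t_*=+\infty$ for $0<\lambda<\frac{1+k}{2}$ but converge to a nontrivial steady state if $\lambda=\frac{1+k}{2}$. (b) For $\frac{1+k}{2}<\lambda<+\infty$, there exists a finite $t_*>0$ such that $M(t)\to+\infty$ and $m(t)\to-\infty$ as $t\uparrow t_*$. Furthermore, $\lim_{t\uparrow t_*}u_x(\gamma(\alpha,t),t)=-\infty$ if $\alpha\notin\bigcup_{i,j}\{\overline\alpha_i\}\cup\{\underline\alpha_j\}$, and $\lim_{t\uparrow t_*}\|u_x\|_p=+\infty$ for all $p>1$. 2. Suppose $u_0''$ has a zero of order $k\ge1$ at each $\underline\alpha_j$, $j=1,\dots,n$. Then: (a) For $-\frac{1+k}{k}<\lambda<0$, there exists a finite $t_*>0$ such that only the minimum diverges, $m(t)\to-\infty$, as $t\uparrow t_*$, whereas, for $\frac{1+k}{1-p(1+k)}<\lambda<0$ and $p\ge1$, $\lim_{t\uparrow t_*}\|u_x\|_p<+\infty$. (b) For $\lambda<-\frac{1+k}{k}$,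 there is a finite $t_*>0$ such that $M(t)\to+\infty$ and $m(t)\to-\infty$ as $t\uparrow t_*$. Additionally, $\lim_{t\uparrow t_*}u_x(\gamma(\alpha,t),t)=+\infty$ for $\alpha\notin\bigcup_{i,j}\{\overline\alpha_i\}\cup\{\underline\alpha_j\}$, and $\lim_{t\uparrow t_*}\|u_x\|_p=+\infty$ if $\lambda<-\frac{1+k}{pk}$ and $p>1$.
   Context: $M_0>0>m_0$ are the greatest and least values of $u_0'$ on $[0,1]$ (so $u_0$ is nonconstant), attained exactly at the finitely many points $\overline\alpha_i$ ($1\le i\le m$) and $\underline\alpha_j$ ($1\le j\le n$) respectively. A smooth function $f$, not identically zero, has a zero of order $k\in\mathbb{N}$ at $x_0$ if $f(x_0)=f'(x_0)=\dots=f^{(k-1)}(x_0)=0$ and $f^{(k)}(x_0)\ne0$. The order $k$ is assumed to be the same at all the points in question (all $\overline\alpha_i$ in part 1, all $\underline\alpha_j$ in part 2); it is necessarily odd. Characteristics $\gamma$ are defined by $\dot\gamma(\alpha,t)=u(\gamma(\alpha,t),t)$, $\gamma(\alpha,0)=\alpha$. For $\lambda\ne0$ put $\mathcal{J}(\alpha,t)=1-\lambda\eta(t)u_0'(\alpha)$, $\bar{\mathcal{K}}_i(t)=\int_0^1\mathcal{J}(\alpha,t)^{-i-1/\lambda}d\alpha$, where $\dot\eta=\bar{\mathcal{K}}_0^{-2\lambda}$, $\eta(0)=0$. The solution is given by $$\gamma_\alpha=\frac{\mathcal{J}(\alpha,t)^{-1/\lambda}}{\bar{\mathcal{K}}_0(t)},\qquad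 u_x(\gamma(\alpha,t),t)=\frac{1}{\lambda\eta(t)\bar{\mathcal{K}}_0(t)^{2\lambda}}\left(\frac{1}{\mathcal{J}(\alpha,t)}-\frac{\bar{\mathcal{K}}_1(t)}{\bar{\mathcal{K}}_0(t)}\right)$$ (with value $u_0'(\alpha)$ at $t=0$) as long as $\eta(t)<\eta_*$, where $\eta_*=\frac1{\lambda M_0}$ if $\lambda>0$ and $\eta_*=\frac1{\lambda m_0}$ if $\lambda<0$. It is defined for $t\in[0,t_* )$ with $$t_*=\lim_{\eta\uparrow\eta_*}\int_0^\eta\left(\int_0^1(1-\lambda\mu u_0'(\alpha))^{-1/\lambda}d\alpha\right)^{2\lambda}d\mu\in(0,+\infty].$$ For $\lambda=0$ the corresponding solution is $\gamma_\alpha=e^{tu_0'(\alpha)}/\int_0^1e^{tu_0'}$, $u_x(\gamma(\alpha,t),t)=u_0'(\alpha)-\int_0^1u_0'e^{tu_0'}/\int_0^1e^{tu_0'}$. $M(t)=\sup_\alpha u_x(\gamma(\alpha,t),t)$ and $m(t)=\inf_\alpha u_x(\gamma(\alpha,t),t)$; one has $M(t)=u_x(\gamma(\overline\alpha_i,t),t)$, $m(t)=u_x(\gamma(\underline\alpha_j,t),t)$. $\|\cdot\|_p$ is the norm of $L^p(0,1)$ in $x$, so $\|u_x(\cdot,t)\|_p^p=\int_0^1|u_x(\gamma(\alpha,t),t)|^p\gamma_\alpha(\alpha,t)\,d\alpha$. ''Vanish'' means $u_x(\gamma(\alpha,t),t)\to0$ for every $\alpha$; ''converge to a nontrivial steady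 state'' means that $u_x(\gamma(\alpha,t),t)$ has a finite limit as $t\to\infty$ for every $\alpha$, the limit not being identically zero. ''Only the minimum diverges'' means that divergence occurs (to $-\infty$) only at the labels $\alpha=\underline\alpha_j$, while $u_x(\gamma(\alpha,t),t)$ stays bounded as $t\uparrow t_*$ for every other $\alpha$ and $M(t)$ does not diverge. The final $L^p$ divergence criterion in 2(b), $\lambda<-\frac{1+k}{pk}$ with $p>1$, is to be read as a statement for all such $\lambda$ (not only for $\lambda<-\frac{1+k}{k}$), with $t_*$ the finite $L^\infty$ blow-up time of $u_x$. *)

(* Defs.v *)
From Stdlib Require Import Reals List.
From Coquelicot Require Import Coquelicot.
Open Scope R_scope.

Definition smooth (f : R -> R) : Prop := forall n x, ex_derive_n f n x.

Definition periodic1 (f : R -> R) : Prop := forall x, f (x + 1) = f x.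

Definition greatest_value (f : R -> R) (M : R) : Prop :=
  (exists x, 0 <= x <= 1 /\ f x = M) /\ forall x, 0 <= x <= 1 -> f x <= M.

Definition least_value (f : R -> R) (m : R) : Prop :=
  (exists x, 0 <= x <= 1 /\ f x = m) /\ forall x, 0 <= x <= 1 -> m <= f x.

Definition attained_exactly_at (f : R -> R) (v : R) (l : list R) : Prop :=
  forall x, In x l <-> 0 <= x <= 1 /\ f x = v.

Definition zero_of_order (f : R -> R) (k : nat) (x : R) : Prop :=
  (forall j, (j < k)%nat -> Derive_n f j x = 0) /\ Derive_n f k x <> 0.

Definition dx (u : R -> R -> R) (x t : R) : R := Derive (fun y => u y t) x.

Definition dt (u : R -> R -> R) (x t : R) : R := Derive (fun s => u x s) t.

Definition strip (T : Rbar) (q : R * R) : Prop :=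
  0 <= snd q /\ Rbar_lt (snd q) T.

Definition continuous_strip (T : Rbar) (f : R -> R -> R) : Prop :=
  continuous_on (strip T) (fun q : R * R => f (fst q) (snd q)).

(** Classical solutions on [0 <= t < T] of the initial boundary value problem.
    The space variable lives on the circle R/Z: [u] is given by its 1-periodic
    extension to all of R (characteristics may leave [0,1]), which contains the
    boundary conditions u(0,t) = u(1,t) and u_x(0,t) = u_x(1,t).  The equation
    makes u_xt continuous, so this is not a separate requirement. *)
Record solution (lam : R) (u0 : R -> R) (T : Rbar) (u : R -> R -> R) : Prop := {
  sol_periodic : forall x t, 0 <= t -> Rbar_lt t T -> u (x + 1) t = u x t;
  sol_init : forall x, u x 0 = u0 x;
  sol_ex_dx : forall x t, 0 <= t -> Rbar_lt t T ->
    ex_derive (fun y => u y t) x;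
  sol_ex_dxx : forall x t, 0 <= t -> Rbar_lt t T ->
    ex_derive (fun y => dx u y t) x;
  sol_ex_dxt : forall x t, 0 < t -> Rbar_lt t T ->
    ex_derive (fun s => dx u x s) t;
  sol_cont : continuous_strip T u;
  sol_cont_dx : continuous_strip T (dx u);
  sol_cont_dxx : continuous_strip T (dx (dx u));
  sol_eq : forall x t, 0 < t -> Rbar_lt t T ->
    dt (dx u) x t + u x t * dx (dx u) x t - lam * dx u x t ^ 2
    = - (lam + 1) * RInt (fun y => dx u y t ^ 2) 0 1
}.

Definition characteristics (T : Rbar) (u gam : R -> R -> R) : Prop :=
  forall a, 0 <= a <= 1 ->
    gam a 0 = a /\
    continuous_on (fun t : R => 0 <= t /\ Rbar_lt t T) (gam a) /\
    forall t, 0 < t -> Rbar_lt t T -> is_derive (gam a) t (u (gam a t) t).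

Definition eta_star (lam M0 m0 : R) : R :=
  if Rlt_dec 0 lam then / (lam * M0) else / (lam * m0).

(** [Rpower] is only applied to positive bases here, since
    1 - lam mu u0' > 0 for 0 <= mu < eta_star. *)
Definition time_of_eta (lam : R) (u0 : R -> R) (eta : R) : R :=
  RInt (fun mu =>
    Rpower (RInt (fun a => Rpower (1 - lam * mu * Derive u0 a) (- / lam)) 0 1)
      (2 * lam)) 0 eta.

(** [T] is the time t_*; it is infinite for lam = 0. *)
Definition is_tstar (lam : R) (u0 : R -> R) (M0 m0 : R) (T : Rbar) : Prop :=
  (lam = 0 -> T = p_infty) /\
  (lam <> 0 -> filterlim (time_of_eta lam u0)
                 (at_left (eta_star lam M0 m0)) (Rbar_locally T)).

(** [T] = t_*, a solution with its characteristics exists on [0, T), and all of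
    them satisfy [P].  (Solutions are unique only up to the Galilean change
    u(x,t) -> u(x - c(t), t) + c'(t) with c(0) = c'(0) = 0, which does not affect
    u_x along characteristics.) *)
Definition solution_up_to (lam : R) (u0 : R -> R) (M0 m0 : R) (T : Rbar)
    (P : (R -> R -> R) -> (R -> R -> R) -> Prop) : Prop :=
  is_tstar lam u0 M0 m0 T /\
  (exists u gam, solution lam u0 T u /\ characteristics T u gam) /\
  forall u gam, solution lam u0 T u -> characteristics T u gam -> P u gam.

Definition ux_along (u gam : R -> R -> R) (a t : R) : R := dx u (gam a t) t.

Definition Msup (u gam : R -> R -> R) (t : R) : R :=
  real (Lub_Rbar (fun y => exists a, 0 <= a <= 1 /\ y = ux_along u gam a t)).

Definition minf (u gam : R -> R -> R) (t : R) : R :=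
  real (Glb_Rbar (fun y => exists a, 0 <= a <= 1 /\ y = ux_along u gam a t)).

(** Power with 0^p = 0; Stdlib has [Rpower 0 p = 1]. *)
Definition pow0 (x p : R) : R := if Rlt_dec 0 x then Rpower x p else 0.

Definition Lp_norm (p : R) (f : R -> R) : R :=
  pow0 (RInt (fun x => pow0 (Rabs (f x)) p) 0 1) (/ p).

Definition Linf_norm (f : R -> R) : R :=
  real (Lub_Rbar (fun y => exists x, 0 <= x <= 1 /\ y = Rabs (f x))).

Definition Lp_ux (p : R) (u : R -> R -> R) (t : R) : R :=
  Lp_norm p (fun x => dx u x t).

Definition Linf_ux (u : R -> R -> R) (t : R) : R :=
  Linf_norm (fun x => dx u x t).

Definition tends_left (f : R -> R) (T : R) (l : Rbar) : Prop :=
  filterlim f (at_left T) (Rbar_locally l).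

(* Main.v *)
Require Import Defs.
From Stdlib Require Import Reals List.
From Coquelicot Require Import Coquelicot.
From Stdlib Require Import ZArith Lra Lia ClassicalEpsilon Ranalysis5.
Open Scope R_scope.

(** Write [f = u0'].  Along a characteristic [w = u_x] satisfies the Riccati equation
    [w' = lam w^2 + I(t)], where [I] is the same for all labels.  For two labels [a], [b] the
    difference therefore obeys a linear equation, [w_a - w_b = (f(a) - f(b)) (g_a g_b)^lam], where
    [g_a = exp (int w_a)] is the Jacobian of the flow.  Consequently [(g_a / g_b)^(- lam)] equals
    [1 - lam eta (f(a) - f(b))] with [eta' = g_b^(2 lam)], and [int g = 1] fixes [g_b]: every
    solution is given by the explicit formula ([flow_formula]).  Conversely, the explicit Jacobian
    and slope define a solution, because differentiating [int g = 1] twice in time reproduces the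
    nonlocal term ([lagrangian_solution], [explicit_solution], [solution_exists]).

    Everything then depends on one family of integrals.  Let [h = M0 - f] for [lam > 0] and
    [h = f - m0] for [lam < 0], [s = 1 / lam], [d = 1 / (|lam| eta) - max (f or - f)], which
    decreases to 0 at the end of the life span, and [H_s(d) = int_0^1 (d + h)^(- s)].  Then
    ([solution_as_profile], [time_eta_of_derive])
      [u_x = sgn(lam) H_s^(- 2 lam) (1 / (d + h) - H_{s+1} / H_s)],
      [g = (d + h)^(- s) / H_s],   [dt = - H_s^(2 lam) / |lam| dd].
    If [u0''] has zeros of order [k] at the extrema in question, the zeros of [h] have order
    [q = k + 1], and the critical exponent is [1/q]:
    - for [s > 1/q], [d^(s - 1/q) H_s] has a positive limit ([sing_int_scaled_limit]), and
      [d H_{s+1} / H_s] tends to [1 - 1 / (q s)] ([sing_int_ratio_limit]), because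
      [H_s' = - s H_{s+1}];
    - for [s < 1/q], [H_s] has a positive limit ([sing_int_subcritical_limit]);
    - [H_s] is log-convex in [s] ([sing_int_log_convex]), which bounds the ratio
      [d H_{s+1} / H_s] away from 1 for every [s > 0].

    For [0 < lam <= q / 2] the rate of time is at least a multiple of [1 / d], so that the life span
    is infinite, and [H_s^(- 2 lam) / d] tends to 0, or to a positive number if [lam = q / 2].  For
    [lam > q / 2] the rate is integrable; at the zeros of [h] the term [1 / d] dominates, elsewhere
    the mean [H_{s+1} / H_s] does.  For [lam < 0], [H_s] itself converges, so that the life span is
    finite and the minimum diverges; the other labels follow the mean, which converges or diverges
    according to whether [1/lam + 1] lies below or above [1/q].  The norm of [u_x] in [L^p] is
    governed in the same way by the exponent [1/lam + p]: in the subcritical case the integral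
    converges ([profile_mass_converges]), and otherwise Bernoulli's inequality bounds it from below
    by integrals of the same family ([profile_mass_lower]); for [lam > q / 2] this lower bound for
    [p = 1] is enough.  For [lam = 0] only existence for all times has to be shown. *)

(** * Continuity, powers and integrals *)

Section ContinuityRules.
Context {U : UniformSpace}.
Implicit Types (f g : U -> R) (x : U).

Lemma cont_plus f g x :
  continuous f x -> continuous g x -> continuous (fun y => f y + g y) x.
Proof. exact (continuous_plus f g x). Qed.

Lemma cont_opp f x : continuous f x -> continuous (fun y => - f y) x.
Proof. exact (continuous_opp f x). Qed.

Lemma cont_minus f g x :
  continuous f x -> continuous g x -> continuous (fun y => f y - g y) x.
Proof. exact (continuous_minus f g x). Qed.

Lemma cont_mult f g x :
  continuous f x -> continuous g x -> continuous (fun y => f y * g y) x.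
Proof. exact (continuous_mult f g x). Qed.

Lemma cont_comp_derivable (phi dphi : R -> R) f x :
  is_derive phi (f x) (dphi (f x)) -> continuous f x -> continuous (fun y => phi (f y)) x.
Proof.
  intros Hd Hf. apply (continuous_comp f phi); [exact Hf|].
  apply (ex_derive_continuous (V := R_NormedModule)). eexists; exact Hd.
Qed.

Lemma cont_inv f x : f x <> 0 -> continuous f x -> continuous (fun y => / f y) x.
Proof.
  intros Hne. apply (cont_comp_derivable Rinv (fun z => - / z ^ 2)).
  auto_derive; [exact Hne|]. field; exact Hne.
Qed.

Lemma cont_div f g x :
  g x <> 0 -> continuous f x -> continuous g x -> continuous (fun y => f y / g y) x.
Proof. intros. apply cont_mult; [|apply cont_inv]; assumption. Qed.

Lemma cont_exp f x : continuous f x -> continuous (fun y => exp (f y)) x.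
Proof. apply (cont_comp_derivable exp exp). apply is_derive_exp. Qed.

Lemma cont_ln f x : 0 < f x -> continuous f x -> continuous (fun y => ln (f y)) x.
Proof.
  intros Hpos. apply (cont_comp_derivable ln Rinv). apply is_derive_ln, Hpos.
Qed.

Lemma cont_Rpower f g x :
  0 < f x -> continuous f x -> continuous g x -> continuous (fun y => Rpower (f y) (g y)) x.
Proof. intros. apply cont_exp, cont_mult; [|apply cont_ln]; assumption. Qed.

Lemma cont_pow f n x : continuous f x -> continuous (fun y => f y ^ n) x.
Proof.
  intros Hf. induction n as [|n IH]; simpl.
  - apply continuous_const.
  - apply cont_mult; assumption.
Qed.

Lemma cont_Rabs f x : continuous f x -> continuous (fun y => Rabs (f y)) x.
Proof. intros Hf. apply (continuous_comp f Rabs); [exact Hf|apply continuous_Rabs]. Qed.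

End ContinuityRules.

Ltac cont :=
  repeat match goal with
  | H : ?P |- ?P => exact H
  | H : forall z, continuous ?f z |- continuous ?f _ => apply H
  | |- continuous (fun y => y) _ => apply continuous_id
  | |- continuous (fun _ => ?c) _ => apply continuous_const
  | |- continuous (fun _ => _ + _) _ => apply cont_plus
  | |- continuous (fun _ => _ - _) _ => apply cont_minus
  | |- continuous (fun _ => _ * _) _ => apply cont_mult
  | |- continuous (fun _ => - _) _ => apply cont_opp
  | |- continuous (fun _ => _ / _) _ => apply cont_div
  | |- continuous (fun _ => / _) _ => apply cont_inv
  | |- continuous (fun _ => Rpower _ _) _ => apply cont_Rpower
  | |- continuous (fun _ => exp _) _ => apply cont_exp
  | |- continuous (fun _ => ln _) _ => apply cont_ln
  | |- continuous (fun _ => _ ^ _) _ => apply cont_pow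
  | |- continuous (fun _ => Rabs _) _ => apply cont_Rabs
  | |- continuous (Rplus ?c) ?x => apply (cont_plus (fun _ => c) (fun y => y) x)
  | |- continuous (Rmult ?c) ?x => apply (cont_mult (fun _ => c) (fun y => y) x)
  | |- continuous (Rminus ?c) ?x => apply (cont_minus (fun _ => c) (fun y => y) x)
  | |- continuous ln ?x => apply (cont_ln (fun y => y) x)
  | |- continuous exp ?x => apply (cont_exp (fun y => y) x)
  | |- continuous Rinv ?x => apply (cont_inv (fun y => y) x)
  | |- continuous Ropp ?x => apply (cont_opp (fun y => y) x)
  | |- continuous Rabs _ => apply continuous_Rabs
  | |- continuous fst _ => apply continuous_fst
  | |- continuous snd _ => apply continuous_snd
  | |- continuous (fun p => fst p) _ => apply continuous_fst
  | |- continuous (fun p => snd p) _ => apply continuous_snd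
  | H : forall z, continuous ?f z |- continuous (fun y => ?f (@?g y)) _ =>
      apply (continuous_comp g f); [|apply H]
  end; try (simpl; lra).

(** [ring] and [field] need the equation at type [R], not at the carrier of a normed module. *)
Ltac eqR := match goal with |- @eq _ ?a ?b => change (@eq R a b) end.

Lemma is_derive_continuous (f : R -> R) x l : is_derive f x l -> continuous f x.
Proof. intros Hd. apply (ex_derive_continuous (V := R_NormedModule)). eexists; exact Hd. Qed.

Lemma Rpower_gt0 x y : 0 < Rpower x y.
Proof. apply exp_pos. Qed.

Lemma is_derive_Rpower x y : 0 < x -> is_derive (fun z => Rpower z y) x (y * Rpower x (y - 1)).
Proof.
  intros Hx. unfold Rpower. auto_derive; [exact Hx|].
  replace ((y - 1) * ln x) with (y * ln x - ln x) by ring.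
  unfold Rminus. rewrite exp_plus, exp_Ropp, exp_ln by exact Hx. ring.
Qed.

(** At the end points continuity is enough: solutions are differentiable in time only for
    [t > 0]. *)
Lemma derive_nonneg_le (f df : R -> R) a b : a <= b ->
  (forall x, a < x < b -> is_derive f x (df x)) ->
  (forall x, a <= x <= b -> continuous f x) ->
  (forall x, a < x < b -> 0 <= df x) -> f a <= f b.
Proof.
  intros Hab Hd Hc Hp.
  destruct (Rle_lt_or_eq_dec _ _ Hab) as [Hlt|<-]; [|lra].
  destruct (MVT_gen f a b (fun x => if Rlt_dec a x then if Rlt_dec x b then df x else 0 else 0))
    as [c [Hc1 Hc2]].
  - intros x. rewrite Rmin_left, Rmax_right by lra. intros Hx.
    destruct (Rlt_dec a x); [|lra]. destruct (Rlt_dec x b); [|lra]. auto.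
  - intros x. rewrite Rmin_left, Rmax_right by lra. intros Hx.
    apply continuity_pt_filterlim, Hc, Hx.
  - assert (0 <= (if Rlt_dec a c then if Rlt_dec c b then df c else 0 else 0)).
    { destruct (Rlt_dec a c); [|lra]. destruct (Rlt_dec c b); [|lra]. auto. }
    nra.
Qed.

Lemma derive_zero_const (f : R -> R) a b : a <= b ->
  (forall x, a < x < b -> is_derive f x 0) ->
  (forall x, a <= x <= b -> continuous f x) -> f a = f b.
Proof.
  intros Hab Hd Hc. apply Rle_antisym.
  - apply (derive_nonneg_le f (fun _ => 0)); auto; intros; lra.
  - assert (- f a <= - f b); [|lra].
    apply (derive_nonneg_le (fun x => - f x) (fun _ => 0)); auto; intros; try lra.
    + replace 0 with (- 0) by ring. apply (is_derive_opp f), Hd; auto.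
    + apply cont_opp; auto.
Qed.

Lemma derive_pos_lt (f df : R -> R) a b : a < b ->
  (forall x, a <= x <= b -> is_derive f x (df x)) ->
  (forall x, a <= x <= b -> 0 < df x) -> f a < f b.
Proof.
  intros Hab Hd Hp.
  destruct (MVT_gen f a b df) as [c [Hc1 Hc2]].
  - intros x. rewrite Rmin_left, Rmax_right by lra. intros Hx. apply Hd; lra.
  - intros x. rewrite Rmin_left, Rmax_right by lra. intros Hx.
    apply continuity_pt_filterlim, (is_derive_continuous _ _ (df x)), Hd, Hx.
  - rewrite Rmin_left, Rmax_right in Hc1 by lra.
    assert (0 < df c) by auto. nra.
Qed.

Lemma cont_ex_RInt (f : R -> R) a b :
  (forall x, Rmin a b <= x <= Rmax a b -> continuous f x) -> ex_RInt f a b.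
Proof. apply (ex_RInt_continuous (V := R_CompleteNormedModule)). Qed.

Lemma continuous_ex_RInt (f : R -> R) a b : (forall x, continuous f x) -> ex_RInt f a b.
Proof. intros Hf. apply cont_ex_RInt. auto. Qed.

Lemma RInt_split (f : R -> R) a b c :
  ex_RInt f a b -> ex_RInt f b c -> RInt f a c = RInt f a b + RInt f b c.
Proof. intros. symmetry. apply (RInt_Chasles f a b c); assumption. Qed.

Lemma RInt_nonneg (f : R -> R) a b : a <= b -> ex_RInt f a b ->
  (forall x, a < x < b -> 0 <= f x) -> 0 <= RInt f a b.
Proof. intros. apply RInt_ge_0; auto. Qed.

Lemma RInt_mult_l (f : R -> R) c a b : ex_RInt f a b ->
  RInt (fun x => c * f x) a b = c * RInt f a b.
Proof. intros. apply (RInt_scal f a b c); auto. Qed.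

Lemma RInt_add (f g : R -> R) a b : ex_RInt f a b -> ex_RInt g a b ->
  RInt (fun x => f x + g x) a b = RInt f a b + RInt g a b.
Proof. intros. apply (RInt_plus f g a b); auto. Qed.

Lemma RInt_constR c a b : RInt (fun _ : R => c) a b = (b - a) * c.
Proof. exact (RInt_const a b c). Qed.

Lemma RInt_le_sub (f : R -> R) a x y b : a <= x -> x <= y -> y <= b ->
  (forall z, a <= z <= b -> continuous f z) -> (forall z, a <= z <= b -> 0 <= f z) ->
  RInt f x y <= RInt f a b.
Proof.
  intros Hax Hxy Hyb Hc Hp.
  assert (E : forall u v, a <= u -> u <= v -> v <= b -> ex_RInt f u v).
  { intros u v Hu Huv Hv. apply cont_ex_RInt. intros z.
    rewrite Rmin_left, Rmax_right by lra. intros Hz. apply Hc; lra. }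
  rewrite (RInt_split f a x b), (RInt_split f x y b); try (apply E; lra).
  assert (0 <= RInt f a x) by (apply RInt_nonneg; [lra|apply E; lra|intros; apply Hp; lra]).
  assert (0 <= RInt f y b) by (apply RInt_nonneg; [lra|apply E; lra|intros; apply Hp; lra]).
  lra.
Qed.

(** Continuous induction, by taking the supremum of the points that are reached from [a].
    Most compactness arguments below go through this lemma, with [P x y] a bound or a limit
    on [x, y] that is known locally. *)
Lemma interval_gluing (P : R -> R -> Prop) a b : a <= b ->
  (forall x y z, a <= x -> x <= y -> y <= z -> z <= b -> P x y -> P y z -> P x z) ->
  (forall c, a <= c <= b -> exists r, 0 < r /\
     (forall y, c <= y <= c + r -> y <= b -> P c y) /\
     (forall x, c - r <= x <= c -> a <= x -> P x c)) ->
  P a b.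
Proof.
  intros Hab Hadd Hloc.
  set (S := fun y => a <= y <= b /\ P a y).
  assert (Sa : S a).
  { split; [lra|]. destruct (Hloc a) as [r [Hr [H1 _]]]; [lra|]. apply H1; lra. }
  destruct (completeness S) as [c [Hub Hlub]].
  { exists b. intros y [Hy _]. lra. }
  { exists a. exact Sa. }
  assert (Hac : a <= c) by (apply Hub, Sa).
  assert (Hcb : c <= b) by (apply Hlub; intros y [Hy _]; lra).
  destruct (Hloc c) as [r [Hr [Hright Hleft]]]; [lra|].
  assert (Hy : exists y, S y /\ c - r < y).
  { apply Classical_Prop.NNPP. intros Hn.
    assert (c <= c - r); [|lra]. apply Hlub. intros y Sy.
    destruct (Rle_lt_dec y (c - r)); [assumption|]. exfalso. apply Hn. eauto. }
  destruct Hy as [y [[Hy1 Hy2] Hy3]].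
  assert (Hyc : y <= c) by (apply Hub; split; auto).
  assert (Pac : P a c).
  { apply (Hadd a y c); try lra; auto. apply Hleft; lra. }
  destruct (Rle_lt_or_eq_dec _ _ Hcb) as [Hlt|<-]; [|exact Pac].
  exfalso. set (z := Rmin (c + r) b).
  assert (Hz : c < z) by (unfold z; apply Rmin_glb_lt; lra).
  assert (z <= b) by apply Rmin_r. assert (z <= c + r) by apply Rmin_l.
  assert (z <= c); [|lra]. apply Hub. split; [lra|].
  apply (Hadd a c z); try lra; auto. apply Hright; lra.
Qed.

Lemma is_derive_primitive (f : R -> R) a Y :
  (forall x, continuous f x) -> is_derive (fun y => RInt f a y) Y (f Y).
Proof.
  intros Hf. apply (is_derive_RInt (V := R_NormedModule) f (fun y => RInt f a y) a).
  - apply filter_forall. intros z.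
    apply (RInt_correct (V := R_CompleteNormedModule)), continuous_ex_RInt, Hf.
  - apply Hf.
Qed.

Lemma is_derive_eq (f : R -> R) x (l l' : R) : is_derive f x l -> l = l' -> is_derive f x l'.
Proof. intros H <-. exact H. Qed.

Lemma is_derive_comp_exp (g : R -> R) x dg :
  is_derive g x dg -> is_derive (fun s => exp (g s)) x (dg * exp (g x)).
Proof. intros Hg. apply (is_derive_comp exp g); [apply is_derive_exp|exact Hg]. Qed.

(** * Limits along filters on the line *)

Section LimitRules.
Context {T : Type} {F : (T -> Prop) -> Prop} {FF : Filter F}.
Implicit Types (f g : T -> R).

Lemma lim_eps f l :
  filterlim f F (locally l) <-> forall eps, 0 < eps -> F (fun x => Rabs (f x - l) < eps).
Proof.
  split.
  - intros H eps He. apply (H (fun y => Rabs (y - l) < eps)). exists (mkposreal eps He). auto.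
  - intros H P [eps He]. unfold filtermap. generalize (H eps (cond_pos eps)). apply filter_imp.
    intros x Hx. apply He. exact Hx.
Qed.

Lemma lim_pinfty f :
  filterlim f F (Rbar_locally p_infty) <-> forall B, F (fun x => B < f x).
Proof.
  split.
  - intros H B. apply (H (fun y => B < y)). exists B. auto.
  - intros H P [B HB]. unfold filtermap. generalize (H B). apply filter_imp. intros x Hx. apply HB, Hx.
Qed.

Lemma lim_minfty f :
  filterlim f F (Rbar_locally m_infty) <-> forall B, F (fun x => f x < B).
Proof.
  split.
  - intros H B. apply (H (fun y => y < B)). exists B. auto.
  - intros H P [B HB]. unfold filtermap. generalize (H B). apply filter_imp. intros x Hx. apply HB, Hx.
Qed.

Lemma lim_plus f g a b : filterlim f F (locally a) -> filterlim g F (locally b) ->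
  filterlim (fun x => f x + g x) F (locally (a + b)).
Proof. intros Hf Hg. eapply filterlim_comp_2; [exact Hf|exact Hg|]. exact (filterlim_plus a b). Qed.

Lemma lim_mult f g a b : filterlim f F (locally a) -> filterlim g F (locally b) ->
  filterlim (fun x => f x * g x) F (locally (a * b)).
Proof. intros Hf Hg. eapply filterlim_comp_2; [exact Hf|exact Hg|]. exact (filterlim_mult a b). Qed.

Lemma lim_cont (phi : R -> R) f a : filterlim f F (locally a) -> continuous phi a ->
  filterlim (fun x => phi (f x)) F (locally (phi a)).
Proof. intros Hf Hphi. exact (filterlim_comp _ _ _ _ _ _ _ _ Hf Hphi). Qed.

Lemma lim_const (a : R) : filterlim (fun _ : T => a) F (locally a).
Proof. apply filterlim_const. Qed.

Lemma lim_opp f a : filterlim f F (locally a) -> filterlim (fun x => - f x) F (locally (- a)).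
Proof. intros Hf. apply (lim_cont Ropp); [exact Hf|]. apply cont_opp, continuous_id. Qed.

Lemma lim_minus f g a b : filterlim f F (locally a) -> filterlim g F (locally b) ->
  filterlim (fun x => f x - g x) F (locally (a - b)).
Proof. intros Hf Hg. apply lim_plus; [|apply lim_opp]; assumption. Qed.

Lemma lim_inv f a : a <> 0 -> filterlim f F (locally a) ->
  filterlim (fun x => / f x) F (locally (/ a)).
Proof. intros Ha Hf. apply (lim_cont Rinv); [exact Hf|]. apply cont_inv; cont. Qed.

Lemma lim_div f g a b : b <> 0 -> filterlim f F (locally a) -> filterlim g F (locally b) ->
  filterlim (fun x => f x / g x) F (locally (a / b)).
Proof. intros Hb Hf Hg. apply lim_mult; [|apply lim_inv]; assumption. Qed.

Lemma lim_Rpower f a e : 0 < a -> filterlim f F (locally a) ->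
  filterlim (fun x => Rpower (f x) e) F (locally (Rpower a e)).
Proof. intros Ha Hf. apply (lim_cont (fun z => Rpower z e)); [exact Hf|]. cont. Qed.

Lemma lim_ext f g (l : Rbar) : F (fun x => f x = g x) ->
  filterlim f F (Rbar_locally l) -> filterlim g F (Rbar_locally l).
Proof. intros E. apply filterlim_ext_loc. exact E. Qed.

Lemma lim_squeeze0 f g : F (fun x => Rabs (f x) <= g x) ->
  filterlim g F (locally 0) -> filterlim f F (locally 0).
Proof.
  intros Hfg Hg. apply lim_eps. intros eps He.
  generalize (filter_and _ _ Hfg (proj1 (lim_eps g 0) Hg eps He)). apply filter_imp.
  intros x [H1 H2]. rewrite Rminus_0_r in *. apply Rabs_def2 in H2. lra.
Qed.

Lemma lim_pinfty_ge f g : F (fun x => f x <= g x) ->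
  filterlim f F (Rbar_locally p_infty) -> filterlim g F (Rbar_locally p_infty).
Proof.
  intros Hfg Hf. apply lim_pinfty. intros B.
  generalize (filter_and _ _ Hfg (proj1 (lim_pinfty f) Hf B)). apply filter_imp.
  intros x [H1 H2]. lra.
Qed.

Lemma lim_pinfty_scal f c : 0 < c ->
  filterlim f F (Rbar_locally p_infty) -> filterlim (fun x => c * f x) F (Rbar_locally p_infty).
Proof.
  intros Hc Hf. apply lim_pinfty. intros B.
  generalize (proj1 (lim_pinfty f) Hf (B / c)). apply filter_imp. intros x Hx.
  apply (Rmult_lt_compat_l c) in Hx; [|exact Hc].
  replace (c * (B / c)) with B in Hx by (field; lra). exact Hx.
Qed.

Lemma lim_pinfty_minus_const f c :
  filterlim f F (Rbar_locally p_infty) -> filterlim (fun x => f x - c) F (Rbar_locally p_infty).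
Proof.
  intros Hf. apply lim_pinfty. intros B.
  generalize (proj1 (lim_pinfty f) Hf (B + c)). apply filter_imp. intros x Hx. lra.
Qed.

Lemma lim_opp_pinfty f :
  filterlim f F (Rbar_locally p_infty) -> filterlim (fun x => - f x) F (Rbar_locally m_infty).
Proof.
  intros Hf. apply lim_minfty. intros B.
  generalize (proj1 (lim_pinfty f) Hf (- B)). apply filter_imp. intros x Hx. lra.
Qed.

Lemma lim_eventually_gt f l c : filterlim f F (locally l) -> c < l -> F (fun x => c < f x).
Proof.
  intros Hf Hc. generalize (proj1 (lim_eps f l) Hf (l - c)).
  intros H. assert (0 < l - c) by lra. specialize (H H0). revert H. apply filter_imp.
  intros x Hx. apply Rabs_def2 in Hx. lra.
Qed.

Lemma lim_eventually_lt f l c : filterlim f F (locally l) -> l < c -> F (fun x => f x < c).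
Proof.
  intros Hf Hc. generalize (proj1 (lim_eps f l) Hf (c - l)).
  intros H. assert (0 < c - l) by lra. specialize (H H0). revert H. apply filter_imp.
  intros x Hx. apply Rabs_def2 in Hx. lra.
Qed.

End LimitRules.

(** The domain [D] and the eventual inequality express monotonicity along the filter, so that
    one lemma serves limits at infinity and one-sided limits of either monotonicity. *)
Lemma monotone_bounded_limit (F : (R -> Prop) -> Prop) (PF : ProperFilter F)
    (f : R -> R) (D : R -> Prop) B :
  F D -> (forall x, D x -> F (fun y => f x <= f y)) -> (forall x, D x -> f x <= B) ->
  exists l, filterlim f F (locally l) /\ forall x, D x -> f x <= l.
Proof.
  intros HD Hmon HB.
  destruct (filter_ex _ HD) as [x0 Hx0].
  destruct (completeness (fun y => exists x, D x /\ y = f x)) as [l [Hub Hlub]].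
  { exists B. intros y [x [Hx ->]]. auto. }
  { exists (f x0). eauto. }
  exists l. split; [|intros x Hx; apply Hub; eauto].
  apply lim_eps. intros eps He.
  assert (Hx : exists x, D x /\ l - eps < f x).
  { apply Classical_Prop.NNPP. intros Hn.
    assert (l <= l - eps); [|lra]. apply Hlub. intros y [x [Hx ->]].
    destruct (Rle_lt_dec (f x) (l - eps)); [assumption|]. exfalso. apply Hn. eauto. }
  destruct Hx as [x [Dx Hx]].
  generalize (filter_and _ _ HD (Hmon x Dx)). apply filter_imp. intros y [Dy Hy].
  assert (f y <= l) by (apply Hub; eauto). apply Rabs_def1; lra.
Qed.

Lemma at_right_intro (P : R -> Prop) a r : 0 < r ->
  (forall x, a < x < a + r -> P x) -> at_right a P.
Proof.
  intros Hr HP. exists (mkposreal r Hr). intros y Hy Hlt. apply HP.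
  unfold ball in Hy; simpl in Hy. unfold AbsRing_ball, abs, minus, plus, opp in Hy; simpl in Hy.
  apply Rabs_def2 in Hy. lra.
Qed.

Lemma at_right_elim (P : R -> Prop) a : at_right a P ->
  exists r, 0 < r /\ forall x, a < x < a + r -> P x.
Proof.
  intros [r Hr]. exists r. split; [apply cond_pos|]. intros x Hx. apply Hr; [|lra].
  unfold ball; simpl. unfold AbsRing_ball, abs, minus, plus, opp; simpl.
  apply Rabs_def1; lra.
Qed.

Lemma at_left_intro (P : R -> Prop) a r : 0 < r ->
  (forall x, a - r < x < a -> P x) -> at_left a P.
Proof.
  intros Hr HP. exists (mkposreal r Hr). intros y Hy Hlt. apply HP.
  unfold ball in Hy; simpl in Hy. unfold AbsRing_ball, abs, minus, plus, opp in Hy; simpl in Hy.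
  apply Rabs_def2 in Hy. lra.
Qed.

Lemma at_left_elim (P : R -> Prop) a : at_left a P ->
  exists r, 0 < r /\ forall x, a - r < x < a -> P x.
Proof.
  intros [r Hr]. exists r. split; [apply cond_pos|]. intros x Hx. apply Hr; [|lra].
  unfold ball; simpl. unfold AbsRing_ball, abs, minus, plus, opp; simpl.
  apply Rabs_def1; lra.
Qed.

Lemma at_right_0_lt r : 0 < r -> at_right 0 (fun d => 0 < d < r).
Proof. intros Hr. apply (at_right_intro _ 0 r Hr). intros; lra. Qed.

Lemma Rpower_le_base x y e : 0 < x -> x <= y -> 0 <= e -> Rpower x e <= Rpower y e.
Proof. intros. apply Rle_Rpower_l; [|split]; assumption. Qed.

Lemma Rpower_anti_base x y e : 0 < x -> x <= y -> e <= 0 -> Rpower y e <= Rpower x e.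
Proof.
  intros Hx Hxy He. replace e with (- (- e)) by ring. rewrite !(Rpower_Ropp _ (- e)).
  apply Rinv_le_contravar; [apply Rpower_gt0|]. apply Rpower_le_base; lra.
Qed.

Lemma Rpower_pos_small e : 0 < e -> filterlim (fun d => Rpower d e) (at_right 0) (locally 0).
Proof.
  intros He. apply lim_eps. intros eps Heps.
  apply (at_right_intro _ 0 (Rpower eps (/ e)) (Rpower_gt0 _ _)). intros x Hx.
  rewrite Rminus_0_r, Rabs_pos_eq by (left; apply Rpower_gt0).
  replace eps with (Rpower (Rpower eps (/ e)) e).
  2:{ rewrite Rpower_mult, Rinv_l by lra. apply Rpower_1, Heps. }
  apply Rlt_Rpower_l; [|split]; lra.
Qed.

Lemma Rpower_neg_large e : e < 0 ->
  filterlim (fun d => Rpower d e) (at_right 0) (Rbar_locally p_infty).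
Proof.
  intros He. apply lim_pinfty. intros B.
  set (B' := Rmax B 1). assert (HB : B <= B') by apply Rmax_l.
  assert (HB1 : 1 <= B') by apply Rmax_r.
  assert (He' : 0 < - e) by lra. assert (HB2 : 0 < / B') by (apply Rinv_0_lt_compat; lra).
  generalize (proj1 (lim_eps _ _) (Rpower_pos_small (- e) He') (/ B') HB2).
  apply filter_imp. intros x Hx. rewrite Rminus_0_r in Hx.
  rewrite Rabs_pos_eq in Hx by (left; apply Rpower_gt0).
  rewrite Rpower_Ropp in Hx. assert (0 < Rpower x e) by apply Rpower_gt0.
  apply Rinv_lt_cancel in Hx; lra.
Qed.

Lemma Rpower_as_pow x n : 0 < x -> x ^ n = Rpower x (INR n).
Proof. intros. symmetry. apply Rpower_pow; assumption. Qed.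

(** * Singular integrals near a zero of finite order *)

Lemma pow_Rabs_nonneg x n : 0 <= Rabs x ^ n.
Proof. apply pow_le, Rabs_pos. Qed.

(** The constant in the asymptotics near a zero.  The integrand decays like [y^(- s q)], and
    [s q > 1]. *)
Lemma model_integral_limit (C s : R) (q : nat) : 0 < C -> (1 <= q)%nat -> 1 < s * INR q ->
  exists L, 0 < L /\
    filterlim (fun Y => RInt (fun y => Rpower (1 + C * y ^ q) (- s)) 0 Y)
      (Rbar_locally p_infty) (locally L).
Proof.
  intros HC Hq Hs.
  assert (HQ : 1 <= INR q) by (apply (le_INR 1); lia).
  assert (Hs0 : 0 < s) by nra.
  set (p := fun y => Rpower (1 + C * Rabs y ^ q) (- s)).
  set (G := fun Y => RInt p 0 Y).
  assert (Hpc : forall y, continuous p y).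
  { intros y. unfold p. cont. generalize (pow_Rabs_nonneg y q). nra. }
  assert (Hp0 : forall y, 0 < p y) by (intros; apply Rpower_gt0).
  assert (HGd : forall Y, is_derive G Y (p Y)).
  { intros Y. apply is_derive_primitive, Hpc. }
  assert (Hmon : forall x y, x <= y -> G x <= G y).
  { intros x y Hxy. apply (derive_nonneg_le G p); auto.
    - intros z _. apply (is_derive_continuous _ _ _ (HGd z)).
    - intros z _. left; apply Hp0. }
  set (e := s * INR q - 1).
  set (K := Rpower C (- s) / e).
  assert (HK : 0 < K).
  { apply Rdiv_lt_0_compat; [apply Rpower_gt0|unfold e; lra]. }
  (* beyond 1 the integrand is at most C^-s y^(-s q), whose primitive is bounded *)
  assert (Hbound : forall Y, 1 <= Y -> G Y <= G 1 + K).
  { intros Y HY.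
    assert (H : - (G 1 + K * Rpower 1 (- e)) <= - (G Y + K * Rpower Y (- e))).
    { apply (derive_nonneg_le (fun y => - (G y + K * Rpower y (- e)))
               (fun y => - (p y + K * (- e * Rpower y (- e - 1))))); auto.
      - intros y Hy. apply (is_derive_opp (fun y => G y + K * Rpower y (- e))).
        apply (is_derive_plus G); [apply HGd|].
        apply (is_derive_scal (fun y => Rpower y (- e))), is_derive_Rpower. lra.
      - intros y Hy. apply cont_opp, cont_plus.
        + apply (is_derive_continuous _ _ _ (HGd y)).
        + cont.
      - intros y Hy. unfold K.
        replace (Rpower C (- s) / e * (- e * Rpower y (- e - 1)))
          with (- (Rpower C (- s) * Rpower y (- e - 1))) by (field; unfold e; lra).
        assert (p y <= Rpower C (- s) * Rpower y (- e - 1)); [|lra].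
        replace (- e - 1) with (INR q * (- s)) by (unfold e; ring).
        rewrite <- Rpower_mult, <- Rpower_as_pow by lra.
        rewrite Rpower_mult_distr by (auto; apply pow_lt; lra).
        unfold p. rewrite Rabs_pos_eq by lra.
        assert (0 < C * y ^ q) by (apply Rmult_lt_0_compat; auto; apply pow_lt; lra).
        apply Rpower_anti_base; lra. }
    assert (Rpower 1 (- e) = 1) by (unfold Rpower; rewrite ln_1, Rmult_0_r; apply exp_0).
    assert (0 < Rpower Y (- e)) by apply Rpower_gt0. nra. }
  destruct (monotone_bounded_limit (Rbar_locally p_infty) _ G (fun y => 1 <= y) (G 1 + K))
    as [L [HL1 HL2]].
  - exists 1. intros; simpl in *; lra.
  - intros x _. exists x. intros y Hy. apply Hmon. simpl in Hy. lra.
  - auto.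
  - exists L. split.
    + apply Rlt_le_trans with (G 1); [|apply HL2; lra].
      apply RInt_gt_0; auto; lra.
    + revert HL1. apply filterlim_ext_loc. exists 0. intros Y HY. simpl in HY.
      apply RInt_ext. intros y. rewrite Rmin_left, Rmax_right by lra. intros Hy.
      unfold p. rewrite Rabs_pos_eq by lra. reflexivity.
Qed.

(** The substitution [x = d^(1/q) y] turns the scaled integral into an integral of a fixed
    profile over a growing interval; hence the limit is the same for every [r]. *)
Lemma pure_power_limit (C s : R) (q : nat) : 0 < C -> (1 <= q)%nat -> 1 < s * INR q ->
  exists L, 0 < L /\ forall r, 0 < r ->
    filterlim (fun d => Rpower d (s - / INR q) *
                 RInt (fun x => Rpower (d + C * x ^ q) (- s)) 0 r)
      (at_right 0) (locally L).
Proof.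
  intros HC Hq Hs.
  assert (HQ : 1 <= INR q) by (apply (le_INR 1); lia).
  destruct (model_integral_limit C s q HC Hq Hs) as [L [HL HG]].
  exists L. split; [exact HL|]. intros r Hr.
  assert (Hinf : filterlim (fun d => r * Rpower d (- / INR q)) (at_right 0)
                   (Rbar_locally p_infty)).
  { apply lim_pinfty_scal; [exact Hr|]. apply Rpower_neg_large.
    assert (0 < / INR q) by (apply Rinv_0_lt_compat; lra). lra. }
  generalize (filterlim_comp _ _ _ _ _ _ _ _ Hinf HG).
  apply filterlim_ext_loc.
  generalize (at_right_0_lt 1 Rlt_0_1). apply filter_imp. intros d Hd.
  set (m := Rpower d (/ INR q)).
  assert (Hm : 0 < m) by apply Rpower_gt0.
  assert (Hmq : m ^ q = d).
  { rewrite Rpower_as_pow by exact Hm. unfold m. rewrite Rpower_mult, Rinv_l by lra.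
    apply Rpower_1; lra. }
  assert (Hmi : Rpower d (- / INR q) = / m) by apply Rpower_Ropp.
  assert (Hms : Rpower d (s - / INR q) = Rpower d s * / m).
  { unfold Rminus. rewrite Rpower_plus, Hmi. reflexivity. }
  set (fd := fun x => Rpower (d + C * x ^ q) (- s)).
  assert (Hfc : forall x, 0 <= x -> continuous fd x).
  { intros x Hx. unfold fd. cont. assert (0 <= x ^ q) by (apply pow_le; lra). nra. }
  assert (Hex : ex_RInt fd 0 r).
  { apply cont_ex_RInt. intros x. rewrite Rmin_left, Rmax_right by lra.
    intros Hx. apply Hfc; lra. }
  assert (E : RInt (fun y => m * fd (m * y)) 0 (r * / m) = RInt fd 0 r).
  { generalize (RInt_comp_lin fd m 0 0 (r * / m)).
    rewrite Rmult_0_r, Rplus_0_l. replace (m * (r * / m) + 0) with r by (field; lra).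
    intros H. rewrite <- (H Hex). apply RInt_ext. intros y _.
    unfold scal; simpl; unfold mult; simpl. rewrite Rplus_0_r. reflexivity. }
  rewrite Hmi, Hms, <- E.
  rewrite <- RInt_mult_l.
  2:{ apply cont_ex_RInt. intros y. rewrite Rmin_left, Rmax_right.
      2,3: apply Rmult_le_pos; [lra|left; apply Rinv_0_lt_compat; lra].
      intros Hy. apply cont_mult; [cont|]. apply (continuous_comp (fun y => m * y) fd).
      cont. apply Hfc. nra. }
  apply RInt_ext. intros y. rewrite Rmin_left, Rmax_right.
  2,3: apply Rmult_le_pos; [lra|left; apply Rinv_0_lt_compat; lra].
  intros Hy. unfold fd.
  rewrite Rpow_mult_distr, Hmq.
  assert (0 <= y ^ q) by (apply pow_le; lra).
  replace (d + C * (d * y ^ q)) with (d * (1 + C * y ^ q)) by ring.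
  rewrite <- Rpower_mult_distr by nra.
  rewrite (Rpower_Ropp d s). eqR. field. split; [apply Rgt_not_eq, Rpower_gt0|lra].
Qed.

(** Multiplicative form of [h x ~ C |x - a|^q]; it transfers to powers of [d + h] because
    [d + h <= (1 + kap) (d + C |x - a|^q)]. *)
Definition power_zero (h : R -> R) (q : nat) (a : R) : Prop :=
  exists C, 0 < C /\ forall kap, 0 < kap -> exists rho, 0 < rho /\
    forall x, Rabs (x - a) <= rho ->
      C * Rabs (x - a) ^ q <= (1 + kap) * h x /\ h x <= (1 + kap) * (C * Rabs (x - a) ^ q).

Lemma Rpower_comparable u v c s : 0 < u -> 0 < v -> 0 < c -> 0 <= s ->
  u <= c * v -> Rpower c (- s) * Rpower v (- s) <= Rpower u (- s).
Proof.
  intros Hu Hv Hc Hs Huv. rewrite Rpower_mult_distr by auto.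
  apply Rpower_anti_base; lra.
Qed.

(** Near 0 the function [phi] is squeezed between multiples of [C x^q] arbitrarily close to it;
    the rest of the interval contributes a bounded integral, which the factor [d^(s - 1/q)]
    removes in the limit. *)
Lemma one_sided_limit (phi : R -> R) (C s : R) (q : nat) :
  0 < C -> (1 <= q)%nat -> 1 < s * INR q ->
  (forall x, continuous phi x) -> (forall x, 0 <= phi x) ->
  (forall kap, 0 < kap -> exists rho, 0 < rho /\ forall x, 0 <= x <= rho ->
     C * x ^ q <= (1 + kap) * phi x /\ phi x <= (1 + kap) * (C * x ^ q)) ->
  exists r L, 0 < r /\ 0 < L /\ forall y, 0 < y <= r ->
    filterlim (fun d => Rpower d (s - / INR q) * RInt (fun x => Rpower (d + phi x) (- s)) 0 y)
      (at_right 0) (locally L).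
Proof.
  intros HC Hq Hs Hc Hpos Hcmp.
  assert (HQ : 1 <= INR q) by (apply (le_INR 1); lia).
  assert (Hs0 : 0 < s) by nra.
  assert (HsQ : 0 < s - / INR q).
  { apply Rmult_lt_reg_r with (INR q); [lra|]. rewrite Rmult_0_l, Rmult_minus_distr_r, Rinv_l; lra. }
  destruct (pure_power_limit C s q HC Hq Hs) as [L [HL HB]].
  destruct (Hcmp 1 Rlt_0_1) as [r [Hr Hr1]].
  exists r, L. repeat split; auto. intros y Hy.
  apply lim_eps. intros eps Heps.
  set (X := fun d => Rpower d (s - / INR q)).
  set (A := fun d u v => RInt (fun x => Rpower (d + phi x) (- s)) u v).
  set (B := fun d v => RInt (fun x => Rpower (d + C * x ^ q) (- s)) 0 v).
  assert (HAc : forall d x, 0 < d -> continuous (fun x => Rpower (d + phi x) (- s)) x).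
  { intros d x Hd. cont. generalize (Hpos x). lra. }
  assert (HAex : forall d u v, 0 < d -> ex_RInt (fun x => Rpower (d + phi x) (- s)) u v).
  { intros. apply continuous_ex_RInt. auto. }
  assert (HBex : forall d v, 0 < d -> 0 <= v -> ex_RInt (fun x => Rpower (d + C * x ^ q) (- s)) 0 v).
  { intros d v Hd Hv. apply cont_ex_RInt. intros x. rewrite Rmin_left, Rmax_right by lra.
    intros Hx. cont. assert (0 <= x ^ q) by (apply pow_le; lra). nra. }
  (* choose kap with L (1+kap)^s < L + eps/2 and L (1+kap)^-s > L - eps/2 *)
  assert (Hkap : exists kap, 0 < kap /\ L * Rpower (1 + kap) s < L + eps / 2 /\
                   L - eps / 2 < L * Rpower (1 + kap) (- s)).
  { assert (Hlim : forall e, filterlim (fun k => L * Rpower (1 + k) e) (at_right 0) (locally L)).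
    { intros e. replace (locally L) with (locally (L * Rpower (1 + 0) e)).
      2:{ f_equal. rewrite Rplus_0_r. unfold Rpower. rewrite ln_1, Rmult_0_r, exp_0. ring. }
      apply (filterlim_filter_le_1 (G := at_right 0) (F := locally 0)).
      - intros P [e' He']. exists e'. intros; auto.
      - apply (cont_mult (fun _ => L) (fun k => Rpower (1 + k) e) 0); cont. }
    assert (G1 : L < L + eps / 2) by lra. assert (G2 : L - eps / 2 < L) by lra.
    destruct (filter_ex (F := at_right 0) _ (filter_and _ _ (at_right_0_lt 1 Rlt_0_1)
       (filter_and _ _ (lim_eventually_lt _ _ _ (Hlim s) G1)
          (lim_eventually_gt _ _ _ (Hlim (- s)) G2)))) as [k Hk].
    exists k. lra. }
  destruct Hkap as [kap [Hk0 [Hk1 Hk2]]].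
  destruct (Hcmp kap Hk0) as [rho' [Hrho' Hrho1']].
  set (rho := Rmin rho' y).
  assert (Hrho : 0 < rho) by (apply Rmin_glb_lt; lra).
  assert (Hrho'' : rho <= rho') by apply Rmin_l.
  assert (Hrhoy : rho <= y) by apply Rmin_r.
  assert (Hrho1 : forall x, 0 <= x <= rho ->
     C * x ^ q <= (1 + kap) * phi x /\ phi x <= (1 + kap) * (C * x ^ q)).
  { intros. apply Hrho1'. lra. }
  set (m := C * rho ^ q / 2).
  assert (Hm : 0 < m).
  { apply Rdiv_lt_0_compat; [|lra]. apply Rmult_lt_0_compat; auto. apply pow_lt; auto. }
  (* the part away from the zero is bounded, hence negligible after scaling *)
  assert (Htail : filterlim (fun d => X d * A d rho y) (at_right 0) (locally 0)).
  { apply (lim_squeeze0 _ (fun d => ((y - rho) * Rpower m (- s)) * X d)).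
    - generalize (at_right_0_lt 1 Rlt_0_1). apply filter_imp. intros d Hd.
      assert (0 < X d) by apply Rpower_gt0.
      assert (0 <= A d rho y).
      { apply RInt_nonneg; auto. apply HAex; lra. intros; left; apply Rpower_gt0. }
      assert (A d rho y <= (y - rho) * Rpower m (- s)).
      { rewrite <- RInt_constR. apply RInt_le; auto; [apply HAex; lra|apply ex_RInt_const|].
        intros x Hx. apply Rpower_anti_base; try lra.
        destruct (Hr1 x) as [H1 _]; [lra|].
        assert (rho ^ q <= x ^ q) by (apply pow_incr; lra).
        assert (C * rho ^ q <= C * x ^ q) by (apply Rmult_le_compat_l; lra).
        unfold m. lra. }
      rewrite Rabs_pos_eq by (apply Rmult_le_pos; lra). nra.
    - replace (locally 0) with (locally ((y - rho) * Rpower m (- s) * 0)) by (f_equal; ring).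
      apply lim_mult; [apply lim_const|]. apply Rpower_pos_small, HsQ. }
  assert (HBlim := HB rho Hrho). fold X in HBlim.
  assert (Hup : filterlim (fun d => Rpower (1 + kap) s * (X d * B d rho) + X d * A d rho y)
                  (at_right 0) (locally (Rpower (1 + kap) s * L + 0))).
  { apply lim_plus; [apply lim_mult; [apply lim_const|exact HBlim]|exact Htail]. }
  assert (Hlo : filterlim (fun d => Rpower (1 + kap) (- s) * (X d * B d rho) + X d * A d rho y)
                  (at_right 0) (locally (Rpower (1 + kap) (- s) * L + 0))).
  { apply lim_plus; [apply lim_mult; [apply lim_const|exact HBlim]|exact Htail]. }
  assert (G1 : Rpower (1 + kap) s * L + 0 < L + eps) by lra.
  assert (G2 : L - eps < Rpower (1 + kap) (- s) * L + 0) by lra.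
  generalize (filter_and _ _ (at_right_0_lt 1 Rlt_0_1)
    (filter_and _ _ (lim_eventually_lt _ _ _ Hup G1) (lim_eventually_gt _ _ _ Hlo G2))).
  apply filter_imp. intros d [Hd [H1 H2]].
  fold (A d 0 y).
  replace (A d 0 y) with (A d 0 rho + A d rho y).
  2:{ symmetry. apply RInt_split; apply HAex; lra. }
  fold (X d). rewrite Rmult_plus_distr_l.
  assert (HX : 0 < X d) by apply Rpower_gt0.
  assert (Hcl : Rpower (1 + kap) (- s) * B d rho <= A d 0 rho).
  { unfold B, A. rewrite <- RInt_mult_l by (apply HBex; lra).
    apply RInt_le; try lra; [|apply HAex; lra|].
    - apply (ex_RInt_scal (fun x => Rpower (d + C * x ^ q) (- s))). apply HBex; lra.
    - intros x Hx. assert (0 <= x ^ q) by (apply pow_le; lra).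
      assert (0 <= phi x) by auto. destruct (Hrho1 x) as [_ H3]; [lra|].
      assert (0 <= C * x ^ q) by nra.
      apply Rpower_comparable; try lra. nra. }
  assert (Hcu : A d 0 rho <= Rpower (1 + kap) s * B d rho).
  { unfold B, A. rewrite <- RInt_mult_l by (apply HBex; lra).
    apply RInt_le; try lra; [apply HAex; lra| |].
    - apply (ex_RInt_scal (fun x => Rpower (d + C * x ^ q) (- s))). apply HBex; lra.
    - intros x Hx. assert (0 <= x ^ q) by (apply pow_le; lra).
      assert (0 <= phi x) by auto. destruct (Hrho1 x) as [H3 _]; [lra|].
      assert (0 <= C * x ^ q) by nra.
      assert (H5 : Rpower (1 + kap) (- s) * Rpower (d + phi x) (- s) <= Rpower (d + C * x ^ q) (- s)).
      { apply Rpower_comparable; try lra. nra. }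
      apply (Rmult_le_compat_l (Rpower (1 + kap) s)) in H5; [|left; apply Rpower_gt0].
      rewrite <- Rmult_assoc, <- Rpower_plus in H5.
      replace (s + - s) with 0 in H5 by ring. rewrite Rpower_O, Rmult_1_l in H5 by lra.
      exact H5. }
  assert (X d * (Rpower (1 + kap) (- s) * B d rho) <= X d * A d 0 rho) by (apply Rmult_le_compat_l; lra).
  assert (X d * A d 0 rho <= X d * (Rpower (1 + kap) s * B d rho)) by (apply Rmult_le_compat_l; lra).
  apply Rabs_def1; lra.
Qed.

Lemma locally_ball_elim (P : R -> Prop) a : locally a P ->
  exists r, 0 < r /\ forall x, Rabs (x - a) < r -> P x.
Proof.
  intros [r Hr]. exists r. split; [apply cond_pos|]. intros x Hx. apply Hr. exact Hx.
Qed.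

Lemma locally_ball_intro (P : R -> Prop) a r : 0 < r ->
  (forall x, Rabs (x - a) < r -> P x) -> locally a P.
Proof. intros Hr HP. exists (mkposreal r Hr). intros x Hx. apply HP. exact Hx. Qed.

(** Differentiation under the integral sign, with the derivative given as a function
    that is jointly continuous on the line [t = t0] only. *)
Lemma is_derive_RInt_under (f df : R -> R -> R) (D : R -> Prop) a b t0 :
  locally t0 D ->
  (forall t s, D t -> is_derive (fun z => f z s) t (df t s)) ->
  (forall s, continuous (fun p : R * R => df (fst p) (snd p)) (t0, s)) ->
  (forall t s, D t -> continuous (f t) s) ->
  is_derive (fun t => RInt (f t) a b) t0 (RInt (df t0) a b).
Proof.
  intros HD Hd Hc Hf.
  assert (HD0 : D t0) by exact (locally_singleton _ _ HD).
  replace (RInt (df t0) a b) with (RInt (fun s => Derive (fun u => f u s) t0) a b).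
  2:{ apply RInt_ext. intros s _. apply is_derive_unique, Hd, HD0. }
  apply is_derive_RInt_param.
  - revert HD. apply filter_imp. intros t Ht s _. eexists. apply Hd, Ht.
  - intros s _. apply continuity_2d_pt_ext_loc with df.
    + destruct (locally_ball_elim _ _ HD) as [r [Hr Hr']].
      exists (mkposreal r Hr). intros u v Hu _. symmetry. apply is_derive_unique, Hd, Hr', Hu.
    + apply continuity_2d_pt_filterlim. exact (Hc s).
  - revert HD. apply filter_imp. intros t Ht. apply continuous_ex_RInt. intros s. apply Hf, Ht.
Qed.

(** If [F] converges at 0 and [d F'(d) -> c], then [c = 0]: otherwise [F] would grow like
    [c ln d]. *)
Lemma log_slope_zero (F G : R -> R) l c :
  (forall d, 0 < d < 1 -> is_derive F d (G d / d)) ->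
  filterlim F (at_right 0) (locally l) -> filterlim G (at_right 0) (locally c) -> c = 0.
Proof.
  assert (main : forall (F G : R -> R) l c,
    (forall d, 0 < d < 1 -> is_derive F d (G d / d)) ->
    filterlim F (at_right 0) (locally l) -> filterlim G (at_right 0) (locally c) -> c <= 0).
  { clear. intros F G l c Hd HF HG. apply Rnot_lt_le. intros Hc.
    assert (H1 : c / 2 < c) by lra. assert (H2 : l - 1 < l) by lra.
    destruct (at_right_elim _ _ (filter_and _ _ (at_right_0_lt 1 Rlt_0_1)
      (lim_eventually_gt _ _ _ HG H1))) as [r [Hr Hr']].
    set (u := r / 2). assert (Hu0 : 0 < u) by (unfold u; lra).
    destruct (filter_ex (F := at_right 0) _ (filter_and _ _ (lim_eventually_gt _ _ _ HF H2)
      (filter_and _ _ (at_right_0_lt u Hu0)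
        (proj1 (lim_minfty _) is_lim_ln_0 ((l - 1 - F u + c / 2 * ln u) / (c / 2)))))) as [d [Hd1 [Hd2 Hd3]]].
    assert (Hu : 0 < u < r) by (unfold u; lra).
    assert (F d - c / 2 * ln d <= F u - c / 2 * ln u).
    { apply (derive_nonneg_le (fun x => F x - c / 2 * ln x) (fun x => G x / x - c / 2 * / x)); [lra|..].
      - intros x Hx. destruct (Hr' x) as [Hx1 Hx2]; [lra|].
        apply (is_derive_minus F). apply Hd; lra.
        apply (is_derive_scal ln), is_derive_ln. lra.
      - intros x Hx. destruct (Hr' x) as [Hx1 Hx2]; [lra|].
        apply cont_minus; [apply (is_derive_continuous _ _ _ (Hd x Hx1))|cont].
      - intros x Hx. destruct (Hr' x) as [Hx1 Hx2]; [lra|].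
        replace (G x / x - c / 2 * / x) with ((G x - c / 2) * / x) by (field; lra).
        apply Rmult_le_pos; [lra|]. left; apply Rinv_0_lt_compat; lra. }
    apply (Rmult_lt_compat_l (c / 2)) in Hd3; [|lra].
    replace (c / 2 * ((l - 1 - F u + c / 2 * ln u) / (c / 2)))
      with (l - 1 - F u + c / 2 * ln u) in Hd3 by (field; lra).
    lra. }
  intros Hd HF HG. apply Rle_antisym; [exact (main F G l c Hd HF HG)|].
  assert (- c <= 0); [|lra].
  apply (main (fun d => - F d) (fun d => - G d) (- l) (- c)).
  - intros d Hd'. replace (- G d / d) with (- (G d / d)) by (field; lra).
    apply (is_derive_opp F), Hd, Hd'.
  - apply lim_opp, HF.
  - apply lim_opp, HG.
Qed.

(** In the comments [H_s] stands for [sing_int h s] and [q] for the order of the zeros of [h]. *)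
Definition sing_int (h : R -> R) (s d : R) : R := RInt (fun a => Rpower (d + h a) (- s)) 0 1.

Section SingularIntegral.
Context (h : R -> R) (q : nat).
Context (h_cont : forall x, continuous h x) (h_nonneg : forall x, 0 <= h x).
Context (q_ge : (2 <= q)%nat).
Context (h_zeros : forall a, 0 <= a <= 1 -> h a = 0 -> power_zero h q a).
Context (h_zero_ex : exists a, 0 <= a <= 1 /\ h a = 0).
Context (h_pos_ex : exists a, 0 <= a <= 1 /\ 0 < h a).

Notation SI := (sing_int h).

Lemma order_inv_bounds : 0 < / INR q <= 1 / 2.
Proof.
  assert (2 <= INR q) by (generalize (le_INR 2 q q_ge); simpl; lra).
  split; [apply Rinv_0_lt_compat; lra|]. rewrite Rdiv_1_l. apply Rinv_le_contravar; lra.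
Qed.

Lemma order_mult_gt s : / INR q < s -> 1 < s * INR q.
Proof.
  intros Hs. destruct order_inv_bounds as [H1 _].
  assert (H2 : 0 < INR q) by (apply lt_0_INR; lia).
  apply (Rmult_lt_compat_r (INR q)) in Hs; [|exact H2]. rewrite Rinv_l in Hs; lra.
Qed.

Lemma integrand_cont s d x : 0 < d -> continuous (fun a => Rpower (d + h a) (- s)) x.
Proof. intros Hd. cont. generalize (h_nonneg x). lra. Qed.

Lemma integrand_ex s d a b : 0 < d -> ex_RInt (fun a => Rpower (d + h a) (- s)) a b.
Proof. intros Hd. apply continuous_ex_RInt. intros; apply integrand_cont, Hd. Qed.

Lemma h_bounded : exists B, 0 < B /\ forall a, 0 <= a <= 1 -> h a <= B.
Proof.
  destruct (continuity_ab_maj h 0 1) as [x [Hx _]]; [lra| |].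
  - intros c _. apply continuity_pt_filterlim, h_cont.
  - exists (h x + 1). generalize (h_nonneg x). split; [lra|]. intros a Ha.
    generalize (Hx a Ha). lra.
Qed.

Lemma sing_int_pos s d : 0 < d -> 0 < SI s d.
Proof.
  intros Hd. apply RInt_gt_0; [lra|intros; apply Rpower_gt0|].
  intros; apply integrand_cont, Hd.
Qed.

Lemma sing_int_derive s d : 0 < d -> is_derive (SI s) d (- s * SI (s + 1) d).
Proof.
  intros Hd. unfold sing_int. rewrite <- RInt_mult_l by (apply integrand_ex, Hd).
  apply (is_derive_RInt_under (fun d a => Rpower (d + h a) (- s))
           (fun d a => - s * Rpower (d + h a) (- (s + 1))) (fun z => 0 < z)).
  - apply (locally_ball_intro _ d d Hd). intros x Hx. apply Rabs_def2 in Hx. lra.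
  - intros t a Ht. generalize (h_nonneg a). intros Ha.
    replace (- s * Rpower (t + h a) (- (s + 1)))
      with (1 * (- s * Rpower (t + h a) (- s - 1))).
    2:{ rewrite Rmult_1_l. do 2 f_equal. ring. }
    apply (is_derive_comp (fun y => Rpower y (- s)) (fun z => z + h a)).
    + apply is_derive_Rpower. lra.
    + auto_derive; auto.
  - intros a. generalize (h_nonneg a). intros Ha.
    cont.
  - intros t a Ht. apply integrand_cont, Ht.
Qed.

(** Where [h] is positive the integral is bounded as [d] tends to 0, so that the scaling factor
    removes it. *)
Lemma away_from_zero_limit s c : / INR q < s -> 0 < h c -> exists r, 0 < r /\
  forall x y, c - r <= x -> x <= y -> y <= c + r ->
    filterlim (fun d => Rpower d (s - / INR q) * RInt (fun a => Rpower (d + h a) (- s)) x y)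
      (at_right 0) (locally 0).
Proof.
  intros Hs Hc. destruct order_inv_bounds as [Hq0 _].
  destruct (locally_ball_elim (fun x => h c / 2 < h x) c) as [r [Hr Hr']].
  { apply (lim_eventually_gt h (h c)); [apply h_cont|lra]. }
  exists (r / 2). split; [lra|]. intros x y Hx Hxy Hy.
  apply (lim_squeeze0 _ (fun d => ((y - x) * Rpower (h c / 2) (- s)) * Rpower d (s - / INR q))).
  - generalize (at_right_0_lt 1 Rlt_0_1). apply filter_imp. intros d Hd.
    assert (0 < Rpower d (s - / INR q)) by apply Rpower_gt0.
    assert (0 <= RInt (fun a => Rpower (d + h a) (- s)) x y).
    { apply RInt_nonneg; auto. apply integrand_ex; lra. intros; left; apply Rpower_gt0. }
    assert (RInt (fun a => Rpower (d + h a) (- s)) x y <= (y - x) * Rpower (h c / 2) (- s)).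
    { rewrite <- RInt_constR. apply RInt_le; auto; [apply integrand_ex; lra|apply ex_RInt_const|].
      intros z Hz. assert (h c / 2 < h z) by (apply Hr', Rabs_def1; lra).
      apply Rpower_anti_base; lra. }
    rewrite Rabs_pos_eq by (apply Rmult_le_pos; lra). nra.
  - replace (locally 0) with (locally ((y - x) * Rpower (h c / 2) (- s) * 0)) by (f_equal; ring).
    apply lim_mult; [apply lim_const|]. apply Rpower_pos_small. lra.
Qed.

Lemma RInt_reflect (f : R -> R) c y : (forall x, continuous f x) ->
  RInt f (c - y) c = RInt (fun x => f (c - x)) 0 y.
Proof.
  intros Hf. generalize (RInt_comp_lin f (-1) c 0 y). intros E.
  replace (-1 * 0 + c) with c in E by ring. replace (-1 * y + c) with (c - y) in E by ring.
  rewrite <- (opp_RInt_swap (V := R_CompleteNormedModule)) by (apply continuous_ex_RInt, Hf).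
  rewrite <- E by (apply continuous_ex_RInt, Hf).
  rewrite <- RInt_opp.
  - apply RInt_ext. intros x _. unfold scal; simpl; unfold mult; simpl. unfold opp; simpl.
    replace (-1 * x + c) with (c - x) by ring. ring.
  - apply continuous_ex_RInt. intros x. unfold scal; simpl; unfold mult; simpl. cont.
Qed.

Lemma RInt_shift (f : R -> R) c a b : (forall x, continuous f x) ->
  RInt f (c + a) (c + b) = RInt (fun x => f (c + x)) a b.
Proof.
  intros Hf. generalize (RInt_comp_lin f 1 c a b). intros E.
  replace (1 * a + c) with (c + a) in E by ring. replace (1 * b + c) with (c + b) in E by ring.
  rewrite <- E by (apply continuous_ex_RInt, Hf).
  apply RInt_ext. intros x _. unfold scal; simpl; unfold mult; simpl.
  replace (1 * x + c) with (c + x) by ring. ring.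
Qed.

(** The two sides of the zero are separate, so that zeros at the ends of [0, 1] are covered. *)
Lemma near_zero_limit s c : / INR q < s -> 0 <= c <= 1 -> h c = 0 -> exists r, 0 < r /\
  (forall y, c < y <= c + r -> exists l, 0 < l /\
    filterlim (fun d => Rpower d (s - / INR q) * RInt (fun a => Rpower (d + h a) (- s)) c y)
      (at_right 0) (locally l)) /\
  (forall x, c - r <= x < c -> exists l, 0 < l /\
    filterlim (fun d => Rpower d (s - / INR q) * RInt (fun a => Rpower (d + h a) (- s)) x c)
      (at_right 0) (locally l)).
Proof.
  intros Hs Hc Hz. assert (Hs' := order_mult_gt s Hs).
  destruct (h_zeros c Hc Hz) as [C [HC Hcmp]].
  destruct (one_sided_limit (fun x => h (c + x)) C s q) as [r1 [l1 [Hr1 [Hl1 Hlim1]]]]; auto.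
  { lia. }
  { intros x. cont. }
  { intros kap Hk. destruct (Hcmp kap Hk) as [rho [Hrho H']]. exists rho. split; auto.
    intros x Hx. specialize (H' (c + x)). replace (c + x - c) with x in H' by ring.
    rewrite Rabs_pos_eq in H' by lra. apply H'. lra. }
  destruct (one_sided_limit (fun x => h (c - x)) C s q) as [r2 [l2 [Hr2 [Hl2 Hlim2]]]]; auto.
  { lia. }
  { intros x. cont. }
  { intros kap Hk. destruct (Hcmp kap Hk) as [rho [Hrho H']]. exists rho. split; auto.
    intros x Hx. specialize (H' (c - x)). replace (c - x - c) with (- x) in H' by ring.
    rewrite Rabs_Ropp, Rabs_pos_eq in H' by lra. apply H'. lra. }
  exists (Rmin r1 r2). assert (Rmin r1 r2 <= r1) by apply Rmin_l.
  assert (Rmin r1 r2 <= r2) by apply Rmin_r.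
  split; [apply Rmin_glb_lt; auto|]. split.
  - intros y Hy. exists l1. split; [exact Hl1|].
    assert (Hyc : 0 < y - c <= r1) by lra. generalize (Hlim1 (y - c) Hyc). apply filterlim_ext_loc.
    generalize (at_right_0_lt 1 Rlt_0_1). apply filter_imp. intros d Hd. f_equal.
    rewrite <- (RInt_shift (fun x => Rpower (d + h x) (- s))) by (intros; apply integrand_cont; lra).
    f_equal; ring.
  - intros x Hx. exists l2. split; [exact Hl2|].
    assert (Hxc : 0 < c - x <= r2) by lra. generalize (Hlim2 (c - x) Hxc). apply filterlim_ext_loc.
    generalize (at_right_0_lt 1 Rlt_0_1). apply filter_imp. intros d Hd. f_equal.
    rewrite <- (RInt_reflect (fun x => Rpower (d + h x) (- s))) by (intros; apply integrand_cont; lra).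
    f_equal; ring.
Qed.

(** Limits over adjacent intervals add up, so the local limits glue; the sum is positive because
    some zero of [h] contributes to it. *)
Theorem sing_int_scaled_limit s : / INR q < s -> exists l, 0 < l /\
  filterlim (fun d => Rpower d (s - / INR q) * SI s d) (at_right 0) (locally l).
Proof.
  intros Hs.
  set (X := fun d => Rpower d (s - / INR q)).
  set (A := fun x y d => X d * RInt (fun a => Rpower (d + h a) (- s)) x y).
  set (P := fun x y => exists l, 0 <= l /\ filterlim (A x y) (at_right 0) (locally l)).
  assert (Hadd : forall x y z, P x y -> P y z -> P x z).
  { intros x y z [l1 [Hl1 H1]] [l2 [Hl2 H2]]. exists (l1 + l2). split; [lra|].
    generalize (lim_plus _ _ _ _ H1 H2). apply filterlim_ext_loc.
    generalize (at_right_0_lt 1 Rlt_0_1). apply filter_imp. intros d Hd. unfold A.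
    rewrite <- Rmult_plus_distr_l. f_equal. symmetry. apply RInt_split; apply integrand_ex; lra. }
  assert (Hdeg : forall c, P c c).
  { intros c. exists 0. split; [lra|]. apply filterlim_ext with (fun _ => 0).
    - intros d. unfold A. rewrite RInt_point. unfold zero; simpl. ring.
    - apply lim_const. }
  assert (Htot : P 0 1).
  { apply interval_gluing; [lra|intros; eapply Hadd; eauto|].
    intros c Hc. destruct (Rle_lt_or_eq_dec _ _ (h_nonneg c)) as [Hp|Hz].
    - destruct (away_from_zero_limit s c Hs Hp) as [r [Hr Hlim]].
      exists r. split; auto. split; intros y Hy _; exists 0; (split; [lra|]); apply Hlim; lra.
    - destruct (near_zero_limit s c Hs Hc (eq_sym Hz)) as [r [Hr [H1 H2]]].
      exists r. split; auto. split; intros y Hy _.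
      + destruct (Rle_lt_or_eq_dec c y) as [Hlt| <-]; [lra| |apply Hdeg].
        destruct (H1 y) as [l [Hl Hl']]; [lra|]. exists l. split; [lra|exact Hl'].
      + destruct (Rle_lt_or_eq_dec y c) as [Hlt| ->]; [lra| |apply Hdeg].
        destruct (H2 y) as [l [Hl Hl']]; [lra|]. exists l. split; [lra|exact Hl']. }
  destruct Htot as [l [_ Hl]]. exists l. split; [|exact Hl].
  assert (Hsub : exists x y l', 0 <= x /\ x <= y /\ y <= 1 /\ 0 < l' /\
                   filterlim (A x y) (at_right 0) (locally l')).
  { destruct h_zero_ex as [c [Hc Hz]].
    destruct (near_zero_limit s c Hs Hc Hz) as [r [Hr [H1 H2]]].
    destruct (Rlt_dec c 1) as [Hlt|Hge].
    - assert (c < Rmin (c + r) 1) by (apply Rmin_glb_lt; lra).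
      assert (Rmin (c + r) 1 <= c + r) by apply Rmin_l.
      assert (Rmin (c + r) 1 <= 1) by apply Rmin_r.
      destruct (H1 (Rmin (c + r) 1)) as [l' [Hl' Hlim']]; [lra|].
      exists c, (Rmin (c + r) 1), l'. repeat split; auto; lra.
    - assert (Rmax (c - r) 0 < c) by (apply Rmax_lub_lt; lra).
      assert (c - r <= Rmax (c - r) 0) by apply Rmax_l.
      assert (0 <= Rmax (c - r) 0) by apply Rmax_r.
      destruct (H2 (Rmax (c - r) 0)) as [l' [Hl' Hlim']]; [lra|].
      exists (Rmax (c - r) 0), c, l'. repeat split; auto; lra. }
  destruct Hsub as [x [y [l' [Hx [Hxy [Hy [Hl' Hlim]]]]]]].
  apply Rlt_le_trans with l'; [exact Hl'|].
  apply (filterlim_le (F := at_right 0) (A x y) (A 0 1) (Finite l') (Finite l)); auto.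
  generalize (at_right_0_lt 1 Rlt_0_1). apply filter_imp. intros d Hd.
  apply Rmult_le_compat_l; [left; apply Rpower_gt0|].
  apply (RInt_le_sub (fun a => Rpower (d + h a) (- s))); auto.
  - intros; apply integrand_cont; lra.
  - intros; left; apply Rpower_gt0.
Qed.

(** The value is forced by [H_s' = - s H_{s+1}]: the scaled integral has a limit, so its
    logarithmic slope, which tends to a combination of the two limits, must tend to 0. *)
Theorem sing_int_ratio_limit s : / INR q < s ->
  filterlim (fun d => d * SI (s + 1) d / SI s d) (at_right 0) (locally (1 - / (INR q * s))).
Proof.
  intros Hs. destruct order_inv_bounds as [Hq0 _].
  assert (HQ : 0 < INR q) by (apply lt_0_INR; lia).
  destruct (sing_int_scaled_limit s Hs) as [l0 [Hl0 H0]].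
  destruct (sing_int_scaled_limit (s + 1)) as [l1 [Hl1 H1]]; [lra|].
  set (e := s - / INR q) in *.
  replace (s + 1 - / INR q) with (e + 1) in H1 by (unfold e; ring).
  assert (Hpow : forall d, 0 < d -> Rpower d (e + 1) = Rpower d e * d).
  { intros d Hd. rewrite Rpower_plus, Rpower_1; auto. }
  assert (Hc : e * l0 - s * l1 = 0).
  { apply (log_slope_zero (fun d => Rpower d e * SI s d)
      (fun d => e * (Rpower d e * SI s d) - s * (Rpower d (e + 1) * SI (s + 1) d)) l0); auto.
    - intros d Hd.
      replace ((e * (Rpower d e * SI s d) - s * (Rpower d (e + 1) * SI (s + 1) d)) / d)
        with (e * Rpower d (e - 1) * SI s d + Rpower d e * (- s * SI (s + 1) d)).
      + apply (is_derive_mult (fun d => Rpower d e) (SI s)).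
        * apply is_derive_Rpower; lra.
        * apply sing_int_derive; lra.
        * intros; apply Rmult_comm.
      + rewrite Hpow by lra.
        replace (Rpower d e) with (Rpower d (e - 1) * d).
        2:{ replace e with (e - 1 + 1) at 2 by ring. rewrite Rpower_plus, Rpower_1; lra. }
        field; lra.
    - apply lim_minus; (apply lim_mult; [apply lim_const|assumption]). }
  replace (1 - / (INR q * s)) with (l1 / l0).
  2:{ apply Rmult_eq_reg_r with l0; [|lra]. unfold Rdiv. rewrite Rmult_assoc, Rinv_l, Rmult_1_r by lra.
      apply Rmult_eq_reg_l with s; [|lra]. unfold e in Hc.
      replace (s * ((1 - / (INR q * s)) * l0)) with ((s - / INR q) * l0) by (field; lra). lra. }
  assert (Hdiv := lim_div _ _ _ _ (Rgt_not_eq _ _ Hl0) H1 H0).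
  revert Hdiv. apply filterlim_ext_loc.
  generalize (at_right_0_lt 1 Rlt_0_1). apply filter_imp. intros d Hd.
  rewrite Hpow by lra. assert (0 < Rpower d e) by apply Rpower_gt0.
  assert (0 < SI s d) by (apply sing_int_pos; lra). field; lra.
Qed.

(** Cauchy-Schwarz inequality: the integral of [(d + h)^-s (1 - t / (d + h))^2] is a nonnegative
    quadratic polynomial in [t]. *)
Lemma sing_int_log_convex s d : 0 < d -> SI (s + 1) d ^ 2 <= SI s d * SI (s + 2) d.
Proof.
  intros Hd.
  assert (P0 := sing_int_pos s d Hd). assert (P1 := sing_int_pos (s + 1) d Hd).
  assert (P2 := sing_int_pos (s + 2) d Hd).
  (* the minimizer of the quadratic polynomial *)
  set (t := SI (s + 1) d / SI (s + 2) d).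
  assert (E : 0 <= SI s d + (- 2 * t * SI (s + 1) d + t ^ 2 * SI (s + 2) d)).
  { unfold sing_int at 1 2 3.
    rewrite <- !RInt_mult_l by (apply integrand_ex, Hd).
    rewrite <- RInt_add.
    2,3: apply continuous_ex_RInt; intros; apply cont_mult; [cont|apply integrand_cont, Hd].
    rewrite <- RInt_add.
    2: apply integrand_ex, Hd.
    2: apply continuous_ex_RInt; intros; apply cont_plus; apply cont_mult; cont; try (apply integrand_cont, Hd).
    2,3: generalize (h_nonneg x); lra.
    apply RInt_nonneg; [lra| |].
    - apply continuous_ex_RInt; intros; cont; generalize (h_nonneg x); lra.
    - intros a _. generalize (h_nonneg a). intros Ha.
      set (y := Rpower (d + h a) (-1)).
      assert (E1 : Rpower (d + h a) (- (s + 1)) = Rpower (d + h a) (- s) * y).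
      { unfold y. rewrite <- Rpower_plus. f_equal. ring. }
      assert (E2 : Rpower (d + h a) (- (s + 2)) = Rpower (d + h a) (- s) * y * y).
      { unfold y. rewrite <- !Rpower_plus. f_equal. ring. }
      rewrite E1, E2. assert (0 < Rpower (d + h a) (- s)) by apply Rpower_gt0.
      replace (Rpower (d + h a) (- s) + (- 2 * t * (Rpower (d + h a) (- s) * y)
         + t ^ 2 * (Rpower (d + h a) (- s) * y * y)))
        with (Rpower (d + h a) (- s) * (1 - t * y) ^ 2) by ring.
      apply Rmult_le_pos; [lra|]. apply pow2_ge_0. }
  replace (SI s d + (-2 * t * SI (s + 1) d + t ^ 2 * SI (s + 2) d))
    with (SI s d - SI (s + 1) d ^ 2 / SI (s + 2) d) in E by (unfold t; field; lra).
  apply (Rmult_le_compat_r (SI (s + 2) d)) in E; [|lra].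
  replace ((SI s d - SI (s + 1) d ^ 2 / SI (s + 2) d) * SI (s + 2) d)
    with (SI s d * SI (s + 2) d - SI (s + 1) d ^ 2) in E by (field; lra).
  lra.
Qed.

Lemma sing_int_exponent_le s s' : s <= s' -> exists K, 0 < K /\
  forall d, 0 < d < 1 -> SI s d <= K * SI s' d.
Proof.
  intros Hs. destruct h_bounded as [B [HB Hh]].
  exists (Rpower (1 + B) (s' - s)). split; [apply Rpower_gt0|]. intros d Hd.
  unfold sing_int. rewrite <- RInt_mult_l by (apply integrand_ex; lra).
  apply RInt_le; [lra|apply integrand_ex; lra| |].
  - apply (ex_RInt_scal (fun a => Rpower (d + h a) (- s'))), integrand_ex. lra.
  - intros a Ha. assert (h a <= B) by (apply Hh; lra). assert (0 <= h a) by auto.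
    replace (- s) with ((s' - s) + - s') by ring. rewrite Rpower_plus.
    apply Rmult_le_compat_r; [left; apply Rpower_gt0|]. apply Rpower_le_base; lra.
Qed.

(** The case [s <= 1/q] is included: [H_s] is at most a multiple of [H_{e + 1/q}], whose exponent
    is supercritical. *)
Lemma sing_int_upper s e : 0 < e -> s - / INR q < e -> exists C, 0 < C /\
  at_right 0 (fun d => SI s d <= C * Rpower d (- e)).
Proof.
  intros He Hs. destruct order_inv_bounds as [Hq0 _].
  destruct (sing_int_exponent_le s (e + / INR q)) as [K [HK HKle]]; [lra|].
  destruct (sing_int_scaled_limit (e + / INR q)) as [l [Hl Hlim]]; [lra|].
  replace (e + / INR q - / INR q) with e in Hlim by ring.
  exists (K * (l + 1)). split; [apply Rmult_lt_0_compat; lra|].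
  assert (G : l < l + 1) by lra.
  generalize (filter_and _ _ (at_right_0_lt 1 Rlt_0_1) (lim_eventually_lt _ _ _ Hlim G)).
  apply filter_imp. intros d [Hd Hlt].
  apply Rle_trans with (1 := HKle d Hd). rewrite Rmult_assoc. apply Rmult_le_compat_l; [lra|].
  rewrite Rpower_Ropp. assert (0 < Rpower d e) by apply Rpower_gt0.
  apply Rmult_le_reg_l with (Rpower d e); auto.
  replace (Rpower d e * ((l + 1) * / Rpower d e)) with (l + 1) by (field; lra). lra.
Qed.

Lemma sing_int_lower s : / INR q < s -> exists c, 0 < c /\
  at_right 0 (fun d => c * Rpower d (/ INR q - s) <= SI s d).
Proof.
  intros Hs. destruct (sing_int_scaled_limit s Hs) as [l [Hl Hlim]].
  exists (l / 2). split; [lra|]. assert (G : l / 2 < l) by lra.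
  generalize (filter_and _ _ (at_right_0_lt 1 Rlt_0_1) (lim_eventually_gt _ _ _ Hlim G)).
  apply filter_imp. intros d [Hd Hgt].
  replace (/ INR q - s) with (- (s - / INR q)) by ring. rewrite Rpower_Ropp.
  assert (0 < Rpower d (s - / INR q)) by apply Rpower_gt0.
  apply Rmult_le_reg_l with (Rpower d (s - / INR q)); auto.
  replace (Rpower d (s - / INR q) * (l / 2 * / Rpower d (s - / INR q))) with (l / 2) by (field; lra).
  lra.
Qed.

Lemma sing_int_lower_const s : exists c, 0 < c /\ forall d, 0 < d < 1 -> c <= SI s d.
Proof.
  destruct h_bounded as [B [HB Hh]].
  destruct (Rle_lt_dec 0 s) as [Hs|Hs].
  - exists (Rpower (1 + B) (- s)). split; [apply Rpower_gt0|]. intros d Hd.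
    unfold sing_int. replace (Rpower (1 + B) (- s)) with ((1 - 0) * Rpower (1 + B) (- s)) by ring.
    rewrite <- RInt_constR. apply RInt_le; [lra|apply ex_RInt_const|apply integrand_ex; lra|].
    intros a Ha. assert (h a <= B) by (apply Hh; lra). assert (0 <= h a) by auto.
    apply Rpower_anti_base; lra.
  - destruct h_pos_ex as [c [Hc Hp]].
    destruct (locally_ball_elim (fun x => h c / 2 < h x) c) as [r [Hr Hr']].
    { apply (lim_eventually_gt h (h c)); [apply h_cont|lra]. }
    assert (Hsub : exists x y, 0 <= x /\ x < y /\ y <= 1 /\ forall z, x < z < y -> Rabs (z - c) < r).
    { destruct (Rlt_dec c 1) as [Hlt|Hge].
      - exists c, (Rmin (c + r) 1). assert (c < Rmin (c + r) 1) by (apply Rmin_glb_lt; lra).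
        assert (Rmin (c + r) 1 <= c + r) by apply Rmin_l.
        assert (Rmin (c + r) 1 <= 1) by apply Rmin_r.
        repeat split; try lra. intros z Hz. apply Rabs_def1; lra.
      - exists (Rmax (c - r) 0), c. assert (Rmax (c - r) 0 < c) by (apply Rmax_lub_lt; lra).
        assert (c - r <= Rmax (c - r) 0) by apply Rmax_l.
        assert (0 <= Rmax (c - r) 0) by apply Rmax_r.
        repeat split; try lra. intros z Hz. apply Rabs_def1; lra. }
    destruct Hsub as [x [y [Hx [Hxy [Hy Hz]]]]].
    exists ((y - x) * Rpower (h c / 2) (- s)).
    split; [apply Rmult_lt_0_compat; [lra|apply Rpower_gt0]|]. intros d Hd.
    apply Rle_trans with (RInt (fun a => Rpower (d + h a) (- s)) x y).
    + rewrite <- RInt_constR. apply RInt_le; [lra|apply ex_RInt_const|apply integrand_ex; lra|].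
      intros a Ha. assert (h c / 2 < h a) by (apply Hr', Hz, Ha).
      apply Rpower_le_base; lra.
    + apply (RInt_le_sub (fun a => Rpower (d + h a) (- s))); try lra.
      * intros; apply integrand_cont; lra.
      * intros; left; apply Rpower_gt0.
Qed.

(** Below the critical exponent the integral stays bounded: [H_s' = - s H_{s+1}] is
    at most a multiple of [d^-e] with [e < 1], which is integrable at 0. *)
Lemma sing_int_subcritical_bounded s : 0 <= s -> s < / INR q ->
  exists C, at_right 0 (fun d => SI s d <= C).
Proof.
  intros Hs0 Hs. destruct order_inv_bounds as [Hq0 Hq1].
  set (e := 1 - (/ INR q - s) / 2).
  destruct (sing_int_upper (s + 1) e) as [C [HC Hup]]; [unfold e; lra|unfold e; lra|].
  destruct (at_right_elim _ _ Hup) as [r [Hr Hr']].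
  set (u := r / 2). assert (Hu : 0 < u < r) by (unfold u; lra).
  assert (He : 0 < 1 - e) by (unfold e; lra).
  set (K := s * C / (1 - e)).
  assert (HK : 0 <= K).
  { unfold K. apply Rmult_le_pos; [apply Rmult_le_pos; lra|]. left; apply Rinv_0_lt_compat, He. }
  exists (SI s u + K * Rpower u (1 - e)).
  apply (at_right_intro _ 0 u); [lra|]. intros d Hd.
  assert (E : SI s d + K * Rpower d (1 - e) <= SI s u + K * Rpower u (1 - e)).
  { apply (derive_nonneg_le (fun x => SI s x + K * Rpower x (1 - e))
      (fun x => - s * SI (s + 1) x + K * ((1 - e) * Rpower x (1 - e - 1)))); [lra|..].
    - intros x Hx. apply (is_derive_plus (SI s)).
      + apply sing_int_derive; lra.
      + apply (is_derive_scal (fun x => Rpower x (1 - e))), is_derive_Rpower; lra.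
    - intros x Hx. assert (Hx' : 0 < x < r) by lra. apply cont_plus; [|cont].
      apply (is_derive_continuous _ _ _ (sing_int_derive s x (proj1 Hx'))).
    - intros x Hx. assert (SI (s + 1) x <= C * Rpower x (- e)) by (apply Hr'; lra).
      replace (1 - e - 1) with (- e) by ring.
      replace (K * ((1 - e) * Rpower x (- e))) with (s * (C * Rpower x (- e)))
        by (unfold K; field; lra).
      assert (s * SI (s + 1) x <= s * (C * Rpower x (- e))) by (apply Rmult_le_compat_l; lra).
      lra. }
  assert (0 < Rpower d (1 - e)) by apply Rpower_gt0. nra.
Qed.

(** The integral is monotone in [d] and stays between positive bounds near 0. *)
Theorem sing_int_subcritical_limit s : s < / INR q -> exists l, 0 < l /\
  filterlim (SI s) (at_right 0) (locally l).
Proof.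
  intros Hs. destruct (sing_int_lower_const s) as [c [Hc Hlow]].
  assert (Hmono : forall x y, 0 < x -> x <= y -> 0 <= s -> SI s y <= SI s x).
  { intros x y Hx Hxy Hs0. apply RInt_le; [lra|apply integrand_ex; lra..|].
    intros a _. generalize (h_nonneg a). intros. apply Rpower_anti_base; lra. }
  assert (Hmono' : forall x y, 0 < x -> x <= y -> s <= 0 -> SI s x <= SI s y).
  { intros x y Hx Hxy Hs0. apply RInt_le; [lra|apply integrand_ex; lra..|].
    intros a _. generalize (h_nonneg a). intros. apply Rpower_le_base; lra. }
  destruct (Rle_lt_dec 0 s) as [Hs0|Hs0].
  - destruct (sing_int_subcritical_bounded s Hs0 Hs) as [C HC].
    destruct (at_right_elim _ _ HC) as [r [Hr Hr']].
    destruct (monotone_bounded_limit (at_right 0) _ (SI s) (fun d => 0 < d < Rmin r 1) C)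
      as [l [Hl1 Hl2]].
    + apply at_right_0_lt. apply Rmin_glb_lt; lra.
    + intros x Hx. apply (at_right_intro _ 0 x); [lra|]. intros y Hy. apply Hmono; lra.
    + intros x Hx. apply Hr'. assert (Rmin r 1 <= r) by apply Rmin_l. lra.
    + exists l. split; [|exact Hl1].
      assert (0 < Rmin r 1) by (apply Rmin_glb_lt; lra).
      apply Rlt_le_trans with (SI s (Rmin r 1 / 2)); [apply sing_int_pos; lra|apply Hl2; lra].
  - destruct (monotone_bounded_limit (at_right 0) _ (fun d => - SI s d) (fun d => 0 < d < 1) (- c))
      as [l [Hl1 Hl2]].
    + apply at_right_0_lt, Rlt_0_1.
    + intros x Hx. apply (at_right_intro _ 0 x); [lra|]. intros y Hy.
      apply Ropp_le_contravar, Hmono'; lra.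
    + intros x Hx. apply Ropp_le_contravar, Hlow, Hx.
    + apply lim_opp in Hl1. exists (- l). split.
      * apply Rlt_le_trans with c; [exact Hc|].
        apply (filterlim_le (F := at_right 0) (fun _ => c) (fun d => - - SI s d) (Finite c) (Finite (- l))).
        -- generalize (at_right_0_lt 1 Rlt_0_1). apply filter_imp. intros d Hd.
           rewrite Ropp_involutive. apply Hlow, Hd.
        -- apply lim_const.
        -- exact Hl1.
      * revert Hl1. apply filterlim_ext. intros d. apply Ropp_involutive.
Qed.

End SingularIntegral.

Lemma pow0_pos x p : 0 < x -> pow0 x p = Rpower x p.
Proof. intros Hx. unfold pow0. destruct (Rlt_dec 0 x); [reflexivity|contradiction]. Qed.

Lemma pow0_nonpos x p : x <= 0 -> pow0 x p = 0.
Proof. intros Hx. unfold pow0. destruct (Rlt_dec 0 x); [lra|reflexivity]. Qed.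

Lemma pow0_nonneg x p : 0 <= pow0 x p.
Proof. unfold pow0. destruct (Rlt_dec 0 x); [left; apply Rpower_gt0|lra]. Qed.

Lemma pow0_mult x y p : 0 < y -> pow0 (x * y) p = pow0 x p * Rpower y p.
Proof.
  intros Hy. destruct (Rlt_le_dec 0 x) as [Hx|Hx].
  - rewrite !pow0_pos by nra. symmetry. apply Rpower_mult_distr; auto.
  - rewrite !pow0_nonpos by nra. ring.
Qed.

Lemma pow0_continuous p x : 0 < p -> continuous (fun y => pow0 y p) x.
Proof.
  intros Hp. destruct (total_order_T x 0) as [[Hx|Hx]|Hx].
  - apply continuous_ext_loc with (fun _ => 0); [|apply continuous_const].
    apply (locally_ball_intro _ x (- x)); [lra|]. intros y Hy. apply Rabs_def2 in Hy.
    symmetry. apply pow0_nonpos. lra.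
  - subst x. unfold continuous. rewrite (pow0_nonpos 0) by lra. apply lim_eps. intros eps Heps.
    destruct (at_right_elim _ _ (proj1 (lim_eps _ _) (Rpower_pos_small p Hp) eps Heps)) as [r [Hr Hr']].
    apply (locally_ball_intro _ 0 r Hr). intros y Hy. rewrite Rminus_0_r in *.
    apply Rabs_def2 in Hy. destruct (Rlt_le_dec 0 y) as [H0|H0].
    + rewrite pow0_pos by exact H0. specialize (Hr' y). rewrite Rminus_0_r in Hr'. apply Hr'. lra.
    + rewrite pow0_nonpos by exact H0. rewrite Rabs_R0. exact Heps.
  - apply continuous_ext_loc with (fun y => Rpower y p); [|cont].
    apply (locally_ball_intro _ x x Hx). intros y Hy. apply Rabs_def2 in Hy.
    symmetry. apply pow0_pos. lra.
Qed.

(** Bernoulli's inequality for real exponents, from [ln x >= 1 - 1/x]. *)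
Lemma pow0_bernoulli x p : 1 <= p -> 0 <= x -> 1 + p * (x - 1) <= pow0 x p.
Proof.
  intros Hp Hx. destruct (Rle_lt_or_eq_dec _ _ Hx) as [Hx0| <-].
  2:{ rewrite pow0_nonpos; lra. }
  rewrite pow0_pos by exact Hx0.
  replace p with (1 + (p - 1)) at 2 by ring. rewrite Rpower_plus, Rpower_1 by exact Hx0.
  assert (Hln : 1 - / x <= ln x).
  { assert (H : 1 + ln (/ x) <= exp (ln (/ x))) by apply exp_ineq1_le.
    rewrite exp_ln in H by (apply Rinv_0_lt_compat, Hx0). rewrite ln_Rinv in H by exact Hx0. lra. }
  assert (H1 : 1 + (p - 1) * ln x <= Rpower x (p - 1)) by apply exp_ineq1_le.
  assert (H2 : (p - 1) * (1 - / x) <= (p - 1) * ln x) by (apply Rmult_le_compat_l; lra).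
  assert (H3 : x * (1 + (p - 1) * (1 - / x)) <= x * Rpower x (p - 1)) by (apply Rmult_le_compat_l; lra).
  replace (x * (1 + (p - 1) * (1 - / x))) with (1 + p * (x - 1)) in H3 by (field; lra).
  exact H3.
Qed.

Lemma pow0_ge_minus_1 x p : 1 <= p -> 0 <= x -> x - 1 <= pow0 x p.
Proof.
  intros Hp Hx. destruct (Rle_lt_dec 1 x).
  - generalize (pow0_bernoulli x p Hp Hx). nra.
  - generalize (pow0_nonneg x p). lra.
Qed.

(** * Blow-up profile as the singularity is approached *)

(** Up to the sign of [lam], [u_x] along the characteristic from [a], and the Jacobian of the
    flow, in terms of [d = 1 / (|lam| eta) - |extremum of u0'|], which tends to 0 at [t_*]. *)
Definition profile (h : R -> R) (lam d a : R) : R :=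
  Rpower (sing_int h (/ lam) d) (- 2 * lam) *
  (/ (d + h a) - sing_int h (/ lam + 1) d / sing_int h (/ lam) d).

Definition density (h : R -> R) (lam d a : R) : R :=
  Rpower (d + h a) (- / lam) / sing_int h (/ lam) d.

(** The [p]-th power of the norm of [u_x] in [L^p(0,1)], as an integral over labels. *)
Definition profile_mass (h : R -> R) (lam p d : R) : R :=
  RInt (fun a => pow0 (Rabs (profile h lam d a)) p * density h lam d a) 0 1.

Section Profile.
Context (h : R -> R) (q : nat).
Context (h_cont : forall x, continuous h x) (h_nonneg : forall x, 0 <= h x).
Context (q_ge : (2 <= q)%nat).
Context (h_zeros : forall a, 0 <= a <= 1 -> h a = 0 -> power_zero h q a).
Context (h_zero_ex : exists a, 0 <= a <= 1 /\ h a = 0).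
Context (h_pos_ex : exists a, 0 <= a <= 1 /\ 0 < h a).
Notation SI := (sing_int h).

Let SI_pos := sing_int_pos h h_cont h_nonneg.
Let q_bounds := order_inv_bounds q q_ge.
Let scaled_limit := sing_int_scaled_limit h q h_cont h_nonneg q_ge h_zeros h_zero_ex.
Let ratio_limit := sing_int_ratio_limit h q h_cont h_nonneg q_ge h_zeros h_zero_ex.
Let upper := sing_int_upper h q h_cont h_nonneg q_ge h_zeros h_zero_ex.
Let lower := sing_int_lower h q h_cont h_nonneg q_ge h_zeros h_zero_ex.
Let lower_const := sing_int_lower_const h h_cont h_nonneg h_pos_ex.
Let subcritical_limit :=
  sing_int_subcritical_limit h q h_cont h_nonneg q_ge h_zeros h_zero_ex h_pos_ex.

Lemma ratio_le_1 s d : 0 < d -> d * SI (s + 1) d / SI s d <= 1.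
Proof.
  intros Hd. assert (H0 := SI_pos s d Hd).
  apply Rmult_le_reg_r with (SI s d); auto. unfold Rdiv.
  rewrite Rmult_assoc, Rinv_l, Rmult_1_l, Rmult_1_r by lra.
  unfold sing_int. rewrite <- RInt_mult_l by (apply integrand_ex; auto).
  apply RInt_le; [lra| |apply integrand_ex; auto|].
  - apply (ex_RInt_scal (fun a => Rpower (d + h a) (- (s + 1)))), integrand_ex; auto.
  - intros a _. generalize (h_nonneg a). intros Ha.
    replace (- s) with (1 + - (s + 1)) by ring. rewrite Rpower_plus, Rpower_1 by lra.
    apply Rmult_le_compat_r; [left; apply Rpower_gt0|lra].
Qed.

(** Log-convexity in the exponent makes the ratio increase with [s], which reduces every
    exponent to a supercritical one, where the limit of the ratio is known. *)
Lemma ratio_eventually_lt s c : / INR q < s + 1 -> 1 - / (INR q * (s + 1)) < c ->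
  at_right 0 (fun d => d * SI (s + 1) d / SI s d < c).
Proof.
  intros Hs Hc.
  generalize (filter_and _ _ (at_right_0_lt 1 Rlt_0_1)
    (lim_eventually_lt _ _ _ (ratio_limit (s + 1) Hs) Hc)).
  apply filter_imp. intros d [Hd Hlt].
  assert (H0 := SI_pos s d (proj1 Hd)). assert (H1 := SI_pos (s + 1) d (proj1 Hd)).
  apply Rle_lt_trans with (2 := Hlt).
  replace (s + 1 + 1) with (s + 2) by ring.
  assert (HC := sing_int_log_convex h h_cont h_nonneg s d (proj1 Hd)).
  unfold Rdiv. rewrite !Rmult_assoc. apply Rmult_le_compat_l; [lra|].
  apply Rmult_le_reg_r with (SI s d * SI (s + 1) d); [apply Rmult_lt_0_compat; lra|].
  replace (SI (s + 1) d * / SI s d * (SI s d * SI (s + 1) d)) with (SI (s + 1) d ^ 2) by (field; lra).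
  replace (SI (s + 2) d * / SI (s + 1) d * (SI s d * SI (s + 1) d)) with (SI s d * SI (s + 2) d)
    by (field; lra).
  exact HC.
Qed.

Lemma ratio_limit_lt_1 s : 0 < s -> 1 - / (INR q * s) < 1.
Proof.
  intros Hs. assert (0 < INR q) by (apply lt_0_INR; lia).
  assert (0 < / (INR q * s)) by (apply Rinv_0_lt_compat, Rmult_lt_0_compat; lra). lra.
Qed.

Lemma ratio_limit_increasing s : 0 < s -> 1 - / (INR q * s) < 1 - / (INR q * (s + 1)).
Proof.
  intros Hs. assert (0 < INR q) by (apply lt_0_INR; lia).
  assert (/ (INR q * (s + 1)) < / (INR q * s)); [|lra].
  apply Rinv_lt_contravar; [|nra].
  repeat apply Rmult_lt_0_compat; lra.
Qed.

(** In the last factor both terms lie in [0, 1], so that the first factors give the rate and the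
    last one the sign. *)
Lemma profile_factored lam d a : 0 < d ->
  profile h lam d a =
  Rpower (SI (/ lam) d) (- 2 * lam) * / d *
    (d / (d + h a) - d * SI (/ lam + 1) d / SI (/ lam) d).
Proof.
  intros Hd. generalize (h_nonneg a). intros Ha. assert (H0 := SI_pos (/ lam) d Hd).
  unfold profile. field. lra.
Qed.

Lemma Rpower_combine c x e f : 0 < c -> 0 < x ->
  Rpower (c * Rpower x e) f = Rpower c f * Rpower x (e * f).
Proof.
  intros Hc Hx. rewrite <- Rpower_mult_distr by (auto; apply Rpower_gt0).
  rewrite Rpower_mult. reflexivity.
Qed.

Lemma Rpower_scale_inv x e : 0 < x -> Rpower x e * / x = Rpower x (e - 1).
Proof.
  intros Hx. unfold Rminus. rewrite Rpower_plus, Rpower_Ropp, Rpower_1 by exact Hx. reflexivity.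
Qed.

Lemma inv_lt_of_lt_mult lam c : 0 < lam -> 0 < c -> lam < c -> / c < / lam.
Proof. intros. apply Rinv_lt_contravar; auto. apply Rmult_lt_0_compat; auto. Qed.

(** Since [H_(1/lam)] is at least a multiple of [d^(1/q - 1/lam)], the factor in front of the
    difference is at most a multiple of [d^(1 - 2 lam / q)]. *)
Lemma profile_vanishes lam a : 0 < lam -> lam < INR q / 2 ->
  filterlim (fun d => profile h lam d a) (at_right 0) (locally 0).
Proof.
  intros Hl0 Hl.
  assert (HQ : 0 < INR q) by (apply lt_0_INR; lia).
  assert (Hs : 2 * / INR q < / lam).
  { replace (2 * / INR q) with (/ (INR q / 2)) by (field; lra). apply inv_lt_of_lt_mult; lra. }
  destruct (lower (/ lam)) as [c [Hc Hlow]]; [lra|].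
  set (e := 2 - 2 * lam * / INR q - 1).
  apply (lim_squeeze0 _ (fun d => Rpower c (- 2 * lam) * Rpower d e)).
  - generalize (filter_and _ _ (at_right_0_lt 1 Rlt_0_1) Hlow). apply filter_imp.
    intros d [Hd Hlowd]. rewrite profile_factored by lra.
    assert (H0 := SI_pos (/ lam) d (proj1 Hd)). assert (H1 := SI_pos (/ lam + 1) d (proj1 Hd)).
    assert (Hr := ratio_le_1 (/ lam) d (proj1 Hd)).
    assert (Hr0 : 0 < d * SI (/ lam + 1) d / SI (/ lam) d)
      by (apply Rdiv_lt_0_compat; [apply Rmult_lt_0_compat|]; lra).
    generalize (h_nonneg a). intros Ha.
    assert (Hy : 0 < d / (d + h a) <= 1).
    { split; [apply Rdiv_lt_0_compat; lra|]. apply Rmult_le_reg_r with (d + h a); [lra|].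
      unfold Rdiv. rewrite Rmult_assoc, Rinv_l; lra. }
    rewrite Rabs_mult.
    assert (Hb : Rabs (d / (d + h a) - d * SI (/ lam + 1) d / SI (/ lam) d) <= 1)
      by (apply Rabs_le; lra).
    assert (Hp : 0 < Rpower (SI (/ lam) d) (- 2 * lam) * / d).
    { apply Rmult_lt_0_compat; [apply Rpower_gt0|apply Rinv_0_lt_compat; lra]. }
    rewrite Rabs_pos_eq by lra.
    apply Rle_trans with (Rpower (SI (/ lam) d) (- 2 * lam) * / d); [nra|].
    unfold e. rewrite <- Rpower_scale_inv, <- Rmult_assoc by lra.
    apply Rmult_le_compat_r; [left; apply Rinv_0_lt_compat; lra|].
    replace (2 - 2 * lam * / INR q) with ((/ INR q - / lam) * (- 2 * lam)) by (field; lra).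
    rewrite <- Rpower_combine by lra.
    apply Rpower_anti_base; [apply Rmult_lt_0_compat; [lra|apply Rpower_gt0]|exact Hlowd|lra].
  - replace (locally 0) with (locally (Rpower c (- 2 * lam) * 0)) by (f_equal; ring).
    apply lim_mult; [apply lim_const|]. apply Rpower_pos_small. unfold e.
    assert (lam * (2 * / INR q) < lam * / lam) by (apply Rmult_lt_compat_l; lra).
    rewrite Rinv_r in * by lra. lra.
Qed.

(** At [lam = q / 2] the factor in front of the difference tends to a positive number, the first
    term of the difference to 0 or 1, and the second to 1/2. *)
Lemma profile_critical_limit lam a : lam = INR q / 2 -> exists v,
  filterlim (fun d => profile h lam d a) (at_right 0) (locally v) /\ (0 < h a -> v <> 0).
Proof.
  intros Hl.
  assert (HQ : 2 <= INR q) by (generalize (le_INR 2 q q_ge); simpl; lra).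
  assert (Hl0 : 0 < lam) by lra.
  assert (Hs : / lam = 2 * / INR q) by (rewrite Hl; field; lra).
  assert (Hs1 : / INR q < / lam) by lra.
  destruct (scaled_limit (/ lam) Hs1) as [l [Hl' Hlim]].
  assert (Hr := ratio_limit (/ lam) Hs1).
  replace (1 - / (INR q * / lam)) with (/ 2) in Hr by (rewrite Hl; field; lra).
  assert (Hy : exists y, filterlim (fun d => d / (d + h a)) (at_right 0) (locally y) /\ (0 < h a -> y = 0)).
  { destruct (Rle_lt_or_eq_dec _ _ (h_nonneg a)) as [Hp|Hz].
    - exists 0. split; auto.
      replace (locally 0) with (locally (0 / (0 + h a))) by (f_equal; field; lra).
      apply (filterlim_filter_le_1 (G := at_right 0) (F := locally 0)).
      + intros P [e' He']. exists e'. intros; auto.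
      + apply (cont_div (fun d => d) (fun d => d + h a) 0); cont.
    - exists 1. split; [|lra]. apply filterlim_ext_loc with (fun _ => 1); [|apply lim_const].
      generalize (at_right_0_lt 1 Rlt_0_1). apply filter_imp. intros d Hd. rewrite <- Hz. field. lra. }
  destruct Hy as [y [Hy Hy0]].
  exists (Rpower l (- 2 * lam) * (y - / 2)). split.
  2:{ intros Hp. rewrite (Hy0 Hp). assert (0 < Rpower l (- 2 * lam)) by apply Rpower_gt0. nra. }
  generalize (lim_mult _ _ _ _ (lim_Rpower _ _ (- 2 * lam) Hl' Hlim) (lim_minus _ _ _ _ Hy Hr)).
  apply filterlim_ext_loc. generalize (at_right_0_lt 1 Rlt_0_1). apply filter_imp. intros d Hd.
  rewrite profile_factored by lra. f_equal.
  rewrite <- Rpower_mult_distr by (try apply Rpower_gt0; apply SI_pos; lra).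
  rewrite Rpower_mult. replace ((/ lam - / INR q) * (- 2 * lam)) with (- (1)) by (rewrite Hl; field; lra).
  rewrite Rpower_Ropp, Rpower_1 by lra. ring.
Qed.

(** For every such [e], [H_(1/lam)] is at most a multiple of [d^-e].  The condition
    [2 lam e < 1] yields a finite life span and divergence at the zeros of [h]; the last condition
    yields divergence elsewhere. *)
Lemma supercritical_exponent lam : INR q / 2 < lam -> exists e, 0 < e /\ / lam - / INR q < e /\
  2 * lam * e < 1 /\ e * (2 * lam + 1) < 1 + / lam - / INR q.
Proof.
  intros Hl. assert (HQ : 0 < INR q) by (apply lt_0_INR; lia).
  assert (Hl0 : 0 < lam) by lra.
  assert (Hs0 : 0 < / lam) by (apply Rinv_0_lt_compat; lra).
  assert (Hs : / lam < 2 * / INR q).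
  { replace (2 * / INR q) with (/ (INR q / 2)) by (field; lra). apply inv_lt_of_lt_mult; lra. }
  set (e0 := Rmax 0 (/ lam - / INR q)).
  set (e1 := Rmin (/ lam / 2) ((1 + / lam - / INR q) / (2 * lam + 1))).
  assert (Hll : lam * / lam = 1) by (apply Rinv_r; lra).
  assert (He : e0 < e1).
  { apply Rmin_glb_lt; apply Rmax_lub_lt; try lra.
    - apply Rdiv_lt_0_compat; lra.
    - apply Rmult_lt_reg_r with (2 * lam + 1); [lra|].
      unfold Rdiv at 1. rewrite Rmult_assoc, Rinv_l, Rmult_1_r by lra.
      assert (lam * (/ lam - / INR q) < lam * (/ lam / 2)) by (apply Rmult_lt_compat_l; lra). nra. }
  assert (H0 : 0 <= e0) by apply Rmax_l. assert (H1 : / lam - / INR q <= e0) by apply Rmax_r.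
  assert (H2 : e1 <= / lam / 2) by apply Rmin_l.
  assert (H3 : e1 <= (1 + / lam - / INR q) / (2 * lam + 1)) by apply Rmin_r.
  exists ((e0 + e1) / 2). repeat split; try lra.
  - assert (lam * ((e0 + e1) / 2) < lam * (/ lam / 2)) by (apply Rmult_lt_compat_l; lra). nra.
  - apply Rlt_le_trans with (e1 * (2 * lam + 1)); [apply Rmult_lt_compat_r; lra|].
    apply (Rmult_le_compat_r (2 * lam + 1)) in H3; [|lra].
    unfold Rdiv in H3. rewrite (Rmult_assoc _ (/ _)), Rinv_l, Rmult_1_r in H3 by lra. exact H3.
Qed.

(** Upper bounds for [H_(1/lam)], raised to a negative power, and lower bounds for the other integral
    combine to a multiple of a negative power of [d], independent of [j]. *)
Lemma supercritical_large lam j : 0 <= j -> INR q / 2 < lam ->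
  filterlim (fun d => Rpower (SI (/ lam) d) (- 2 * lam - 1) *
               (Rpower d j * SI (/ lam + 1 + j) d)) (at_right 0) (Rbar_locally p_infty).
Proof.
  intros Hj Hl.
  assert (HQ : 0 < INR q) by (apply lt_0_INR; lia).
  assert (Hs0 : 0 < / lam) by (apply Rinv_0_lt_compat; lra).
  destruct (supercritical_exponent lam Hl) as [e [He0 [He1 [He2 He3]]]].
  destruct (upper (/ lam) e He0 He1) as [C [HC Hup]].
  destruct (lower (/ lam + 1 + j)) as [c [Hc Hlow]]; [lra|].
  set (f := - e * (- 2 * lam - 1) + (/ INR q - (/ lam + 1))).
  apply (lim_pinfty_ge (fun d => (Rpower C (- 2 * lam - 1) * c) * Rpower d f)).
  - generalize (filter_and _ _ (at_right_0_lt 1 Rlt_0_1) (filter_and _ _ Hup Hlow)).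
    apply filter_imp. intros d [Hd [Hupd Hlowd]].
    assert (H0 := SI_pos (/ lam) d (proj1 Hd)).
    replace (Rpower C (- 2 * lam - 1) * c * Rpower d f)
      with (Rpower (C * Rpower d (- e)) (- 2 * lam - 1) *
            (Rpower d j * (c * Rpower d (/ INR q - (/ lam + 1 + j))))).
    2:{ rewrite Rpower_combine by lra. unfold f. rewrite (Rpower_plus (- e * _)).
        replace (Rpower d (/ INR q - (/ lam + 1)))
          with (Rpower d j * Rpower d (/ INR q - (/ lam + 1 + j))).
        2:{ rewrite <- Rpower_plus. f_equal. ring. }
        ring. }
    apply Rmult_le_compat.
    + left; apply Rpower_gt0.
    + apply Rmult_le_pos; [left; apply Rpower_gt0|].
      apply Rmult_le_pos; [lra|left; apply Rpower_gt0].
    + apply Rpower_anti_base; lra.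
    + apply Rmult_le_compat_l; [left; apply Rpower_gt0|exact Hlowd].
  - apply lim_pinfty_scal; [apply Rmult_lt_0_compat; [apply Rpower_gt0|lra]|].
    apply Rpower_neg_large. unfold f. lra.
Qed.

(** At a zero of [h] the difference in [profile_factored] is at least [1 - c']. *)
Lemma profile_at_zero_diverges lam a c e c' : 0 < c -> e < 1 -> c' < 1 ->
  at_right 0 (fun d => c * Rpower d e <= Rpower (SI (/ lam) d) (- 2 * lam)) ->
  at_right 0 (fun d => d * SI (/ lam + 1) d / SI (/ lam) d < c') -> h a = 0 ->
  filterlim (fun d => profile h lam d a) (at_right 0) (Rbar_locally p_infty).
Proof.
  intros Hc He Hc' Hlow Hr Ha.
  apply (lim_pinfty_ge (fun d => (c * (1 - c')) * Rpower d (e - 1))).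
  2: apply lim_pinfty_scal, Rpower_neg_large; [apply Rmult_lt_0_compat|]; lra.
  generalize (filter_and _ _ (at_right_0_lt 1 Rlt_0_1) (filter_and _ _ Hlow Hr)).
  apply filter_imp. intros d [Hd [Hlowd Hrd]].
  rewrite profile_factored, Ha, <- Rpower_scale_inv by lra.
  replace (d / (d + 0)) with 1 by (field; lra).
  assert (0 < / d) by (apply Rinv_0_lt_compat; lra).
  assert (0 < c * Rpower d e) by (apply Rmult_lt_0_compat; [lra|apply Rpower_gt0]).
  apply Rle_trans with (c * Rpower d e * / d * (1 - c')); [right; ring|].
  apply Rmult_le_compat; try lra; [apply Rmult_le_pos|apply Rmult_le_compat_r]; lra.
Qed.

(** Away from the zeros of [h] the term [1 / (d + h)] stays bounded, and the mean
    [H_{s+1} / H_s] dominates. *)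
Lemma profile_off_zero_diverges lam a A :
  at_right 0 (fun d => Rpower (SI (/ lam) d) (- 2 * lam) <= A) ->
  filterlim (fun d => Rpower (SI (/ lam) d) (- 2 * lam - 1) * SI (/ lam + 1) d) (at_right 0)
    (Rbar_locally p_infty) -> 0 < h a ->
  filterlim (fun d => profile h lam d a) (at_right 0) (Rbar_locally m_infty).
Proof.
  intros HA Hlim Ha.
  assert (Hneg : filterlim (fun d => - profile h lam d a) (at_right 0) (Rbar_locally p_infty)).
  { apply (lim_pinfty_ge (fun d => Rpower (SI (/ lam) d) (- 2 * lam - 1) * SI (/ lam + 1) d - A * / h a)).
    2: apply lim_pinfty_minus_const, Hlim.
    generalize (filter_and _ _ (at_right_0_lt 1 Rlt_0_1) HA). apply filter_imp. intros d [Hd HAd].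
    rewrite <- Rpower_scale_inv by (apply SI_pos; lra). unfold profile.
    assert (/ (d + h a) <= / h a) by (apply Rinv_le_contravar; lra).
    assert (0 < / (d + h a)) by (apply Rinv_0_lt_compat; lra).
    assert (0 < Rpower (SI (/ lam) d) (- 2 * lam)) by apply Rpower_gt0.
    assert (Rpower (SI (/ lam) d) (- 2 * lam) * / (d + h a) <= A * / h a)
      by (apply Rmult_le_compat; lra).
    unfold Rdiv. lra. }
  apply lim_opp_pinfty in Hneg. revert Hneg. apply filterlim_ext. intros; ring.
Qed.

Lemma ratio_eventually_below_1 s : 0 < s -> exists c, c < 1 /\
  at_right 0 (fun d => d * SI (s + 1) d / SI s d < c).
Proof.
  intros Hs. assert (Hlt := ratio_limit_lt_1 (s + 1) ltac:(lra)).
  exists ((1 - / (INR q * (s + 1)) + 1) / 2). split; [lra|].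
  apply ratio_eventually_lt; lra.
Qed.

Lemma profile_at_zero_diverges_pos lam a : INR q / 2 < lam -> h a = 0 ->
  filterlim (fun d => profile h lam d a) (at_right 0) (Rbar_locally p_infty).
Proof.
  intros Hl Ha. assert (HQ : 0 < INR q) by (apply lt_0_INR; lia).
  destruct (supercritical_exponent lam Hl) as [e [He0 [He1 [He2 _]]]].
  destruct (ratio_eventually_below_1 (/ lam)) as [c [Hc Hr]]; [apply Rinv_0_lt_compat; lra|].
  destruct (upper (/ lam) e He0 He1) as [C [HC Hup]].
  apply (profile_at_zero_diverges lam a (Rpower C (- 2 * lam)) (2 * lam * e) c); auto.
  - apply Rpower_gt0.
  - generalize (filter_and _ _ (at_right_0_lt 1 Rlt_0_1) Hup). apply filter_imp. intros d [Hd Hupd].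
    replace (2 * lam * e) with (- e * (- 2 * lam)) by ring.
    rewrite <- Rpower_combine by lra. apply Rpower_anti_base; [apply SI_pos|exact Hupd|]; lra.
Qed.

Lemma profile_off_zero_diverges_pos lam a : INR q / 2 < lam -> 0 < h a ->
  filterlim (fun d => profile h lam d a) (at_right 0) (Rbar_locally m_infty).
Proof.
  intros Hl. assert (HQ : 0 < INR q) by (apply lt_0_INR; lia).
  destruct (lower_const (/ lam)) as [c [Hc Hlow]].
  apply (profile_off_zero_diverges lam a (Rpower c (- 2 * lam))).
  - generalize (at_right_0_lt 1 Rlt_0_1). apply filter_imp. intros d Hd.
    apply Rpower_anti_base; [exact Hc|apply Hlow, Hd|lra].
  - generalize (supercritical_large lam 0 (Rle_refl 0) Hl). apply filterlim_ext_loc.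
    generalize (at_right_0_lt 1 Rlt_0_1). apply filter_imp. intros d Hd.
    rewrite Rpower_O, Rmult_1_l, Rplus_0_r by lra. reflexivity.
Qed.

Lemma density_pos lam d a : 0 < d -> 0 < density h lam d a.
Proof. intros Hd. apply Rdiv_lt_0_compat; [apply Rpower_gt0|apply SI_pos, Hd]. Qed.

Lemma profile_cont lam d a : 0 < d -> continuous (profile h lam d) a.
Proof.
  intros Hd. unfold profile. generalize (h_nonneg a). intros Ha.
  apply cont_mult; [apply continuous_const|]. apply cont_minus; [|apply continuous_const]. cont.
Qed.

Lemma density_cont lam d a : 0 < d -> continuous (density h lam d) a.
Proof.
  intros Hd. unfold density, Rdiv. apply cont_mult; [|apply continuous_const].
  apply integrand_cont; auto.
Qed.

Lemma mass_integrand_cont lam p d a : 0 < p -> 0 < d ->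
  continuous (fun a => pow0 (Rabs (profile h lam d a)) p * density h lam d a) a.
Proof.
  intros Hp Hd. apply cont_mult; [|apply density_cont, Hd].
  apply (continuous_comp (fun a => Rabs (profile h lam d a)) (fun x => pow0 x p)).
  - apply cont_Rabs, profile_cont, Hd.
  - apply pow0_continuous, Hp.
Qed.

Lemma density_total lam d : 0 < d -> RInt (density h lam d) 0 1 = 1.
Proof.
  intros Hd. unfold density, Rdiv.
  transitivity (RInt (fun a => / SI (/ lam) d * Rpower (d + h a) (- / lam)) 0 1).
  - apply RInt_ext. intros; eqR; ring.
  - rewrite RInt_mult_l by (apply integrand_ex; auto).
    fold (SI (/ lam) d). apply Rinv_l, Rgt_not_eq, SI_pos, Hd.
Qed.

(** From [|x|^p >= |x| - 1], because the density has integral 1. *)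
Lemma profile_mass_ge_first lam p d : 1 <= p -> 0 < d ->
  profile_mass h lam 1 d - 1 <= profile_mass h lam p d.
Proof.
  intros Hp Hd.
  assert (E1 : ex_RInt (fun a => pow0 (Rabs (profile h lam d a)) 1 * density h lam d a) 0 1).
  { apply continuous_ex_RInt. intros; apply mass_integrand_cont; lra. }
  assert (E2 : ex_RInt (fun a => -1 * density h lam d a) 0 1).
  { apply (ex_RInt_scal (density h lam d)), continuous_ex_RInt. intros; apply density_cont, Hd. }
  replace (profile_mass h lam 1 d - 1) with (profile_mass h lam 1 d + -1 * RInt (density h lam d) 0 1).
  2:{ rewrite density_total by exact Hd. ring. }
  rewrite <- RInt_mult_l by (apply continuous_ex_RInt; intros; apply density_cont, Hd).
  unfold profile_mass at 1. rewrite <- RInt_add by assumption.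
  apply RInt_le; [lra| | |].
  - apply (ex_RInt_plus (fun a => pow0 (Rabs (profile h lam d a)) 1 * density h lam d a)); assumption.
  - apply continuous_ex_RInt. intros; apply mass_integrand_cont; lra.
  - intros a _. assert (Hg := density_pos lam d a Hd).
    assert (Hb := pow0_ge_minus_1 _ _ Hp (Rabs_pos (profile h lam d a))).
    assert (H1 : pow0 (Rabs (profile h lam d a)) 1 = Rabs (profile h lam d a)).
    { destruct (Rle_lt_or_eq_dec _ _ (Rabs_pos (profile h lam d a))) as [H| <-].
      - rewrite pow0_pos, Rpower_1; auto.
      - apply pow0_nonpos; lra. }
    rewrite H1. nra.
Qed.

(** The factor [(d + h)^-p] is taken out of the power, leaving a bounded factor
    [|1 - r (d + h)|^p], with [r] the quotient of the two integrals. *)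
Lemma profile_mass_factored lam p d : 0 < p -> 0 < d ->
  profile_mass h lam p d =
  Rpower (SI (/ lam) d) (- 2 * lam * p - 1) *
  RInt (fun a => pow0 (Rabs (1 - SI (/ lam + 1) d / SI (/ lam) d * (d + h a))) p *
                 Rpower (d + h a) (- (/ lam + p))) 0 1.
Proof.
  intros Hp Hd. assert (H0 := SI_pos (/ lam) d Hd).
  set (r := SI (/ lam + 1) d / SI (/ lam) d).
  rewrite <- RInt_mult_l.
  2:{ apply continuous_ex_RInt. intros a. apply cont_mult; [|apply integrand_cont; auto].
      apply (continuous_comp (fun a => Rabs (1 - r * (d + h a))) (fun x => pow0 x p)).
      cont. apply pow0_continuous, Hp. }
  apply RInt_ext. intros a _. eqR. generalize (h_nonneg a). intros Ha.
  unfold profile, density. fold r.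
  replace (/ (d + h a) - r) with ((1 - r * (d + h a)) * / (d + h a)) by (field; lra).
  assert (Hi : 0 < / (d + h a)) by (apply Rinv_0_lt_compat; lra).
  assert (HA : 0 < Rpower (SI (/ lam) d) (- 2 * lam)) by apply Rpower_gt0.
  rewrite !Rabs_mult, (Rabs_pos_eq (/ (d + h a))), (Rabs_pos_eq (Rpower _ _)) by lra.
  replace (Rpower (SI (/ lam) d) (- 2 * lam) * (Rabs (1 - r * (d + h a)) * / (d + h a)))
    with (Rabs (1 - r * (d + h a)) * / (d + h a) * Rpower (SI (/ lam) d) (- 2 * lam)) by ring.
  rewrite !pow0_mult by lra. rewrite Rpower_mult.
  rewrite <- Rpower_scale_inv by lra.
  replace (- (/ lam + p)) with (- p + - / lam) by ring. rewrite Rpower_plus.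
  replace (Rpower (/ (d + h a)) p) with (Rpower (d + h a) (- p)).
  2:{ unfold Rpower. rewrite ln_Rinv by lra. f_equal. ring. }
  unfold Rdiv. ring.
Qed.

(** Bernoulli's inequality [|1 - v|^p >= 1 - p v] makes the integral explicit.  The factor [y^(J+1)],
    with [y = d / (d + h)] in (0, 1], keeps the inequality valid and raises the exponents, hence
    the ratio in the result, without changing its order in [d]. *)
Lemma profile_mass_lower lam p (J : nat) d : 1 <= p -> 0 < d ->
  Rpower (SI (/ lam) d) (- 2 * lam * p - 1) * (d ^ J * (d * SI (/ lam + p + INR J + 1) d -
    p * (d * SI (/ lam + 1) d / SI (/ lam) d) * SI (/ lam + p + INR J) d)) <= profile_mass h lam p d.
Proof.
  intros Hp Hd. rewrite profile_mass_factored by lra.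
  apply Rmult_le_compat_l; [left; apply Rpower_gt0|].
  assert (P0 := SI_pos (/ lam) d Hd). set (s := / lam + p).
  set (r := SI (/ lam + 1) d / SI (/ lam) d).
  replace (d * SI (/ lam + 1) d / SI (/ lam) d) with (r * d) by (unfold r; field; lra).
  apply Rle_trans with (RInt (fun a => d ^ J * (d * Rpower (d + h a) (- (s + INR J + 1)) +
     - (p * (r * d)) * Rpower (d + h a) (- (s + INR J)))) 0 1).
  - assert (E1 := integrand_ex h h_cont h_nonneg (s + INR J + 1) d 0 1 Hd).
    assert (E0 := integrand_ex h h_cont h_nonneg (s + INR J) d 0 1 Hd).
    set (w1 := fun a => Rpower (d + h a) (- (s + INR J + 1))) in *.
    set (w0 := fun a => Rpower (d + h a) (- (s + INR J))) in *.
    assert (E1' : ex_RInt (fun a => d * w1 a) 0 1) by (apply (ex_RInt_scal w1), E1).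
    assert (E0' : ex_RInt (fun a => - (p * (r * d)) * w0 a) 0 1) by (apply (ex_RInt_scal w0), E0).
    rewrite (RInt_mult_l (fun a => d * w1 a + - (p * (r * d)) * w0 a))
      by (apply (ex_RInt_plus (fun a => d * w1 a)); assumption).
    rewrite (RInt_add (fun a => d * w1 a)), (RInt_mult_l w1), (RInt_mult_l w0) by assumption.
    right. unfold sing_int, w1, w0. lra.
  - apply RInt_le; [lra| | |].
    + apply continuous_ex_RInt. intros a. apply cont_mult; [apply continuous_const|].
      apply cont_plus; (apply cont_mult; [apply continuous_const|apply integrand_cont; auto]).
    + apply continuous_ex_RInt. intros a. apply cont_mult; [|apply integrand_cont; auto].
      apply (continuous_comp (fun a => Rabs (1 - r * (d + h a))) (fun x => pow0 x p)).
      cont. apply pow0_continuous; lra.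
    + intros a _. assert (Ha := h_nonneg a). set (v := r * (d + h a)). set (y := d / (d + h a)).
      assert (Hy : 0 < y <= 1).
      { split; [apply Rdiv_lt_0_compat; lra|]. apply Rmult_le_reg_r with (d + h a); [lra|].
        unfold y, Rdiv. rewrite Rmult_assoc, Rinv_l; lra. }
      assert (Hb : 1 - p * v <= pow0 (Rabs (1 - v)) p).
      { apply Rle_trans with (2 := pow0_bernoulli _ _ Hp (Rabs_pos _)).
        assert (1 - v <= Rabs (1 - v)) by apply Rle_abs. nra. }
      assert (Hn : 0 <= pow0 (Rabs (1 - v)) p) by apply pow0_nonneg.
      assert (HP : 0 < Rpower (d + h a) (- s)) by apply Rpower_gt0.
      assert (HyJ : 0 < y ^ J <= 1) by (split; [apply pow_lt; lra|rewrite <- (pow1 J); apply pow_incr; lra]).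
      replace (d ^ J * (d * Rpower (d + h a) (- (s + INR J + 1)) +
                 - (p * (r * d)) * Rpower (d + h a) (- (s + INR J))))
        with (y ^ J * (y * (1 - p * v)) * Rpower (d + h a) (- s)).
      2:{ replace (- (s + INR J + 1)) with (- s + - INR J + - (1)) by ring.
          replace (- (s + INR J)) with (- s + - INR J) by ring.
          rewrite !Rpower_plus, (Rpower_Ropp _ 1), Rpower_1, (Rpower_Ropp _ (INR J)), Rpower_pow by lra.
          unfold y, v, Rdiv. rewrite Rpow_mult_distr, pow_inv. field.
          split; [apply pow_nonzero|]; lra. }
      apply Rmult_le_compat_r; [lra|].
      apply Rle_trans with (y ^ J * (y * pow0 (Rabs (1 - v)) p)).
      * apply Rmult_le_compat_l; [lra|]. apply Rmult_le_compat_l; lra.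
      * assert (y * pow0 (Rabs (1 - v)) p <= pow0 (Rabs (1 - v)) p) by nra.
        assert (0 <= y * pow0 (Rabs (1 - v)) p) by nra. nra.
Qed.

(** The limit [1 - 1 / (q s)] of [d H_{s+1} / H_s] increases strictly with [s], which makes the lower
    bound with [J = 1] positive.  The ratio at [s = 1/lam], possibly subcritical, is only bounded by the
    limit at [s + 1], with which [J = 0] would give a bound of undecided sign. *)
Lemma profile_mass_diverges_pos lam : INR q / 2 < lam ->
  filterlim (profile_mass h lam 1) (at_right 0) (Rbar_locally p_infty).
Proof.
  intros Hl. assert (HQ : 0 < INR q) by (apply lt_0_INR; lia).
  set (s := / lam). assert (Hs0 : 0 < s) by (apply Rinv_0_lt_compat; lra).
  assert (Hlim := supercritical_large lam 1 Rle_0_1 Hl). fold s in Hlim.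
  set (l1 := 1 - / (INR q * (s + 1))). set (l2 := 1 - / (INR q * (s + 1 + 1))).
  assert (Hl12 : l1 < l2) by (apply ratio_limit_increasing; lra).
  set (g := (l2 - l1) / 3). assert (Hg : 0 < g) by (unfold g; lra).
  assert (G1 : l1 < l1 + g) by lra. assert (G2 : l2 - g < l2) by lra.
  assert (Hs1 : / INR q < s + 1) by lra. assert (Hs2 : / INR q < s + 1 + 1) by lra.
  apply (lim_pinfty_ge (fun d => g * (Rpower (SI s d) (- 2 * lam - 1) * (Rpower d 1 * SI (s + 1 + 1) d)))).
  2: apply lim_pinfty_scal; assumption.
  generalize (filter_and _ _ (at_right_0_lt 1 Rlt_0_1) (filter_and _ _
    (ratio_eventually_lt s _ Hs1 G1) (lim_eventually_gt _ _ _ (ratio_limit _ Hs2) G2))).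
  apply filter_imp. intros d [Hd [Hr1 Hr2]].
  assert (P1 := SI_pos (s + 1 + 1) d (proj1 Hd)). rewrite Rpower_1 by lra.
  apply Rle_trans with (2 := profile_mass_lower lam 1 1 d (Rle_refl 1) (proj1 Hd)). fold s.
  simpl (INR 1). rewrite pow_1, Rmult_1_l, Rmult_1_r.
  set (th := d * SI (s + 1) d / SI s d) in *.
  replace (d * SI (s + 1 + 1 + 1) d - th * SI (s + 1 + 1) d)
    with ((d * SI (s + 1 + 1 + 1) d / SI (s + 1 + 1) d - th) * SI (s + 1 + 1) d) by (field; lra).
  replace (g * (Rpower (SI s d) (-2 * lam - 1) * (d * SI (s + 1 + 1) d)))
    with (Rpower (SI s d) (-2 * lam - 1) * (d * (g * SI (s + 1 + 1) d))) by ring.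
  apply Rmult_le_compat_l; [left; apply Rpower_gt0|]. apply Rmult_le_compat_l; [lra|].
  apply Rmult_le_compat_r; unfold g in *; lra.
Qed.

(** As [dt = - H_(1/lam)^(2 lam) / |lam| dd] along a solution, this makes the life span infinite. *)
Lemma inverse_time_lower lam : 0 < lam -> lam <= INR q / 2 -> exists c, 0 < c /\
  at_right 0 (fun d => c * / d <= Rpower (SI (/ lam) d) (2 * lam)).
Proof.
  intros Hl0 Hl. assert (HQ : 0 < INR q) by (apply lt_0_INR; lia).
  assert (Hs : 2 * / INR q <= / lam).
  { replace (2 * / INR q) with (/ (INR q / 2)) by (field; lra). apply Rinv_le_contravar; lra. }
  destruct (lower (/ lam)) as [c [Hc Hlow]]; [lra|].
  exists (Rpower c (2 * lam)). split; [apply Rpower_gt0|].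
  generalize (filter_and _ _ (at_right_0_lt 1 Rlt_0_1) Hlow). apply filter_imp.
  intros d [Hd Hlowd].
  apply Rle_trans with (Rpower (c * Rpower d (/ INR q - / lam)) (2 * lam)).
  - rewrite Rpower_combine by lra. apply Rmult_le_compat_l; [left; apply Rpower_gt0|].
    rewrite <- (Rpower_1 d) at 1 by lra. rewrite <- Rpower_Ropp.
    unfold Rpower.
    assert (Hln : ln d < 0) by (rewrite <- ln_1; apply ln_increasing; lra).
    assert (He : (/ INR q - / lam) * (2 * lam) <= - (1)).
    { replace ((/ INR q - / lam) * (2 * lam)) with (lam * (2 * / INR q) - 2) by (field; lra).
      apply (Rmult_le_compat_l lam) in Hs; [|lra]. rewrite Rinv_r in Hs by lra. lra. }
    destruct (Rle_lt_or_eq_dec (- (1) * ln d) ((/ INR q - / lam) * (2 * lam) * ln d)) as [Hlt|Heq].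
    + nra.
    + left; apply exp_increasing, Hlt.
    + right; f_equal; exact Heq.
  - apply Rpower_le_base; [apply Rmult_lt_0_compat; [lra|apply Rpower_gt0]|exact Hlowd|lra].
Qed.

(** A bound that is integrable at 0 for the rate of time, which makes the life span finite. *)
Lemma inverse_time_upper lam : INR q / 2 < lam -> exists C e, 0 < C /\ 0 < e < 1 /\
  at_right 0 (fun d => Rpower (SI (/ lam) d) (2 * lam) <= C * Rpower d (- e)).
Proof.
  intros Hl. assert (HQ : 0 < INR q) by (apply lt_0_INR; lia).
  destruct (supercritical_exponent lam Hl) as [e [He0 [He1 [He2 _]]]].
  destruct (upper (/ lam) e He0 He1) as [C [HC Hup]].
  exists (Rpower C (2 * lam)), (2 * lam * e).
  split; [apply Rpower_gt0|]. split; [split; [nra|lra]|].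
  generalize (filter_and _ _ (at_right_0_lt 1 Rlt_0_1) Hup). apply filter_imp.
  intros d [Hd Hupd].
  replace (- (2 * lam * e)) with (- e * (2 * lam)) by ring.
  rewrite <- Rpower_combine by lra.
  apply Rpower_le_base; [apply SI_pos; lra|exact Hupd|lra].
Qed.

(** ** Negative [lam] *)

(** For [s < 0] the denominator tends to a positive number, and [H_{s+1}] grows more slowly than
    [1 / d]. *)
Lemma ratio_vanishes s : s < 0 ->
  filterlim (fun d => d * SI (s + 1) d / SI s d) (at_right 0) (locally 0).
Proof.
  intros Hs. destruct q_bounds as [Hq0 Hq1].
  destruct (subcritical_limit s) as [l [Hl Hlim]]; [lra|].
  set (e := 1 - / INR q / 2).
  destruct (upper (s + 1) e) as [C [HC Hup]]; [unfold e; lra|unfold e; lra|].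
  replace (locally 0) with (locally (0 / l)) by (f_equal; field; lra).
  apply lim_div; [lra| |exact Hlim].
  apply (lim_squeeze0 _ (fun d => C * Rpower d (1 - e))).
  - generalize (filter_and _ _ (at_right_0_lt 1 Rlt_0_1) Hup). apply filter_imp.
    intros d [Hd Hupd]. assert (H0 := SI_pos (s + 1) d (proj1 Hd)).
    rewrite Rabs_pos_eq by nra.
    unfold Rminus. rewrite Rpower_plus, Rpower_1 by lra.
    apply Rle_trans with (d * (C * Rpower d (- e))); [apply Rmult_le_compat_l; lra|right; ring].
  - replace (locally 0) with (locally (C * 0)) by (f_equal; ring).
    apply lim_mult; [apply lim_const|]. apply Rpower_pos_small. unfold e; lra.
Qed.

Lemma neg_power_limit lam c : lam < 0 -> exists L, 0 < L /\
  filterlim (fun d => Rpower (SI (/ lam) d) c) (at_right 0) (locally L).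
Proof.
  intros Hl. assert (Hs : / lam < 0) by (apply Rinv_lt_0_compat, Hl).
  destruct (subcritical_limit (/ lam)) as [l [Hl0 Hlim]]; [lra|].
  exists (Rpower l c). split; [apply Rpower_gt0|]. apply lim_Rpower; assumption.
Qed.

Lemma profile_at_zero_diverges_neg lam a : lam < 0 -> h a = 0 ->
  filterlim (fun d => profile h lam d a) (at_right 0) (Rbar_locally p_infty).
Proof.
  intros Hl Ha. assert (Hs : / lam < 0) by (apply Rinv_lt_0_compat, Hl).
  destruct (neg_power_limit lam (- 2 * lam) Hl) as [L [HL Hlim]].
  assert (G1 : L / 2 < L) by lra. assert (G2 : 0 < 1 / 2) by lra.
  apply (profile_at_zero_diverges lam a (L / 2) 0 (1 / 2)); try lra; auto.
  - generalize (filter_and _ _ (at_right_0_lt 1 Rlt_0_1) (lim_eventually_gt _ _ _ Hlim G1)).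
    apply filter_imp. intros d [Hd H]. rewrite Rpower_O; lra.
  - apply (lim_eventually_lt _ _ _ (ratio_vanishes _ Hs) G2).
Qed.

Lemma profile_off_zero_diverges_neg lam a : lam < 0 -> / INR q < / lam + 1 -> 0 < h a ->
  filterlim (fun d => profile h lam d a) (at_right 0) (Rbar_locally m_infty).
Proof.
  intros Hl Hs.
  destruct (neg_power_limit lam (- 2 * lam) Hl) as [A [HA HAlim]].
  destruct (neg_power_limit lam (- 2 * lam - 1) Hl) as [B [HB HBlim]].
  destruct (lower (/ lam + 1) Hs) as [c [Hc Hlow]].
  assert (G1 : A < A + 1) by lra. assert (G2 : B / 2 < B) by lra.
  apply (profile_off_zero_diverges lam a (A + 1)).
  - generalize (lim_eventually_lt _ _ _ HAlim G1). apply filter_imp. intros; lra.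
  - apply (lim_pinfty_ge (fun d => (B / 2 * c) * Rpower d (/ INR q - (/ lam + 1)))).
    2: apply lim_pinfty_scal, Rpower_neg_large; [apply Rmult_lt_0_compat|]; lra.
    generalize (filter_and _ _ Hlow (lim_eventually_gt _ _ _ HBlim G2)). apply filter_imp.
    intros d [Hlowd H2]. rewrite Rmult_assoc.
    apply Rmult_le_compat; try lra. apply Rmult_le_pos; [lra|left; apply Rpower_gt0].
Qed.

(** Here [J = 0] suffices in the lower bound: the subtracted ratio tends to 0, the other one to a
    positive number. *)
Lemma profile_mass_diverges_neg lam p : lam < 0 -> 1 <= p -> / INR q < / lam + p ->
  filterlim (profile_mass h lam p) (at_right 0) (Rbar_locally p_infty).
Proof.
  intros Hl Hp Hs. destruct q_bounds as [Hq0 Hq1].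
  assert (HQ : 0 < INR q) by (apply lt_0_INR; lia).
  assert (Hs' : / lam < 0) by (apply Rinv_lt_0_compat, Hl).
  set (s := / lam + p) in *.
  destruct (neg_power_limit lam (- 2 * lam * p - 1) Hl) as [B [HB HBlim]].
  destruct (lower s Hs) as [c [Hc Hlow]]. assert (G2 : B / 2 < B) by lra.
  set (g := 1 - / (INR q * s)).
  assert (Hg : 0 < g).
  { unfold g. assert (Hqs := order_mult_gt q q_ge s Hs).
    assert (/ (INR q * s) < / 1) by (apply Rinv_lt_contravar; lra). lra. }
  assert (Hdiff := lim_minus _ _ _ _ (ratio_limit s Hs)
    (lim_mult _ _ _ _ (lim_const (F := at_right 0) p) (ratio_vanishes _ Hs'))).
  fold g in Hdiff. rewrite Rmult_0_r in Hdiff.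
  assert (G1 : g / 2 < g - 0) by lra.
  apply (lim_pinfty_ge (fun d => (B / 2 * (g / 2) * c) * Rpower d (/ INR q - s))).
  2: apply lim_pinfty_scal, Rpower_neg_large; [repeat apply Rmult_lt_0_compat|]; lra.
  generalize (filter_and _ _ (at_right_0_lt 1 Rlt_0_1) (filter_and _ _ Hlow (filter_and _ _
    (lim_eventually_gt _ _ _ HBlim G2) (lim_eventually_gt _ _ _ Hdiff G1)))).
  apply filter_imp. intros d [Hd [H1 [H2 H3]]].
  assert (P1 := SI_pos s d (proj1 Hd)).
  apply Rle_trans with (2 := profile_mass_lower lam p 0 d Hp (proj1 Hd)). fold s.
  simpl (INR 0). rewrite Rplus_0_r, pow_O, Rmult_1_l.
  set (th := d * SI (/ lam + 1) d / SI (/ lam) d) in *.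
  replace (d * SI (s + 1) d - p * th * SI s d)
    with ((d * SI (s + 1) d / SI s d - p * th) * SI s d) by (field; lra).
  assert (0 < Rpower d (/ INR q - s)) by apply Rpower_gt0.
  assert (0 < c * Rpower d (/ INR q - s)) by (apply Rmult_lt_0_compat; lra).
  apply Rle_trans with (B / 2 * (g / 2 * (c * Rpower d (/ INR q - s)))); [right; ring|].
  apply Rmult_le_compat; try lra.
  - apply Rmult_le_pos; lra.
  - apply Rmult_le_compat; lra.
Qed.

Lemma profile_off_zero_converges_neg lam a : lam < 0 -> / lam + 1 < / INR q -> 0 < h a ->
  exists v, filterlim (fun d => profile h lam d a) (at_right 0) (locally v).
Proof.
  intros Hl Hs Ha. destruct q_bounds as [Hq0 Hq1].
  assert (Hs' : / lam < 0) by (apply Rinv_lt_0_compat, Hl).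
  destruct (subcritical_limit (/ lam)) as [l0 [Hl0 H0]]; [lra|].
  destruct (subcritical_limit (/ lam + 1) Hs) as [l1 [Hl1 H1]].
  exists (Rpower l0 (- 2 * lam) * (/ (0 + h a) - l1 / l0)).
  apply lim_mult; [apply lim_Rpower; assumption|].
  apply lim_minus; [|apply lim_div; auto; lra].
  apply (filterlim_filter_le_1 (G := at_right 0) (F := locally 0)).
  - intros P [e' He']. exists e'. intros; auto.
  - apply (cont_inv (fun d => d + h a) 0); [lra|cont].
Qed.

(** The integral is monotone in [d] and bounded near 0. *)
Lemma weighted_subcritical_limit (w : R -> R) s : s < / INR q ->
  (forall a, continuous w a) -> (forall a, 0 <= w a) ->
  exists l, filterlim (fun d => RInt (fun a => w a * Rpower (d + h a) (- s)) 0 1)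
              (at_right 0) (locally l).
Proof.
  intros Hs Hw Hw0.
  assert (Hc : forall d a, 0 < d -> continuous (fun a => w a * Rpower (d + h a) (- s)) a).
  { intros d a Hd. apply cont_mult; [apply Hw|apply integrand_cont; auto]. }
  assert (Hex : forall d, 0 < d -> ex_RInt (fun a => w a * Rpower (d + h a) (- s)) 0 1).
  { intros d Hd. apply continuous_ex_RInt. intros; apply Hc, Hd. }
  set (V := fun d => RInt (fun a => w a * Rpower (d + h a) (- s)) 0 1).
  destruct (Rle_lt_dec 0 s) as [Hs0|Hs0].
  - destruct (continuity_ab_maj w 0 1) as [x [Hx _]]; [lra| |].
    { intros c _. apply continuity_pt_filterlim, Hw. }
    destruct (sing_int_subcritical_bounded h q h_cont h_nonneg q_ge h_zeros h_zero_ex s Hs0 Hs) as [C HC].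
    destruct (at_right_elim _ _ HC) as [r [Hr Hr']].
    destruct (monotone_bounded_limit (at_right 0) _ V (fun d => 0 < d < r) (w x * C))
      as [l [Hl _]].
    + apply at_right_0_lt, Hr.
    + intros d Hd. apply (at_right_intro _ 0 d); [lra|]. intros y Hy.
      apply RInt_le; [lra|apply Hex; lra|apply Hex; lra|]. intros a _.
      generalize (h_nonneg a). intros.
      apply Rmult_le_compat_l; [apply Hw0|apply Rpower_anti_base; lra].
    + intros d Hd. apply Rle_trans with (w x * SI s d).
      * unfold sing_int. rewrite <- RInt_mult_l by (apply integrand_ex; auto; lra).
        apply RInt_le; [lra|apply Hex; lra| |].
        -- apply (ex_RInt_scal (fun a => Rpower (d + h a) (- s))), integrand_ex; auto; lra.
        -- intros a Ha. apply Rmult_le_compat_r; [left; apply Rpower_gt0|apply Hx; lra].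
      * apply Rmult_le_compat_l; [apply Hw0|]. apply Hr'. lra.
    + exists l. exact Hl.
  - destruct (monotone_bounded_limit (at_right 0) _ (fun d => - V d) (fun d => 0 < d < 1) 0)
      as [l [Hl _]].
    + apply at_right_0_lt, Rlt_0_1.
    + intros d Hd. apply (at_right_intro _ 0 d); [lra|]. intros y Hy.
      apply Ropp_le_contravar. apply RInt_le; [lra|apply Hex; lra|apply Hex; lra|]. intros a _.
      generalize (h_nonneg a). intros.
      apply Rmult_le_compat_l; [apply Hw0|apply Rpower_le_base; lra].
    + intros d Hd. assert (0 <= V d); [|lra].
      apply RInt_nonneg; [lra|apply Hex; lra|]. intros a _.
      apply Rmult_le_pos; [apply Hw0|left; apply Rpower_gt0].
    + exists (- l). apply lim_opp in Hl. revert Hl. apply filterlim_ext.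
      intros d. apply Ropp_involutive.
Qed.

(** The bounded factor converges uniformly in [a], and its limit is independent of [d], so the
    remaining integral is monotone in [d]. *)
Lemma profile_mass_converges lam p : lam < 0 -> 1 <= p -> / lam + p < / INR q ->
  exists l, filterlim (profile_mass h lam p) (at_right 0) (locally l).
Proof.
  intros Hl Hp Hs. destruct q_bounds as [Hq0 Hq1].
  assert (Hs' : / lam < 0) by (apply Rinv_lt_0_compat, Hl).
  destruct (subcritical_limit (/ lam)) as [l0 [Hl0 H0]]; [lra|].
  destruct (subcritical_limit (/ lam + 1)) as [l1 [Hl1 H1]]; [lra|].
  destruct (subcritical_limit (/ lam + p) Hs) as [l2 [Hl2 H2]].
  set (s := / lam + p) in *.
  set (N := fun x => pow0 (Rabs x) p).
  assert (HN : forall x, continuous N x).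
  { intros x. apply (continuous_comp Rabs (fun y => pow0 y p)).
    apply continuous_Rabs. apply pow0_continuous; lra. }
  set (r0 := l1 / l0). assert (Hr0 : 0 < r0) by (apply Rdiv_lt_0_compat; lra).
  assert (Hr := lim_div _ _ _ _ (Rgt_not_eq _ _ Hl0) H1 H0). fold r0 in Hr.
  destruct (weighted_subcritical_limit (fun a => N (1 - r0 * h a)) s Hs) as [l3 H3].
  { intros a. apply (continuous_comp (fun a => 1 - r0 * h a) N). cont. apply HN. }
  { intros a. apply pow0_nonneg. }
  destruct (h_bounded h h_cont h_nonneg) as [B [HB Hh]].
  set (M := (r0 + 1) * (1 + B) + 1).
  assert (HM : 1 < M) by (unfold M; nra).
  exists (Rpower l0 (- 2 * lam * p - 1) * l3).
  apply filterlim_ext_loc with (fun d => Rpower (SI (/ lam) d) (- 2 * lam * p - 1) *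
    RInt (fun a => N (1 - SI (/ lam + 1) d / SI (/ lam) d * (d + h a)) *
                 Rpower (d + h a) (- s)) 0 1).
  { generalize (at_right_0_lt 1 Rlt_0_1). apply filter_imp. intros d Hd.
    symmetry. apply profile_mass_factored; lra. }
  apply lim_mult; [apply lim_Rpower; assumption|].
  assert (Hcr : forall r d a, continuous (fun a => N (1 - r * (d + h a))) a).
  { intros r d a. apply (continuous_comp (fun a => 1 - r * (d + h a)) N). cont. apply HN. }
  assert (Hc0 : forall a, continuous (fun a => N (1 - r0 * h a)) a).
  { intros a. apply (continuous_comp (fun a => 1 - r0 * h a) N). cont. apply HN. }
  assert (Hdiff : filterlim (fun d =>
     RInt (fun a => N (1 - SI (/ lam + 1) d / SI (/ lam) d * (d + h a)) * Rpower (d + h a) (- s)) 0 1 -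
     RInt (fun a => N (1 - r0 * h a) * Rpower (d + h a) (- s)) 0 1) (at_right 0) (locally 0)).
  { apply lim_eps. intros eps Heps.
    set (eps' := eps / (2 * (l2 + 1))). assert (Heps' : 0 < eps') by (apply Rdiv_lt_0_compat; lra).
    destruct (Heine_cor2 (f := N) (a := - M) (b := M)
      ltac:(intros; apply continuity_pt_filterlim, HN) (mkposreal eps' Heps')) as [del Hdel].
    set (dl := del / (2 * (r0 + 1 + B))).
    assert (Hdl : 0 < dl) by (apply Rdiv_lt_0_compat; [apply cond_pos|lra]).
    assert (G2 : l2 < l2 + 1) by lra. assert (G3 : r0 < r0 + 1) by lra. assert (G4 : 0 < r0) by lra.
    generalize (filter_and _ _ (at_right_0_lt 1 Rlt_0_1) (filter_and _ _ (at_right_0_lt dl Hdl)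
      (filter_and _ _ (lim_eventually_lt _ _ _ H2 G2) (filter_and _ _ (lim_eventually_gt _ _ _ Hr G4)
       (filter_and _ _ (lim_eventually_lt _ _ _ Hr G3) (proj1 (lim_eps _ _) Hr dl Hdl)))))).
    apply filter_imp. intros d [Hd [Hdd [Hs2 [Hra [Hrb Hrc]]]]].
    set (r := SI (/ lam + 1) d / SI (/ lam) d) in *.
    rewrite Rminus_0_r. apply Rabs_def2 in Hrc.
    assert (Hpt : forall a, 0 < a < 1 ->
      Rabs (N (1 - r * (d + h a)) - N (1 - r0 * h a)) < eps').
    { intros a Ha. assert (0 <= h a) by auto. assert (h a <= B) by (apply Hh; lra).
      assert (r * (d + h a) <= (r0 + 1) * (1 + B)) by (apply Rmult_le_compat; lra).
      assert (0 <= r * (d + h a)) by (apply Rmult_le_pos; lra).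
      assert (r0 * h a <= (r0 + 1) * (1 + B)) by (apply Rmult_le_compat; lra).
      assert (0 <= r0 * h a) by (apply Rmult_le_pos; lra).
      apply (Hdel (1 - r * (d + h a)) (1 - r0 * h a)); unfold M; try lra.
      replace (1 - r * (d + h a) - (1 - r0 * h a)) with ((r0 - r) * h a - r * d) by ring.
      assert (Hab : Rabs ((r0 - r) * h a) <= dl * B).
      { rewrite Rabs_mult, (Rabs_pos_eq (h a)) by lra.
        apply Rmult_le_compat; try lra. apply Rabs_pos. apply Rabs_le; lra. }
      assert (0 <= r * d) by (apply Rmult_le_pos; lra).
      assert (r * d <= (r0 + 1) * dl) by (apply Rmult_le_compat; lra).
      assert (dl * (r0 + 1 + B) = del / 2) by (unfold dl; field; lra).
      assert (0 < del) by apply cond_pos.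
      apply Rabs_le_between in Hab. apply Rabs_def1; nra. }
    assert (Hrr : RInt (fun a => N (1 - r * (d + h a)) * Rpower (d + h a) (- s)) 0 1 -
                  RInt (fun a => N (1 - r0 * h a) * Rpower (d + h a) (- s)) 0 1 =
                  RInt (fun a => (N (1 - r * (d + h a)) - N (1 - r0 * h a)) * Rpower (d + h a) (- s)) 0 1).
    { symmetry. rewrite <- (RInt_minus (V := R_CompleteNormedModule)).
      - apply RInt_ext. intros a _. unfold minus, plus, opp; simpl. ring.
      - apply continuous_ex_RInt. intros a. apply cont_mult; [apply Hcr|apply integrand_cont; auto; lra].
      - apply continuous_ex_RInt. intros a. apply cont_mult; [apply Hc0|apply integrand_cont; auto; lra]. }
    rewrite Hrr.
    apply Rle_lt_trans with (RInt (fun a => eps' * Rpower (d + h a) (- s)) 0 1).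
    - apply Rle_trans with (RInt (fun a => Rabs ((N (1 - r * (d + h a)) - N (1 - r0 * h a)) * Rpower (d + h a) (- s))) 0 1).
      + apply abs_RInt_le; [lra|]. apply continuous_ex_RInt. intros a.
        apply cont_mult; [apply cont_minus; [apply Hcr|apply Hc0]|apply integrand_cont; auto; lra].
      + apply RInt_le; [lra| | |].
        * apply continuous_ex_RInt. intros a. apply cont_Rabs.
          apply cont_mult; [apply cont_minus; [apply Hcr|apply Hc0]|apply integrand_cont; auto; lra].
        * apply (ex_RInt_scal (fun a => Rpower (d + h a) (- s))), integrand_ex; auto; lra.
        * intros a Ha. rewrite Rabs_mult, (Rabs_pos_eq (Rpower _ _)) by (left; apply Rpower_gt0).
          apply Rmult_le_compat_r; [left; apply Rpower_gt0|]. left; apply Hpt, Ha.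
    - rewrite RInt_mult_l by (apply integrand_ex; auto; lra). fold (SI s d).
      apply Rle_lt_trans with (eps' * (l2 + 1)); [apply Rmult_le_compat_l; lra|].
      unfold eps'. replace (eps / (2 * (l2 + 1)) * (l2 + 1)) with (eps / 2) by (field; lra). lra. }
  generalize (lim_plus _ _ _ _ Hdiff H3). rewrite Rplus_0_l. apply filterlim_ext. intros; ring.
Qed.

Lemma inverse_time_upper_neg lam : lam < 0 -> exists C e, 0 < C /\ 0 < e < 1 /\
  at_right 0 (fun d => Rpower (SI (/ lam) d) (2 * lam) <= C * Rpower d (- e)).
Proof.
  intros Hl. destruct (neg_power_limit lam (2 * lam) Hl) as [C [HC Hlim]].
  assert (G : C < C + 1) by lra.
  exists (C + 1), (/ 2). split; [lra|]. split; [lra|].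
  generalize (filter_and _ _ (at_right_0_lt 1 Rlt_0_1) (lim_eventually_lt _ _ _ Hlim G)).
  apply filter_imp. intros d [Hd Hlt].
  assert (1 <= Rpower d (- / 2)); [|nra].
  apply Rle_trans with (Rpower 1 (- / 2)); [|apply Rpower_anti_base; lra].
  right. unfold Rpower. rewrite ln_1, Rmult_0_r, exp_0. reflexivity.
Qed.

End Profile.

(** * Periodic functions and Gronwall estimates *)

Lemma periodic_IZR (f : R -> R) x n : periodic1 f -> f (x + IZR n) = f x.
Proof.
  intros Hf.
  assert (Hnat : forall k y, f (y + INR k) = f y).
  { induction k as [|k IH]; intros y.
    - simpl. f_equal; ring.
    - rewrite S_INR, <- Rplus_assoc, Hf. apply IH. }
  destruct (Z.le_gt_cases 0 n) as [Hn|Hn].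
  - rewrite <- (Z2Nat.id n Hn), <- INR_IZR_INZ. apply Hnat.
  - rewrite <- (Hnat (Z.to_nat (- n)) (x + IZR n)). f_equal.
    rewrite INR_IZR_INZ, Z2Nat.id, opp_IZR by lia. ring.
Qed.

Lemma period_representative x : exists y n, 0 <= y < 1 /\ x = y + IZR n.
Proof.
  exists (x - IZR (Int_part x)), (Int_part x).
  generalize (base_Int_part x). intros [H1 H2]. split; lra.
Qed.

Lemma RInt_period (f : R -> R) c : (forall x, continuous f x) -> periodic1 f ->
  RInt f c (c + 1) = RInt f 0 1.
Proof.
  intros Hc Hp.
  assert (Hd : forall z, is_derive (fun z => RInt f 0 (z + 1) - RInt f 0 z) z 0).
  { intros z. apply is_derive_eq with (1 * f (z + 1) - f z); [|rewrite Hp; ring].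
    apply (is_derive_minus (fun z => RInt f 0 (z + 1)) (fun z => RInt f 0 z)).
    - apply (is_derive_comp (fun z => RInt f 0 z) (fun z => z + 1)).
      + apply is_derive_primitive, Hc.
      + auto_derive; auto.
    - apply is_derive_primitive, Hc. }
  assert (Hg : forall z, RInt f z (z + 1) = RInt f 0 (z + 1) - RInt f 0 z).
  { intros z. rewrite (RInt_split f 0 z (z + 1)) by (apply continuous_ex_RInt, Hc). lra. }
  rewrite Hg. replace (RInt f 0 1) with (RInt f 0 (0 + 1) - RInt f 0 0).
  2:{ rewrite RInt_point. unfold zero; simpl. rewrite Rplus_0_l. lra. }
  set (F := fun z => RInt f 0 (z + 1) - RInt f 0 z) in *.
  change (F c = F 0). destruct (Rle_lt_dec 0 c).
  - symmetry. apply (derive_zero_const F); auto. intros; apply (is_derive_continuous _ _ _ (Hd x)).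
  - apply (derive_zero_const F); auto; [lra|]. intros; apply (is_derive_continuous _ _ _ (Hd x)).
Qed.

(** The function [f^2 exp(- 2 kap s)] is nonincreasing. *)
Lemma gronwall (f df : R -> R) kap t : 0 <= t ->
  (forall s, 0 < s < t -> is_derive f s (df s)) ->
  (forall s, 0 <= s <= t -> continuous f s) ->
  (forall s, 0 < s < t -> Rabs (df s) <= kap * Rabs (f s)) ->
  Rabs (f t) <= Rabs (f 0) * exp (kap * t).
Proof.
  intros Ht Hd Hc Hb.
  set (F := fun s => f s ^ 2 * exp (- (2 * kap * s))).
  assert (HF : - F 0 <= - F t).
  { apply (derive_nonneg_le (fun s => - F s) (fun s => - ((2 * df s * f s ^ 1) * exp (- (2 * kap * s))
            + f s ^ 2 * (- (2 * kap) * exp (- (2 * kap * s)))))); auto.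
    - intros s Hs. apply (is_derive_opp F).
      apply (is_derive_mult (fun s => f s ^ 2) (fun s => exp (- (2 * kap * s)))).
      + replace (2 * df s * f s ^ 1) with (INR 2 * df s * f s ^ pred 2) by (simpl; ring).
        apply (is_derive_pow f 2), Hd, Hs.
      + auto_derive; auto. ring.
      + intros; apply Rmult_comm.
    - intros s Hs. apply cont_opp. unfold F. apply cont_mult.
      + apply cont_pow, Hc, Hs.
      + cont.
    - intros s Hs. assert (He : 0 < exp (- (2 * kap * s))) by apply exp_pos.
      specialize (Hb s Hs).
      replace (- (2 * df s * f s ^ 1 * exp (- (2 * kap * s)) + f s ^ 2 * (- (2 * kap) * exp (- (2 * kap * s)))))
        with (2 * exp (- (2 * kap * s)) * (kap * f s ^ 2 - df s * f s)) by ring.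
      assert (df s * f s <= kap * f s ^ 2).
      { apply Rle_trans with (Rabs (df s * f s)); [apply Rle_abs|].
        rewrite Rabs_mult. rewrite <- (pow2_abs (f s)).
        assert (0 <= Rabs (f s)) by apply Rabs_pos. nra. }
      nra. }
  unfold F in HF. replace (- (2 * kap * 0)) with 0 in HF by ring. rewrite exp_0, Rmult_1_r in HF.
  assert (Hsq : f t ^ 2 <= (Rabs (f 0) * exp (kap * t)) ^ 2).
  { rewrite Rpow_mult_distr, pow2_abs.
    replace (exp (kap * t) ^ 2) with (/ exp (- (2 * kap * t))).
    2:{ rewrite <- exp_Ropp. simpl. rewrite Rmult_1_r, <- exp_plus. f_equal. ring. }
    assert (He : 0 < exp (- (2 * kap * t))) by apply exp_pos.
    apply Rmult_le_reg_r with (exp (- (2 * kap * t))); auto.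
    replace (f 0 ^ 2 * / exp (- (2 * kap * t)) * exp (- (2 * kap * t))) with (f 0 ^ 2) by (field; lra).
    lra. }
  rewrite <- (pow2_abs (f t)) in Hsq.
  apply Rsqr_incr_0_var.
  - unfold Rsqr. nra.
  - apply Rmult_le_pos; [apply Rabs_pos|left; apply exp_pos].
Qed.

Lemma derive_bounded_increment (f df : R -> R) K t : 0 <= t ->
  (forall s, 0 < s < t -> is_derive f s (df s)) ->
  (forall s, 0 <= s <= t -> continuous f s) ->
  (forall s, 0 < s < t -> Rabs (df s) <= K) -> Rabs (f t - f 0) <= K * t.
Proof.
  intros Ht Hd Hc Hb.
  assert (H1 : K * 0 - f 0 <= K * t - f t).
  { apply (derive_nonneg_le (fun s => K * s - f s) (fun s => K - df s)); auto.
    - intros s Hs. apply (is_derive_minus (fun s => K * s) f); [|apply Hd, Hs].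
      auto_derive; auto; ring.
    - intros s Hs. apply cont_minus; [cont|apply Hc, Hs].
    - intros s Hs. specialize (Hb s Hs). apply Rabs_le_between in Hb. lra. }
  assert (H2 : K * 0 + f 0 <= K * t + f t).
  { apply (derive_nonneg_le (fun s => K * s + f s) (fun s => K + df s)); auto.
    - intros s Hs. apply (is_derive_plus (fun s => K * s) f); [|apply Hd, Hs].
      auto_derive; auto; ring.
    - intros s Hs. apply cont_plus; [cont|apply Hc, Hs].
    - intros s Hs. specialize (Hb s Hs). apply Rabs_le_between in Hb. lra. }
  apply Rabs_le. lra.
Qed.

Lemma before_locally t T : Rbar_lt (Finite t) T -> locally t (fun s => Rbar_lt (Finite s) T).
Proof.
  intros Ht. destruct T as [T| |]; simpl in *.
  - apply (locally_ball_intro _ t (T - t)); [lra|]. intros s Hs. apply Rabs_def2 in Hs. lra.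
  - apply filter_forall. auto.
  - contradiction.
Qed.

Lemma Rbar_lt_of_le s t T : s <= t -> Rbar_lt (Finite t) T -> Rbar_lt (Finite s) T.
Proof. destruct T; simpl; auto; lra. Qed.

Lemma Rbar_lt_clamp t T : Rbar_lt 0 T -> Rbar_lt (Finite t) T -> Rbar_lt (Finite (Rmax 0 t)) T.
Proof. intros H0 Ht. unfold Rmax. destruct (Rle_dec 0 t); assumption. Qed.

Lemma cont_clamp (U : UniformSpace) (f : U -> R) x :
  continuous f x -> continuous (fun p => Rmax 0 (f p)) x.
Proof.
  intros Hf. apply continuous_ext with (fun p => (f p + Rabs (f p)) / 2).
  - intros p. unfold Rmax. destruct (Rle_dec 0 (f p)).
    + rewrite Rabs_pos_eq by lra. lra.
    + rewrite Rabs_left by lra. lra.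
  - apply cont_div; [lra| |apply continuous_const]. apply cont_plus; [exact Hf|].
    apply cont_Rabs, Hf.
Qed.

(** Continuity on the half-closed strip becomes continuity in the ordinary sense for the extension
    that is constant in time before 0. *)
Lemma strip_clamp_continuous T F x t : Rbar_lt 0 T -> Rbar_lt (Finite t) T ->
  continuous_strip T F -> continuous (fun p : R * R => F (fst p) (Rmax 0 (snd p))) (x, t).
Proof.
  intros H0 Ht HF.
  assert (Hin : strip T (x, Rmax 0 t)).
  { split; simpl; [apply Rmax_l|apply Rbar_lt_clamp; assumption]. }
  specialize (HF _ Hin). unfold continuous. simpl.
  intros P HP. specialize (HF P HP). unfold filtermap, within in *. simpl in HF.
  assert (Hc : filterlim (fun p : R * R => (fst p, Rmax 0 (snd p))) (locally (x, t))
                 (locally (x, Rmax 0 t))).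
  { intros Q [e He].
    assert (C1 := continuous_fst x t (fun y => ball x e y) (ex_intro _ e (fun y H => H))).
    assert (C2 := cont_clamp _ snd (x, t) (continuous_snd x t) (fun y => ball (Rmax 0 t) e y)
                    (ex_intro _ e (fun y H => H))).
    unfold filtermap in *. generalize (filter_and _ _ C1 C2). apply filter_imp.
    intros p [Hp1 Hp2]. apply He. split; assumption. }
  specialize (Hc _ HF). unfold filtermap in Hc.
  assert (HT : locally (x, t) (fun p : R * R => Rbar_lt (Finite (snd p)) T)).
  { exact (continuous_snd x t _ (before_locally t T Ht)). }
  generalize (filter_and _ _ Hc HT). apply filter_imp. intros p [Hp1 Hp2]. apply Hp1.
  split; simpl; [apply Rmax_l|apply Rbar_lt_clamp; assumption].
Qed.

Lemma strip_interior_continuous T F x t : 0 < t -> Rbar_lt (Finite t) T ->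
  continuous_strip T F -> continuous (fun p : R * R => F (fst p) (snd p)) (x, t).
Proof.
  intros H0 Ht HF.
  apply continuous_ext_loc with (fun p : R * R => F (fst p) (Rmax 0 (snd p))).
  - assert (HT : locally (x, t) (fun p : R * R => 0 < snd p)).
    { apply (continuous_snd x t (fun s => 0 < s)).
      apply (locally_ball_intro _ t t H0). intros s Hs. apply Rabs_def2 in Hs. lra. }
    revert HT. apply filter_imp. intros p Hp. rewrite Rmax_right by lra. reflexivity.
  - apply (strip_clamp_continuous T F x t); auto.
    exact (Rbar_lt_of_le 0 t T (Rlt_le _ _ H0) Ht).
Qed.

Lemma is_derive_primitive_on (f : R -> R) (T : Rbar) t :
  (forall x, Rbar_lt (Finite x) T -> continuous f x) -> Rbar_lt 0 T -> Rbar_lt (Finite t) T ->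
  is_derive (fun y => RInt f 0 y) t (f t).
Proof.
  intros Hf H0 Ht. apply (is_derive_RInt (V := R_NormedModule) f (fun y => RInt f 0 y) 0).
  - generalize (before_locally t T Ht). apply filter_imp. intros y Hy.
    apply (RInt_correct (V := R_CompleteNormedModule)), cont_ex_RInt. intros z Hz. apply Hf.
    apply (Rbar_lt_of_le z (Rmax 0 y) T); [apply Hz|apply Rbar_lt_clamp; assumption].
  - apply Hf, Ht.
Qed.

(** Uniformity in a compact parameter, obtained by gluing. *)
Lemma tube_uniform (Q : R -> R -> Prop) a b (t0 : R) : a <= b ->
  (forall x, a <= x <= b -> exists r, 0 < r /\
     forall y s, Rabs (y - x) < r -> Rabs (s - t0) < r -> Q y s) ->
  exists r, 0 < r /\ forall y s, a <= y <= b -> Rabs (s - t0) < r -> Q y s.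
Proof.
  intros Hab Hloc.
  apply (interval_gluing (fun x y => exists r, 0 < r /\
    forall z s, x <= z <= y -> Rabs (s - t0) < r -> Q z s) a b Hab).
  - intros x y z _ Hxy Hyz _ [r1 [Hr1 H1]] [r2 [Hr2 H2]].
    exists (Rmin r1 r2). split; [apply Rmin_glb_lt; auto|]. intros w s Hw Hs.
    assert (Rmin r1 r2 <= r1) by apply Rmin_l. assert (Rmin r1 r2 <= r2) by apply Rmin_r.
    destruct (Rle_lt_dec w y); [apply H1|apply H2]; lra.
  - intros c Hc. destruct (Hloc c Hc) as [r [Hr Hr']].
    exists (r / 2). split; [lra|].
    split; intros y Hy _; exists r; (split; [auto|]); intros z s Hz Hs; apply Hr'; auto;
      apply Rabs_def1; lra.
Qed.

Lemma locally_2d_elim (P : R * R -> Prop) x t : locally (x, t) P ->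
  exists r, 0 < r /\ forall y s, Rabs (y - x) < r -> Rabs (s - t) < r -> P (y, s).
Proof.
  intros [e He]. exists e. split; [apply cond_pos|]. intros y s Hy Hs. apply He.
  split; assumption.
Qed.

(** * The flow of an arbitrary solution *)

(** Total derivative along a curve; only the space derivative has to be jointly continuous. *)
Lemma is_derive_along (F F1 : R -> R -> R) (y : R -> R) t dy d2 :
  locally (y t, t) (fun p : R * R => is_derive (fun z => F z (snd p)) (fst p) (F1 (fst p) (snd p))) ->
  continuous (fun p : R * R => F1 (fst p) (snd p)) (y t, t) ->
  is_derive (F (y t)) t d2 -> is_derive y t dy ->
  is_derive (fun s => F (y s) s) t (F1 (y t) t * dy + d2).
Proof.
  intros H1 Hc H2 Hy.
  assert (HF := is_derive_filterdiff F (y t) t F1 d2 H1 H2 Hc).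
  assert (Hid : filterdiff (fun s : R => s) (locally t) (fun s : R => s)) by apply filterdiff_id.
  assert (Hcomp := filterdiff_comp'_2 y (fun s => s) F t _ _
    (fun v w : R => plus (scal v (F1 (y t) t)) (scal w d2)) Hy Hid HF).
  apply (filterdiff_ext_lin _ _ _ Hcomp).
  intros z. unfold plus, scal; simpl. unfold mult; simpl. ring.
Qed.

(** These are the quantities of the explicit solution in the reparametrized time [eta].  The division
    by [lam eta] is carried out beforehand, with [(1 / J - 1) / (lam eta) = f / J], so that [eta = 0]
    is not exceptional. *)
Definition kernel_int (lam : R) (f : R -> R) (eta : R) : R :=
  RInt (fun a => Rpower (1 - lam * eta * f a) (- / lam)) 0 1.

Definition kernel_moment (lam : R) (f : R -> R) (eta : R) : R :=
  RInt (fun a => f a * Rpower (1 - lam * eta * f a) (- / lam - 1)) 0 1.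

Definition label_slope (lam : R) (f : R -> R) (eta a : R) : R :=
  Rpower (kernel_int lam f eta) (- 2 * lam) *
  (f a / (1 - lam * eta * f a) - kernel_moment lam f eta / kernel_int lam f eta).

Definition label_jacobian (lam : R) (f : R -> R) (eta a : R) : R :=
  Rpower (1 - lam * eta * f a) (- / lam) / kernel_int lam f eta.

Lemma Rmax_0_r t : 0 <= t -> Rmax 0 t = t.
Proof. apply Rmax_right. Qed.

Lemma locally_clamp_eq t : 0 < t -> locally t (fun s => Rmax 0 s = s).
Proof.
  intros Ht. apply (locally_ball_intro _ t t Ht). intros s Hs. apply Rabs_def2 in Hs.
  apply Rmax_right. lra.
Qed.

Section Flow.
Context (lam : R) (u0 : R -> R) (T : Rbar) (u gam : R -> R -> R).
Context (T_pos : Rbar_lt 0 T).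
Context (Hsol : solution lam u0 T u) (Hchar : characteristics T u gam).

(* Time is clamped at 0, which makes continuity at the initial time two-sided; [G] will turn out
   to be the logarithm of the Jacobian of the flow. *)
Let gamc a s := gam a (Rmax 0 s).
Let uxc y s := dx u y (Rmax 0 s).
Let slope a s := uxc (gamc a s) s.
Let G a t := RInt (slope a) 0 t.

Lemma flow_cont a t : 0 <= a <= 1 -> Rbar_lt (Finite t) T -> continuous (gamc a) t.
Proof.
  intros Ha Ht. destruct (Hchar a Ha) as [_ [Hc _]].
  assert (Hin : 0 <= Rmax 0 t /\ Rbar_lt (Rmax 0 t) T).
  { split; [apply Rmax_l|apply Rbar_lt_clamp; assumption]. }
  intros P HP. specialize (Hc _ Hin P HP). unfold filtermap, within in *.
  assert (C := cont_clamp _ (fun s : R => s) t (continuous_id t) _ Hc).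
  unfold filtermap in C. generalize (filter_and _ _ C (before_locally t T Ht)).
  apply filter_imp. intros s [Hs1 Hs2]. apply Hs1. split; [apply Rmax_l|].
  apply Rbar_lt_clamp; assumption.
Qed.

Lemma uxc_cont y t : Rbar_lt (Finite t) T ->
  continuous (fun p : R * R => uxc (fst p) (snd p)) (y, t).
Proof. intros Ht. apply (strip_clamp_continuous T (dx u)); auto. apply (sol_cont_dx _ _ _ _ Hsol). Qed.

Lemma slope_cont a t : 0 <= a <= 1 -> Rbar_lt (Finite t) T -> continuous (slope a) t.
Proof.
  intros Ha Ht. apply (continuous_comp_2 (gamc a) (fun s => s) uxc).
  - apply flow_cont; auto.
  - apply continuous_id.
  - apply uxc_cont, Ht.
Qed.

Lemma flow_derive a t : 0 <= a <= 1 -> 0 < t -> Rbar_lt (Finite t) T ->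
  is_derive (gamc a) t (u (gamc a t) t).
Proof.
  intros Ha H0 Ht. destruct (Hchar a Ha) as [_ [_ Hd]].
  apply is_derive_ext_loc with (gam a).
  - generalize (locally_clamp_eq t H0). apply filter_imp. intros s Hs. unfold gamc. rewrite Hs. reflexivity.
  - unfold gamc. rewrite Rmax_0_r by lra. apply Hd; assumption.
Qed.

Lemma flow_init a : 0 <= a <= 1 -> gamc a 0 = a.
Proof. intros Ha. unfold gamc. rewrite Rmax_0_r by lra. apply Hchar, Ha. Qed.

Lemma slope_init a : 0 <= a <= 1 -> slope a 0 = Derive u0 a.
Proof.
  intros Ha. unfold slope, uxc. rewrite flow_init, Rmax_0_r by (auto; lra).
  apply Derive_ext. intros y. apply (sol_init _ _ _ _ Hsol).
Qed.

(** Along characteristics the transport term is part of the total derivative, and what remains of the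
    equation besides the Riccati term is the same for all labels. *)
Lemma slope_riccati a t : 0 <= a <= 1 -> 0 < t -> Rbar_lt (Finite t) T ->
  is_derive (slope a) t (lam * slope a t ^ 2 - (lam + 1) * RInt (fun y => dx u y t ^ 2) 0 1).
Proof.
  intros Ha H0 Ht.
  apply is_derive_ext_loc with (fun s => dx u (gamc a s) s).
  { generalize (locally_clamp_eq t H0). apply filter_imp. intros s Hs. unfold slope, uxc.
    rewrite Hs. reflexivity. }
  assert (Et : slope a t = dx u (gamc a t) t) by (unfold slope, uxc; rewrite Rmax_0_r by lra; reflexivity).
  apply is_derive_eq with
    (dx (dx u) (gamc a t) t * u (gamc a t) t + dt (dx u) (gamc a t) t).
  - apply (is_derive_along (dx u) (dx (dx u))).
    + assert (HT : locally (gamc a t, t) (fun p : R * R => 0 < snd p /\ Rbar_lt (Finite (snd p)) T)).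
      { apply (continuous_snd (gamc a t) t (fun s => 0 < s /\ Rbar_lt (Finite s) T)).
        apply filter_and; [|apply before_locally, Ht].
        apply (locally_ball_intro _ t t H0). intros s Hs. apply Rabs_def2 in Hs. lra. }
      revert HT. apply filter_imp. intros p [Hp1 Hp2]. apply Derive_correct.
      apply (sol_ex_dxx _ _ _ _ Hsol); [lra|exact Hp2].
    + apply (strip_interior_continuous T); auto. apply (sol_cont_dxx _ _ _ _ Hsol).
    + apply Derive_correct, (sol_ex_dxt _ _ _ _ Hsol); assumption.
    + apply flow_derive; assumption.
  - generalize (sol_eq _ _ _ _ Hsol (gamc a t) t H0 Ht). rewrite Et. lra.
Qed.

Lemma log_jacobian_derive a t : 0 <= a <= 1 -> Rbar_lt (Finite t) T -> is_derive (G a) t (slope a t).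
Proof.
  intros Ha Ht. apply (is_derive_primitive_on (slope a) T t); auto.
  intros x Hx. apply slope_cont; auto.
Qed.

Lemma log_jacobian_init a : G a 0 = 0.
Proof. unfold G. rewrite RInt_point. reflexivity. Qed.

Lemma log_jacobian_cont a t : 0 <= a <= 1 -> Rbar_lt (Finite t) T -> continuous (G a) t.
Proof. intros Ha Ht. exact (is_derive_continuous _ _ _ (log_jacobian_derive a t Ha Ht)). Qed.

(** The nonlocal term cancels in the difference of two Riccati equations, which is linear. *)
Lemma slope_difference a b t : 0 <= a <= 1 -> 0 <= b <= 1 -> 0 <= t -> Rbar_lt (Finite t) T ->
  slope a t - slope b t = (Derive u0 a - Derive u0 b) * exp (lam * (G a t + G b t)).
Proof.
  intros Ha Hb H0 Ht.
  set (E := fun s => (slope a s - slope b s) * exp (- (lam * (G a s + G b s)))).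
  assert (HE : E 0 = E t).
  { apply derive_zero_const; auto.
    - intros s Hs. assert (HsT : Rbar_lt (Finite s) T) by (apply (Rbar_lt_of_le s t); [lra|auto]).
      set (I := (lam + 1) * RInt (fun y => dx u y s ^ 2) 0 1).
      apply is_derive_eq with
        (((lam * slope a s ^ 2 - I) - (lam * slope b s ^ 2 - I)) * exp (- (lam * (G a s + G b s)))
         + (slope a s - slope b s) * (- (lam * (slope a s + slope b s)) * exp (- (lam * (G a s + G b s))))).
      2: ring.
      apply (is_derive_mult (fun s => slope a s - slope b s) (fun s => exp (- (lam * (G a s + G b s))))).
      + apply (is_derive_minus (slope a) (slope b)); apply slope_riccati; auto; lra.
      + apply (is_derive_comp_exp (fun s => - (lam * (G a s + G b s)))).
        apply (is_derive_opp (fun s => lam * (G a s + G b s))).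
        apply (is_derive_scal (fun s => G a s + G b s)).
        apply (is_derive_plus (G a) (G b)); apply log_jacobian_derive; auto.
      + intros; apply Rmult_comm.
    - intros s Hs. assert (HsT : Rbar_lt (Finite s) T) by (apply (Rbar_lt_of_le s t); [lra|auto]).
      assert (C1 := slope_cont a s Ha HsT). assert (C2 := slope_cont b s Hb HsT).
      assert (C3 := log_jacobian_cont a s Ha HsT). assert (C4 := log_jacobian_cont b s Hb HsT).
      apply cont_mult; [apply cont_minus; assumption|].
      apply cont_exp, cont_opp, cont_mult; [apply continuous_const|apply cont_plus; assumption]. }
  unfold E in HE. rewrite !log_jacobian_init, !slope_init in HE by auto.
  rewrite Rplus_0_r, Rmult_0_r, Ropp_0, exp_0, Rmult_1_r in HE.
  rewrite HE, Rmult_assoc, <- exp_plus.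
  replace (- (lam * (G a t + G b t)) + lam * (G a t + G b t)) with 0 by ring.
  rewrite exp_0. ring.
Qed.

Let eta b t := RInt (fun s => exp (2 * lam * G b s)) 0 t.

Lemma eta_derive b t : 0 <= b <= 1 -> Rbar_lt (Finite t) T ->
  is_derive (eta b) t (exp (2 * lam * G b t)).
Proof.
  intros Hb Ht. apply (is_derive_primitive_on (fun s => exp (2 * lam * G b s)) T t); auto.
  intros x Hx. apply cont_exp, cont_mult; [apply continuous_const|].
  apply log_jacobian_cont; auto.
Qed.

Lemma eta_init b : eta b 0 = 0.
Proof. unfold eta. rewrite RInt_point. reflexivity. Qed.

(** By [slope_difference] the derivative of the left side is a constant times [exp (2 lam G b)]. *)
Lemma jacobian_quotient a b t : 0 <= a <= 1 -> 0 <= b <= 1 -> 0 <= t -> Rbar_lt (Finite t) T ->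
  exp (- (lam * (G a t - G b t))) = 1 - lam * (Derive u0 a - Derive u0 b) * eta b t.
Proof.
  intros Ha Hb H0 Ht.
  set (c := lam * (Derive u0 a - Derive u0 b)).
  set (E := fun s => exp (- (lam * (G a s - G b s))) + c * eta b s).
  assert (HE : E 0 = E t).
  { apply derive_zero_const; auto.
    - intros s Hs. assert (HsT : Rbar_lt (Finite s) T) by (apply (Rbar_lt_of_le s t); [lra|auto]).
      apply is_derive_eq with
        (- (lam * (slope a s - slope b s)) * exp (- (lam * (G a s - G b s))) + c * exp (2 * lam * G b s)).
      + apply (is_derive_plus (fun s => exp (- (lam * (G a s - G b s))))).
        * apply (is_derive_comp_exp (fun s => - (lam * (G a s - G b s)))).
          apply (is_derive_opp (fun s => lam * (G a s - G b s))).
          apply (is_derive_scal (fun s => G a s - G b s)).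
          apply (is_derive_minus (G a) (G b)); apply log_jacobian_derive; auto.
        * apply (is_derive_scal (eta b)), eta_derive; auto.
      + rewrite slope_difference by (auto; lra). unfold c.
        replace (2 * lam * G b s) with (lam * (G a s + G b s) + - (lam * (G a s - G b s))) by ring.
        rewrite exp_plus. ring.
    - intros s Hs. assert (HsT : Rbar_lt (Finite s) T) by (apply (Rbar_lt_of_le s t); [lra|auto]).
      assert (C3 := log_jacobian_cont a s Ha HsT). assert (C4 := log_jacobian_cont b s Hb HsT).
      assert (C5 := is_derive_continuous _ _ _ (eta_derive b s Hb HsT)).
      apply cont_plus.
      + apply cont_exp, cont_opp, cont_mult; [apply continuous_const|apply cont_minus; assumption].
      + apply cont_mult; [apply continuous_const|assumption]. }
  unfold E in HE. rewrite !log_jacobian_init, eta_init in HE.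
  rewrite Rminus_0_r, !Rmult_0_r, Ropp_0, exp_0, Rplus_0_r in HE. lra.
Qed.

(** ** Differentiability of the flow with respect to the label *)

Lemma ux_periodic y t : 0 <= t -> Rbar_lt (Finite t) T -> dx u (y + 1) t = dx u y t.
Proof.
  intros H0 Ht. unfold dx.
  transitivity (Derive (fun z => u (z + 1) t) y).
  - symmetry. unfold Derive. f_equal. apply Lim_ext. intros h.
    replace (y + h + 1) with (y + 1 + h) by ring. reflexivity.
  - apply Derive_ext. intros z. apply (sol_periodic _ _ _ _ Hsol); assumption.
Qed.

Lemma ux_bounded t1 : 0 <= t1 -> Rbar_lt (Finite t1) T ->
  exists L, 0 < L /\ forall y t, 0 <= t <= t1 -> Rabs (dx u y t) <= L.
Proof.
  intros H0 Ht1.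
  assert (Hloc : forall t, 0 <= t <= t1 -> exists r L, 0 < r /\ 0 < L /\
            forall y s, 0 <= y <= 1 -> Rabs (s - t) < r -> Rabs (uxc y s) <= L).
  { intros t Ht. assert (HtT : Rbar_lt (Finite t) T) by (apply (Rbar_lt_of_le t t1); [lra|auto]).
    apply (interval_gluing (fun x x' => exists r L, 0 < r /\ 0 < L /\
      forall y s, x <= y <= x' -> Rabs (s - t) < r -> Rabs (uxc y s) <= L) 0 1); [lra| |].
    - intros x y z _ _ _ _ [r1 [L1 [Hr1 [HL1 H1]]]] [r2 [L2 [Hr2 [HL2 H2]]]].
      exists (Rmin r1 r2), (L1 + L2). split; [apply Rmin_glb_lt; auto|]. split; [lra|].
      intros w s Hw Hs. assert (Rmin r1 r2 <= r1) by apply Rmin_l.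
      assert (Rmin r1 r2 <= r2) by apply Rmin_r.
      destruct (Rle_lt_dec w y).
      + assert (Rabs (uxc w s) <= L1) by (apply H1; lra). lra.
      + assert (Rabs (uxc w s) <= L2) by (apply H2; lra). lra.
    - intros c _. set (L := Rabs (uxc c t) + 1).
      assert (Hl : locally (c, t) (fun p : R * R => Rabs (uxc (fst p) (snd p)) < L)).
      { apply (lim_eventually_lt (F := locally (c, t)) _ (Rabs (uxc c t))).
        - apply (cont_Rabs (fun p : R * R => uxc (fst p) (snd p)) (c, t)), uxc_cont, HtT.
        - unfold L; lra. }
      destruct (locally_2d_elim _ _ _ Hl) as [r [Hr Hr']]. simpl in Hr'.
      exists (r / 2). split; [lra|]. assert (0 < L) by (unfold L; generalize (Rabs_pos (uxc c t)); lra).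
      split; intros y Hy _; exists r, L; repeat split; auto; intros z s Hz Hs; left; apply Hr'; auto;
        apply Rabs_def1; lra. }
  assert (Hglob : exists L, 0 < L /\ forall t y, 0 <= t <= t1 -> 0 <= y <= 1 -> Rabs (uxc y t) <= L).
  { apply (interval_gluing (fun x x' => exists L, 0 < L /\
      forall t y, x <= t <= x' -> 0 <= y <= 1 -> Rabs (uxc y t) <= L) 0 t1); auto.
    - intros x y z _ _ _ _ [L1 [HL1 H1]] [L2 [HL2 H2]].
      exists (L1 + L2). split; [lra|]. intros t w Ht Hw. destruct (Rle_lt_dec t y).
      + assert (Rabs (uxc w t) <= L1) by (apply H1; lra). lra.
      + assert (Rabs (uxc w t) <= L2) by (apply H2; lra). lra.
    - intros c Hc. destruct (Hloc c Hc) as [r [L [Hr [HL H]]]].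
      exists (r / 2). split; [lra|].
      split; intros y Hy _; exists L; (split; [auto|]); intros t w Ht Hw; apply H; auto;
        apply Rabs_def1; lra. }
  destruct Hglob as [L [HL HLb]]. exists L. split; [exact HL|]. intros y t Ht.
  assert (HtT : Rbar_lt (Finite t) T) by (apply (Rbar_lt_of_le t t1); [lra|auto]).
  destruct (period_representative y) as [z [n [Hz ->]]].
  rewrite (periodic_IZR (fun y => dx u y t)).
  - specialize (HLb t z Ht ltac:(lra)). unfold uxc in HLb. rewrite Rmax_0_r in HLb by lra. exact HLb.
  - intros x. apply ux_periodic; [lra|exact HtT].
Qed.

Lemma u_increment y z t : 0 <= t -> Rbar_lt (Finite t) T -> exists x,
  Rabs (x - y) <= Rabs (z - y) /\ u z t - u y t = dx u x t * (z - y).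
Proof.
  intros H0 Ht.
  destruct (MVT_gen (fun y => u y t) y z (fun y => dx u y t)) as [x [Hx1 Hx2]].
  - intros x _. exact (Derive_correct (fun y => u y t) x (sol_ex_dx _ _ _ _ Hsol x t H0 Ht)).
  - intros x _. apply continuity_pt_filterlim.
    exact (ex_derive_continuous (V := R_NormedModule) _ _ (sol_ex_dx _ _ _ _ Hsol x t H0 Ht)).
  - exists x. split; [|exact Hx2]. unfold Rabs, Rmin, Rmax in *.
    destruct (Rle_dec y z), (Rcase_abs (x - y)), (Rcase_abs (z - y)); lra.
Qed.

Lemma flow_lipschitz t1 : 0 <= t1 -> Rbar_lt (Finite t1) T -> exists K, 0 < K /\
  forall a c t, 0 <= a <= 1 -> 0 <= c <= 1 -> 0 <= t <= t1 ->
    Rabs (gamc c t - gamc a t) <= K * Rabs (c - a).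
Proof.
  intros H0 Ht1. destruct (ux_bounded t1 H0 Ht1) as [L [HL HLb]].
  exists (exp (L * t1)). split; [apply exp_pos|]. intros a c t Ha Hc Ht.
  apply Rle_trans with (Rabs (gamc c 0 - gamc a 0) * exp (L * t)).
  - apply (gronwall (fun s => gamc c s - gamc a s) (fun s => u (gamc c s) s - u (gamc a s) s)); [lra|..].
    + intros s Hs. assert (HsT : Rbar_lt (Finite s) T) by (apply (Rbar_lt_of_le s t1); [lra|auto]).
      apply (is_derive_minus (gamc c) (gamc a)); apply flow_derive; auto; lra.
    + intros s Hs. assert (HsT : Rbar_lt (Finite s) T) by (apply (Rbar_lt_of_le s t1); [lra|auto]).
      apply cont_minus; apply flow_cont; auto.
    + intros s Hs. assert (HsT : Rbar_lt (Finite s) T) by (apply (Rbar_lt_of_le s t1); [lra|auto]).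
      destruct (u_increment (gamc a s) (gamc c s) s) as [x [_ Hx]]; [lra|auto|].
      rewrite Hx, Rabs_mult. apply Rmult_le_compat_r; [apply Rabs_pos|]. apply HLb; lra.
  - rewrite !flow_init by auto. rewrite Rmult_comm. apply Rmult_le_compat_r; [apply Rabs_pos|].
    destruct (Rle_lt_or_eq_dec (L * t) (L * t1)) as [Hlt|Heq].
    + apply Rmult_le_compat_l; lra.
    + left; apply exp_increasing, Hlt.
    + right; f_equal; exact Heq.
Qed.

Lemma ux_uniform_along a t1 eps : 0 <= a <= 1 -> 0 <= t1 -> Rbar_lt (Finite t1) T -> 0 < eps ->
  exists rho, 0 < rho /\ forall t y, 0 <= t <= t1 -> Rabs (y - gamc a t) < rho ->
    Rabs (dx u y t - slope a t) < eps.
Proof.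
  intros Ha H0 Ht1 Heps.
  assert (Hg : exists rho, 0 < rho /\ forall t y, 0 <= t <= t1 -> Rabs (y - gamc a t) < rho ->
    Rabs (uxc y t - slope a t) < eps).
  { apply (interval_gluing (fun x x' => exists rho, 0 < rho /\ forall t y, x <= t <= x' ->
      Rabs (y - gamc a t) < rho -> Rabs (uxc y t - slope a t) < eps) 0 t1); auto.
    - intros x y z _ _ _ _ [r1 [Hr1 H1]] [r2 [Hr2 H2]].
      exists (Rmin r1 r2). split; [apply Rmin_glb_lt; auto|]. intros t w Ht Hw.
      assert (Rmin r1 r2 <= r1) by apply Rmin_l. assert (Rmin r1 r2 <= r2) by apply Rmin_r.
      destruct (Rle_lt_dec t y); [apply H1|apply H2]; lra.
    - intros c Hc. assert (HcT : Rbar_lt (Finite c) T) by (apply (Rbar_lt_of_le c t1); [lra|auto]).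
      assert (He2 : 0 < eps / 2) by lra.
      destruct (locally_2d_elim _ _ _ (proj1 (lim_eps _ _) (uxc_cont (gamc a c) c HcT) _ He2))
        as [r1 [Hr1 H1]]. simpl in H1.
      destruct (locally_ball_elim _ _ (proj1 (lim_eps _ _) (slope_cont a c Ha HcT) _ He2))
        as [r2 [Hr2 H2]].
      assert (Hr12 : 0 < r1 / 2) by lra.
      destruct (locally_ball_elim _ _ (proj1 (lim_eps _ _) (flow_cont a c Ha HcT) _ Hr12))
        as [r3 [Hr3 H3]].
      assert (Hk : forall t y, Rabs (t - c) < r1 -> Rabs (t - c) < r2 -> Rabs (t - c) < r3 ->
                Rabs (y - gamc a t) < r1 / 2 -> Rabs (uxc y t - slope a t) < eps).
      { intros t y Ht1' Ht2 Ht3 Hy. specialize (H2 t Ht2). specialize (H3 t Ht3).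
        assert (Hy' : Rabs (y - gamc a c) < r1) by (apply Rabs_def2 in Hy, H3; apply Rabs_def1; lra).
        specialize (H1 y t Hy' Ht1'). unfold slope in *.
        apply Rabs_def2 in H1, H2. apply Rabs_def1; lra. }
      set (r := Rmin r1 (Rmin r2 r3)).
      assert (r <= r1) by apply Rmin_l.
      assert (r <= r2) by (eapply Rle_trans; [apply Rmin_r|apply Rmin_l]).
      assert (r <= r3) by (eapply Rle_trans; [apply Rmin_r|apply Rmin_r]).
      assert (Hr : 0 < r) by (repeat apply Rmin_glb_lt; auto).
      exists (r / 2). split; [lra|].
      split; intros y Hy _; exists (r1 / 2); (split; [auto|]); intros t w Ht Hw;
        apply Hk; auto; apply Rabs_def1; lra. }
  destruct Hg as [rho [Hrho H]]. exists rho. split; auto. intros t y Ht Hy.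
  specialize (H t y Ht Hy). unfold uxc in H. rewrite Rmax_0_r in H by lra. exact H.
Qed.

(** The quotient of an increment of the flow by the candidate Jacobian has a small logarithmic
    derivative, hence stays close to its initial value. *)
Lemma flow_increment a t1 eps : 0 <= a <= 1 -> 0 <= t1 -> Rbar_lt (Finite t1) T -> 0 < eps ->
  exists rho, 0 < rho /\ forall c, 0 <= c <= 1 -> Rabs (c - a) < rho ->
    Rabs (gamc c t1 - gamc a t1 - exp (G a t1) * (c - a)) <= eps * Rabs (c - a).
Proof.
  intros Ha H0 Ht1 Heps.
  destruct (flow_lipschitz t1 H0 Ht1) as [K [HK HKl]].
  set (kap := Rmin 1 (eps / (exp (G a t1) * exp t1 * (t1 + 1)))).
  assert (He1 : 0 < exp (G a t1)) by apply exp_pos. assert (He2 : 0 < exp t1) by apply exp_pos.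
  assert (Hden : 0 < exp (G a t1) * exp t1 * (t1 + 1)) by (repeat apply Rmult_lt_0_compat; lra).
  assert (Hkap : 0 < kap) by (apply Rmin_glb_lt; [lra|apply Rdiv_lt_0_compat; lra]).
  assert (Hkap1 : kap <= 1) by apply Rmin_l.
  assert (Hkap2 : kap * (exp (G a t1) * exp t1 * (t1 + 1)) <= eps).
  { apply Rle_trans with (eps / (exp (G a t1) * exp t1 * (t1 + 1)) * (exp (G a t1) * exp t1 * (t1 + 1))).
    - apply Rmult_le_compat_r; [lra|apply Rmin_r].
    - right; field; lra. }
  destruct (ux_uniform_along a t1 kap Ha H0 Ht1 Hkap) as [rho [Hrho Hu]].
  exists (rho / K). split; [apply Rdiv_lt_0_compat; lra|]. intros c Hc Hca.
  assert (HKc : K * Rabs (c - a) < rho).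
  { apply (Rmult_lt_compat_l K) in Hca; auto. replace (K * (rho / K)) with rho in Hca by (field; lra).
    exact Hca. }
  set (Q := fun s => (gamc c s - gamc a s) * exp (- G a s)).
  set (dQ := fun s => (u (gamc c s) s - u (gamc a s) s) * exp (- G a s)
                      + (gamc c s - gamc a s) * (- slope a s * exp (- G a s))).
  assert (HQd : forall s, 0 < s < t1 -> is_derive Q s (dQ s)).
  { intros s Hs. assert (HsT : Rbar_lt (Finite s) T) by (apply (Rbar_lt_of_le s t1); [lra|auto]).
    apply (is_derive_mult (fun s => gamc c s - gamc a s) (fun s => exp (- G a s))).
    - apply (is_derive_minus (gamc c) (gamc a)); apply flow_derive; auto; lra.
    - apply (is_derive_comp_exp (fun s => - G a s)).
      apply (is_derive_opp (G a)), log_jacobian_derive; auto.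
    - intros; apply Rmult_comm. }
  assert (HQc : forall s, 0 <= s <= t1 -> continuous Q s).
  { intros s Hs. assert (HsT : Rbar_lt (Finite s) T) by (apply (Rbar_lt_of_le s t1); [lra|auto]).
    apply cont_mult.
    - apply cont_minus; apply flow_cont; auto.
    - apply cont_exp, cont_opp, log_jacobian_cont; auto. }
  assert (HQb : forall s, 0 < s < t1 -> Rabs (dQ s) <= kap * Rabs (Q s)).
  { intros s Hs. assert (HsT : Rbar_lt (Finite s) T) by (apply (Rbar_lt_of_le s t1); [lra|auto]).
    destruct (u_increment (gamc a s) (gamc c s) s) as [x [Hx1 Hx2]]; [lra|auto|].
    assert (Hxr : Rabs (x - gamc a s) < rho).
    { apply Rle_lt_trans with (1 := Hx1). apply Rle_lt_trans with (2 := HKc). apply HKl; auto; lra. }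
    assert (E : dQ s = (dx u x s - slope a s) * Q s) by (unfold dQ, Q; rewrite Hx2; ring).
    rewrite E, Rabs_mult. apply Rmult_le_compat_r; [apply Rabs_pos|]. left. apply Hu; [lra|exact Hxr]. }
  assert (HQ0 : Q 0 = c - a).
  { unfold Q. rewrite !flow_init, log_jacobian_init, Ropp_0, exp_0 by auto. ring. }
  assert (HQs : forall s, 0 <= s <= t1 -> Rabs (Q s) <= Rabs (c - a) * exp t1).
  { intros s Hs. apply Rle_trans with (Rabs (Q 0) * exp (kap * s)).
    - apply (gronwall Q dQ); [lra| | |]; intros; [apply HQd|apply HQc|apply HQb]; lra.
    - rewrite HQ0. apply Rmult_le_compat_l; [apply Rabs_pos|].
      destruct (Rle_lt_or_eq_dec (kap * s) t1) as [Hlt|Heq]; [nra| |].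
      + left; apply exp_increasing, Hlt.
      + right; f_equal; exact Heq. }
  assert (HQinc : Rabs (Q t1 - Q 0) <= kap * (Rabs (c - a) * exp t1) * t1).
  { apply (derive_bounded_increment Q dQ); auto. intros s Hs.
    apply Rle_trans with (1 := HQb s Hs). apply Rmult_le_compat_l; [lra|]. apply HQs; lra. }
  rewrite HQ0 in HQinc.
  replace (gamc c t1 - gamc a t1 - exp (G a t1) * (c - a)) with (exp (G a t1) * (Q t1 - (c - a))).
  2:{ unfold Q. rewrite exp_Ropp. field. lra. }
  rewrite Rabs_mult, Rabs_pos_eq by lra.
  apply Rle_trans with (exp (G a t1) * (kap * (Rabs (c - a) * exp t1) * t1)).
  - apply Rmult_le_compat_l; lra.
  - assert (0 <= Rabs (c - a)) by apply Rabs_pos.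
    apply Rle_trans with (kap * (exp (G a t1) * exp t1 * (t1 + 1)) * Rabs (c - a)).
    + replace (exp (G a t1) * (kap * (Rabs (c - a) * exp t1) * t1))
        with (kap * exp (G a t1) * exp t1 * Rabs (c - a) * t1) by ring.
      replace (kap * (exp (G a t1) * exp t1 * (t1 + 1)) * Rabs (c - a))
        with (kap * exp (G a t1) * exp t1 * Rabs (c - a) * (t1 + 1)) by ring.
      apply Rmult_le_compat_l; [|lra]. repeat apply Rmult_le_pos; lra.
    + apply Rmult_le_compat_r; lra.
Qed.

(** As [u] is periodic, [gamc 0 + 1] follows the characteristic that starts at 1, and Gronwall's
    estimate gives uniqueness. *)
Lemma flow_one_turn t : 0 <= t -> Rbar_lt (Finite t) T -> gamc 1 t = gamc 0 t + 1.
Proof.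
  intros H0 Ht. destruct (ux_bounded t H0 Ht) as [L [HL HLb]].
  assert (Hg : Rabs (gamc 1 t - gamc 0 t - 1) <= Rabs (gamc 1 0 - gamc 0 0 - 1) * exp (L * t)).
  { apply (gronwall (fun s => gamc 1 s - gamc 0 s - 1) (fun s => u (gamc 1 s) s - u (gamc 0 s) s - 0)); auto.
    - intros s Hs. assert (HsT : Rbar_lt (Finite s) T) by (apply (Rbar_lt_of_le s t); [lra|auto]).
      apply (is_derive_minus (fun s => gamc 1 s - gamc 0 s) (fun _ => 1)).
      + apply (is_derive_minus (gamc 1) (gamc 0)); apply flow_derive; auto; lra.
      + apply (is_derive_const (V := R_NormedModule)).
    - intros s Hs. assert (HsT : Rbar_lt (Finite s) T) by (apply (Rbar_lt_of_le s t); [lra|auto]).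
      apply cont_minus; [|apply continuous_const]. apply cont_minus; apply flow_cont; auto; lra.
    - intros s Hs. assert (HsT : Rbar_lt (Finite s) T) by (apply (Rbar_lt_of_le s t); [lra|auto]).
      rewrite <- (sol_periodic _ _ _ _ Hsol (gamc 0 s) s) by (auto; lra).
      destruct (u_increment (gamc 0 s + 1) (gamc 1 s) s) as [x [_ Hx]]; [lra|auto|].
      rewrite Rminus_0_r, Hx, Rabs_mult.
      replace (gamc 1 s - gamc 0 s - 1) with (gamc 1 s - (gamc 0 s + 1)) by ring.
      apply Rmult_le_compat_r; [apply Rabs_pos|]. apply HLb; lra. }
  rewrite !flow_init in Hg by lra.
  replace (1 - 0 - 1) with 0 in Hg by ring. rewrite Rabs_R0, Rmult_0_l in Hg.
  assert (0 <= Rabs (gamc 1 t - gamc 0 t - 1)) by apply Rabs_pos.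
  assert (E : gamc 1 t - gamc 0 t - 1 = 0).
  { destruct (Req_dec (gamc 1 t - gamc 0 t - 1) 0) as [E|E]; [exact E|].
    apply Rabs_pos_lt in E. lra. }
  lra.
Qed.

Lemma is_derive_of_increment (F : R -> R) a (l : R) :
  (forall eps, 0 < eps -> exists rho, 0 < rho /\ forall c, Rabs (c - a) < rho ->
     Rabs (F c - F a - l * (c - a)) <= eps * Rabs (c - a)) ->
  is_derive F a l.
Proof.
  intros H. split; [apply is_linear_scal_l|].
  intros x Hx.
  apply (is_filter_lim_locally_unique (K := R_AbsRing) (V := R_NormedModule)) in Hx. subst x.
  intros eps. destruct (H eps (cond_pos eps)) as [rho [Hrho Hb]].
  apply (locally_ball_intro _ a rho Hrho). intros c Hc. specialize (Hb c Hc).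
  unfold norm, minus, plus, opp, scal; simpl. unfold mult, abs; simpl.
  replace (F c + - F a + - ((c + - a) * l)) with (F c - F a - l * (c - a)) by ring. exact Hb.
Qed.

(** Both sides have the same derivative with respect to the label.  The function [g] extends the
    Jacobian continuously to all labels. *)
Lemma flow_as_integral t (g : R -> R) : 0 <= t -> Rbar_lt (Finite t) T ->
  (forall a, continuous g a) -> (forall a, 0 <= a <= 1 -> g a = exp (G a t)) ->
  forall a, 0 <= a <= 1 -> gamc a t = gamc 0 t + RInt g 0 a.
Proof.
  intros H0 Ht Hg Hgeq a Ha.
  set (cl := fun a => Rmax 0 (Rmin 1 a)).
  assert (Hcl : forall c, 0 <= cl c <= 1).
  { intros c. unfold cl. split; [apply Rmax_l|]. apply Rmax_lub; [lra|apply Rmin_l]. }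
  assert (Hcl1 : forall c, 0 <= c <= 1 -> cl c = c).
  { intros c Hc. unfold cl. rewrite Rmin_right, Rmax_right by lra. reflexivity. }
  destruct (flow_lipschitz t H0 Ht) as [K [HK HKl]].
  set (F := fun a => gamc (cl a) t - RInt g 0 a).
  assert (HF : F 0 = F a).
  { apply derive_zero_const; [lra| |].
    - intros c Hc. apply is_derive_eq with (g c - g c); [|ring].
      apply (is_derive_minus (fun a => gamc (cl a) t) (fun a => RInt g 0 a)).
      2: apply is_derive_primitive, Hg.
      apply is_derive_of_increment. intros eps Heps.
      destruct (flow_increment c t eps) as [rho [Hrho Hinc]]; auto; [lra|].
      exists (Rmin rho (Rmin c (1 - c))). split; [repeat apply Rmin_glb_lt; lra|].
      intros z Hz. rewrite Hgeq by lra.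
      assert (H1 := Rmin_l rho (Rmin c (1 - c))). assert (H2 := Rmin_r rho (Rmin c (1 - c))).
      assert (H3 := Rmin_l c (1 - c)). assert (H4 := Rmin_r c (1 - c)).
      assert (Hz' := Rabs_def2 _ _ Hz).
      rewrite !Hcl1 by lra. apply Hinc; lra.
    - intros c Hc. apply cont_minus.
      2: apply (is_derive_continuous _ _ _ (is_derive_primitive g 0 c Hg)).
      apply lim_eps. intros eps Heps.
      apply (locally_ball_intro _ c (eps / K)); [apply Rdiv_lt_0_compat; lra|]. intros z Hz.
      apply Rle_lt_trans with (K * Rabs (cl z - cl c)); [apply HKl; auto; lra|].
      apply Rle_lt_trans with (K * Rabs (z - c)).
      + apply Rmult_le_compat_l; [lra|]. rewrite (Hcl1 c) by lra. unfold cl, Rmax, Rmin, Rabs.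
        destruct (Rle_dec 1 z), (Rcase_abs (z - c));
        match goal with |- context [Rle_dec ?x ?y] => destruct (Rle_dec x y) end;
        match goal with |- context [Rcase_abs ?x] => destruct (Rcase_abs x) end; lra.
      + apply (Rmult_lt_compat_l K) in Hz; auto. replace (K * (eps / K)) with eps in Hz by (field; lra).
        exact Hz. }
  unfold F in HF. rewrite !Hcl1, RInt_point in HF by lra. unfold zero in HF; simpl in HF. lra.
Qed.

Lemma ux_cont_space t y : 0 <= t -> Rbar_lt (Finite t) T -> continuous (fun x => dx u x t) y.
Proof.
  intros H0 Ht.
  exact (ex_derive_continuous (V := R_NormedModule) _ _ (sol_ex_dxx _ _ _ _ Hsol y t H0 Ht)).
Qed.

Lemma ux_mean_zero t : 0 <= t -> Rbar_lt (Finite t) T -> RInt (fun x => dx u x t) 0 1 = 0.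
Proof.
  intros H0 Ht. unfold dx at 1.
  transitivity (u 1 t - u 0 t).
  - apply (RInt_Derive (fun y => u y t)).
    + intros x _. apply (sol_ex_dx _ _ _ _ Hsol x t H0 Ht).
    + intros x _. apply (ux_cont_space t x H0 Ht).
  - eqR. replace 1 with (0 + 1) by ring. rewrite (sol_periodic _ _ _ _ Hsol) by assumption. ring.
Qed.

(** Let [b] be a zero of [u0'].  By [jacobian_quotient] the Jacobian at [a] is the one at [b] times
    [(1 - lam tau u0' a)^(- 1 / lam)], where [tau' = exp (2 lam G b)].  As the Jacobian has integral 1,
    its value at [b] is the inverse of [kernel_int].  The slopes follow from [slope_difference] up to a
    term independent of the label, which is determined by the mean of [u_x] being 0. *)
Theorem flow_formula (m0 M0 : R) :
  lam <> 0 -> (forall x, continuous (Derive u0) x) ->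
  (forall x, m0 <= Derive u0 x <= M0) ->
  (exists a, 0 <= a <= 1 /\ Derive u0 a = M0) -> (exists a, 0 <= a <= 1 /\ Derive u0 a = m0) ->
  (exists a, 0 <= a <= 1 /\ Derive u0 a = 0) ->
  exists tau : R -> R, tau 0 = 0 /\ forall t, 0 <= t -> Rbar_lt (Finite t) T ->
    (0 < t -> 0 < tau t) /\ (forall a, 0 < 1 - lam * tau t * Derive u0 a) /\
    is_derive tau t (Rpower (kernel_int lam (Derive u0) (tau t)) (- 2 * lam)) /\
    (forall a, 0 <= a <= 1 -> ux_along u gam a t = label_slope lam (Derive u0) (tau t) a) /\
    (forall phi, (forall x, continuous phi x) ->
       RInt (fun x => phi (dx u x t)) 0 1 =
       RInt (fun a => phi (label_slope lam (Derive u0) (tau t) a) *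
                      label_jacobian lam (Derive u0) (tau t) a) 0 1).
Proof.
  intros Hlam Hfc Hfb [aM [HaM HfM]] [am [Ham Hfm]] [b [Hb Hfz]].
  set (f := Derive u0) in *.
  exists (eta b). split; [apply eta_init|]. intros t H0 Ht.
  assert (Hpos : 0 < t -> 0 < eta b t).
  { intros Ht0. rewrite <- (eta_init b).
    apply (derive_pos_lt (eta b) (fun s => exp (2 * lam * G b s))); auto.
    - intros s Hs. apply eta_derive; auto. apply (Rbar_lt_of_le s t); [lra|auto].
    - intros; apply exp_pos. }
  assert (Hnn : 0 <= eta b t).
  { destruct (Rle_lt_or_eq_dec _ _ H0) as [Hlt|Heq]; [left; auto|].
    rewrite <- Heq, eta_init. lra. }
  assert (HJ : forall a, 0 <= a <= 1 -> exp (- (lam * (G a t - G b t))) = 1 - lam * eta b t * f a).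
  { intros a Ha. rewrite jacobian_quotient by auto. fold f. rewrite Hfz. ring. }
  assert (HJpos : forall a, 0 < 1 - lam * eta b t * f a).
  { intros a. assert (H1 : 0 < 1 - lam * eta b t * M0) by (rewrite <- HfM, <- HJ by auto; apply exp_pos).
    assert (H2 : 0 < 1 - lam * eta b t * m0) by (rewrite <- Hfm, <- HJ by auto; apply exp_pos).
    destruct (Hfb a) as [H3 H4].
    destruct (Rle_lt_dec 0 (lam * eta b t)); nra. }
  set (eb := eta b t) in *.
  set (gext := fun a => exp (G b t) * Rpower (1 - lam * eb * f a) (- / lam)).
  assert (Hgc : forall a, continuous gext a).
  { intros a. unfold gext. specialize (HJpos a). cont. }
  assert (HgG : forall a, 0 <= a <= 1 -> gext a = exp (G a t)).
  { intros a Ha. unfold gext. rewrite <- HJ by auto. unfold Rpower. rewrite ln_exp, <- exp_plus.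
    f_equal. field. exact Hlam. }
  assert (Hflow := flow_as_integral t gext H0 Ht Hgc HgG).
  set (Gam := fun a => gamc 0 t + RInt gext 0 a).
  assert (HGd : forall a, is_derive Gam a (gext a)).
  { intros a. apply is_derive_eq with (0 + gext a); [|ring].
    apply (is_derive_plus (fun _ => gamc 0 t) (fun a => RInt gext 0 a)).
    - apply (is_derive_const (V := R_NormedModule)).
    - apply is_derive_primitive, Hgc. }
  assert (Hint1 : RInt gext 0 1 = 1).
  { generalize (Hflow 1 ltac:(lra)). rewrite flow_one_turn by auto. lra. }
  assert (HKex : ex_RInt (fun a => Rpower (1 - lam * eb * f a) (- / lam)) 0 1).
  { apply continuous_ex_RInt. intros a. specialize (HJpos a). cont. }
  assert (HK : exp (G b t) * kernel_int lam f eb = 1).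
  { unfold kernel_int. rewrite <- RInt_mult_l by exact HKex. exact Hint1. }
  assert (HeG : 0 < exp (G b t)) by apply exp_pos.
  assert (HKpos : 0 < kernel_int lam f eb) by nra.
  assert (HlnK : ln (kernel_int lam f eb) = - G b t).
  { replace (kernel_int lam f eb) with (exp (- G b t)); [apply ln_exp|].
    apply Rmult_eq_reg_l with (exp (G b t)); [|lra].
    rewrite HK, <- exp_plus, Rplus_opp_r. apply exp_0. }
  assert (HK2 : exp (2 * lam * G b t) = Rpower (kernel_int lam f eb) (- 2 * lam)).
  { unfold Rpower. rewrite HlnK. f_equal. ring. }
  set (K := kernel_int lam f eb) in *.
  set (sext := fun a => slope b t + Rpower K (- 2 * lam) * (f a / (1 - lam * eb * f a))).
  assert (Hsc : forall a, continuous sext a).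
  { intros a. unfold sext. specialize (HJpos a). cont. }
  assert (Hss : forall a, 0 <= a <= 1 -> slope a t = sext a).
  { intros a Ha. unfold sext. rewrite <- HK2, <- HJ by auto.
    generalize (slope_difference a b t Ha Hb H0 Ht). fold f. rewrite Hfz, Rminus_0_r. intros E.
    rewrite exp_Ropp. unfold Rdiv. rewrite Rinv_inv.
    replace (exp (2 * lam * G b t) * (f a * exp (lam * (G a t - G b t))))
      with (f a * exp (lam * (G a t + G b t))); [lra|].
    replace (lam * (G a t + G b t)) with (2 * lam * G b t + lam * (G a t - G b t)) by ring.
    rewrite exp_plus. ring. }
  assert (Hslope : forall a, 0 <= a <= 1 -> dx u (Gam a) t = sext a).
  { intros a Ha. rewrite <- Hss by auto. unfold slope, uxc. rewrite Rmax_0_r by auto.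
    unfold Gam. rewrite <- Hflow by auto. reflexivity. }
  assert (Hcv : forall phi, (forall x, continuous phi x) ->
     RInt (fun x => phi (dx u x t)) 0 1 = RInt (fun a => phi (sext a) * gext a) 0 1).
  { intros phi Hphi.
    assert (Hpc : forall x, continuous (fun x => phi (dx u x t)) x).
    { intros x. apply (continuous_comp (fun x => dx u x t) phi); [apply ux_cont_space; auto|apply Hphi]. }
    rewrite <- (RInt_period (fun x => phi (dx u x t)) (Gam 0)); auto.
    2:{ intros x. rewrite ux_periodic; auto. }
    replace (Gam 0 + 1) with (Gam 1).
    2:{ unfold Gam. rewrite Hint1, RInt_point. unfold zero; simpl. ring. }
    rewrite <- (RInt_comp (fun x => phi (dx u x t)) Gam gext 0 1).
    - apply RInt_ext. intros a. rewrite Rmin_left, Rmax_right by lra. intros Ha.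
      rewrite Hslope by lra. unfold scal; simpl; unfold mult; simpl. ring.
    - intros; apply Hpc.
    - intros a _. split; [apply HGd|apply Hgc]. }
  assert (Hjac : forall a, gext a = label_jacobian lam f eb a).
  { intros a. unfold gext, label_jacobian. fold K. replace (exp (G b t)) with (/ K).
    - unfold Rdiv. ring.
    - apply Rmult_eq_reg_r with K; [|lra]. rewrite Rinv_l; lra. }
  assert (Hmean : slope b t = - Rpower K (- 2 * lam) * (kernel_moment lam f eb / K)).
  { assert (E := Hcv (fun x => x) (fun x => continuous_id x)).
    cbv beta in E. rewrite ux_mean_zero in E by auto.
    assert (Emom : ex_RInt (fun a => f a * Rpower (1 - lam * eb * f a) (- / lam - 1)) 0 1).
    { apply continuous_ex_RInt. intros a. specialize (HJpos a). cont. }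
    assert (E2 : RInt (fun a => sext a * gext a) 0 1 =
                 slope b t * 1 + (Rpower K (- 2 * lam) / K) * kernel_moment lam f eb).
    { replace (slope b t * 1) with (slope b t * RInt gext 0 1) by (rewrite Hint1; reflexivity).
      unfold kernel_moment. rewrite <- !RInt_mult_l; auto.
      2: apply continuous_ex_RInt, Hgc.
      rewrite <- RInt_add.
      - apply RInt_ext. intros a _. rewrite Hjac. unfold sext, label_jacobian. fold K.
        specialize (HJpos a). rewrite <- Rpower_scale_inv by exact HJpos. eqR. field. lra.
      - apply (ex_RInt_scal gext), continuous_ex_RInt, Hgc.
      - apply (ex_RInt_scal (fun a => f a * Rpower (1 - lam * eb * f a) (- / lam - 1))), Emom. }
    rewrite E2 in E. unfold Rdiv in *. lra. }
  assert (Hsl : forall a, sext a = label_slope lam f eb a).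
  { intros a. unfold sext, label_slope. fold K. rewrite Hmean. ring. }
  split; [exact Hpos|]. split; [exact HJpos|]. split; [|split].
  - rewrite <- HK2. apply eta_derive; auto.
  - intros a Ha. rewrite <- Hsl, <- Hss by auto. unfold slope, uxc, gamc, ux_along.
    rewrite Rmax_0_r by auto. reflexivity.
  - intros phi Hphi. rewrite Hcv by auto. apply RInt_ext. intros a _.
    rewrite Hsl, Hjac. reflexivity.
Qed.

End Flow.

(** * Reparametrized time *)

Definition sgn (lam : R) : R := if Rlt_dec 0 lam then 1 else -1.

(** [sgn lam * f] attains this maximum where the solution first becomes singular. *)
Definition peak (lam M0 m0 : R) : R := if Rlt_dec 0 lam then M0 else - m0.

Definition gap (lam M0 m0 : R) (f : R -> R) (a : R) : R := peak lam M0 m0 - sgn lam * f a.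

(** Chosen so that [1 - lam eta f = |lam| eta (remaining + gap)]: this turns the integrals of the
    explicit solution into singular integrals of [gap], as [remaining] tends to 0. *)
Definition remaining (lam M0 m0 eta : R) : R := / (Rabs lam * eta) - peak lam M0 m0.

Lemma is_derive_primitive_open (f : R -> R) lo hi t :
  (forall x, lo < x < hi -> continuous f x) -> lo < 0 < hi -> lo < t < hi ->
  is_derive (fun y => RInt f 0 y) t (f t).
Proof.
  intros Hf H0 Ht. apply (is_derive_RInt (V := R_NormedModule) f (fun y => RInt f 0 y) 0).
  - apply (locally_ball_intro _ t (Rmin (t - lo) (hi - t))); [apply Rmin_glb_lt; lra|].
    intros y Hy. assert (H1 := Rmin_l (t - lo) (hi - t)). assert (H2 := Rmin_r (t - lo) (hi - t)).
    apply Rabs_def2 in Hy.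
    apply (RInt_correct (V := R_CompleteNormedModule)), cont_ex_RInt. intros z Hz. apply Hf.
    unfold Rmin, Rmax in Hz. destruct (Rle_dec 0 y); lra.
  - apply Hf, Ht.
Qed.

Section Reparametrization.
Context (lam : R) (f : R -> R) (M0 m0 : R).
Context (lam_ne : lam <> 0) (f_cont : forall x, continuous f x).
Context (f_bounds : forall x, m0 <= f x <= M0) (M0_pos : 0 < M0) (m0_neg : m0 < 0).

Notation A := (peak lam M0 m0).
Notation es := (eta_star lam M0 m0).
Notation h := (gap lam M0 m0 f).
Notation K := (kernel_int lam f).

Lemma sgn_cases : (0 < lam /\ sgn lam = 1 /\ A = M0) \/ (lam < 0 /\ sgn lam = -1 /\ A = - m0).
Proof. unfold sgn, peak. destruct (Rlt_dec 0 lam); [left|right]; repeat split; auto; lra. Qed.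

Lemma lam_sgn : lam = sgn lam * Rabs lam.
Proof.
  destruct sgn_cases as [[H [-> _]]|[H [-> _]]].
  - rewrite Rabs_pos_eq; lra.
  - rewrite Rabs_left; lra.
Qed.

Lemma sgn_sq : sgn lam * sgn lam = 1.
Proof. destruct sgn_cases as [[_ [-> _]]|[_ [-> _]]]; ring. Qed.

Lemma abs_lam_pos : 0 < Rabs lam.
Proof. apply Rabs_pos_lt, lam_ne. Qed.

Lemma peak_pos : 0 < A.
Proof. destruct sgn_cases as [[_ [_ ->]]|[_ [_ ->]]]; lra. Qed.

Lemma eta_star_eq : es = / (Rabs lam * A).
Proof.
  unfold eta_star, peak. destruct (Rlt_dec 0 lam) as [H|H].
  - rewrite Rabs_pos_eq by lra. reflexivity.
  - rewrite Rabs_left1 by lra. f_equal. ring.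
Qed.

Lemma eta_star_pos : 0 < es.
Proof.
  rewrite eta_star_eq. apply Rinv_0_lt_compat, Rmult_lt_0_compat; [apply abs_lam_pos|apply peak_pos].
Qed.

Lemma eta_star_mult : Rabs lam * A * es = 1.
Proof.
  rewrite eta_star_eq. apply Rinv_r, Rgt_not_eq, Rmult_lt_0_compat; [apply abs_lam_pos|apply peak_pos].
Qed.

Lemma gap_nonneg a : 0 <= h a.
Proof.
  unfold gap. specialize (f_bounds a).
  destruct sgn_cases as [[_ [-> ->]]|[_ [-> ->]]]; lra.
Qed.

Lemma gap_cont a : continuous h a.
Proof. unfold gap. cont. Qed.

(** Slightly negative times are included, so that solutions are smooth up to [t = 0]. *)
Definition eta_low : R := - / (Rabs lam * (M0 - m0)).

Lemma eta_low_neg : eta_low < 0.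
Proof.
  unfold eta_low. assert (0 < / (Rabs lam * (M0 - m0))); [|lra].
  apply Rinv_0_lt_compat, Rmult_lt_0_compat; [apply abs_lam_pos|lra].
Qed.

Lemma J_pos e a : eta_low < e < es -> 0 < 1 - lam * e * f a.
Proof.
  intros He. assert (Hl := abs_lam_pos). assert (HA := peak_pos). assert (Hm := eta_star_mult).
  rewrite lam_sgn. set (g := sgn lam * f a).
  replace (sgn lam * Rabs lam * e * f a) with (Rabs lam * e * g) by (unfold g; ring).
  assert (Hg1 : g <= A) by (generalize (gap_nonneg a); unfold gap, g; lra).
  assert (Hg2 : - (M0 - m0) < g).
  { unfold g. specialize (f_bounds a). destruct sgn_cases as [[_ [-> _]]|[_ [-> _]]]; lra. }
  destruct (Rle_lt_dec 0 e) as [H0|H0].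
  - assert (0 <= Rabs lam * e) by (apply Rmult_le_pos; lra).
    assert (Rabs lam * e * g <= Rabs lam * e * A) by (apply Rmult_le_compat_l; lra).
    assert (Rabs lam * A * e < Rabs lam * A * es).
    { apply Rmult_lt_compat_l; [apply Rmult_lt_0_compat|]; lra. }
    lra.
  - assert (Hel : Rabs lam * (M0 - m0) * - eta_low = 1).
    { unfold eta_low. field. split; [lra|]. apply Rgt_not_eq, Hl. }
    assert (Rabs lam * (M0 - m0) * - e < Rabs lam * (M0 - m0) * - eta_low).
    { apply Rmult_lt_compat_l; [apply Rmult_lt_0_compat|]; lra. }
    assert (0 < Rabs lam * - e) by (apply Rmult_lt_0_compat; lra).
    assert (Rabs lam * - e * - g < Rabs lam * - e * (M0 - m0)) by (apply Rmult_lt_compat_l; lra).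
    lra.
Qed.

Lemma kernel_ex e p : eta_low < e < es ->
  ex_RInt (fun a => Rpower (1 - lam * e * f a) p) 0 1.
Proof. intros He. apply continuous_ex_RInt. intros a. assert (H := J_pos e a He). cont. Qed.

Lemma kernel_pos e : eta_low < e < es -> 0 < K e.
Proof.
  intros He. apply RInt_gt_0; [lra|intros; apply Rpower_gt0|].
  intros a _. assert (H := J_pos e a He). cont.
Qed.

Lemma kernel_derive e : eta_low < e < es -> is_derive K e (kernel_moment lam f e).
Proof.
  intros He.
  apply (is_derive_RInt_under (fun e a => Rpower (1 - lam * e * f a) (- / lam))
    (fun e a => f a * Rpower (1 - lam * e * f a) (- / lam - 1)) (fun z => eta_low < z < es)).
  - apply (locally_ball_intro _ e (Rmin (e - eta_low) (es - e))); [apply Rmin_glb_lt; lra|].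
    intros y Hy. assert (H1 := Rmin_l (e - eta_low) (es - e)).
    assert (H2 := Rmin_r (e - eta_low) (es - e)). apply Rabs_def2 in Hy. lra.
  - intros t a Ht. assert (H := J_pos t a Ht).
    apply is_derive_eq with ((- lam * f a) * (- / lam * Rpower (1 - lam * t * f a) (- / lam - 1))).
    + apply (is_derive_comp (fun y => Rpower y (- / lam)) (fun z => 1 - lam * z * f a)).
      * apply is_derive_Rpower, H.
      * auto_derive; auto. ring.
    + field. exact lam_ne.
  - intros a. assert (H := J_pos e a He). cont.
  - intros t a Ht. assert (H := J_pos t a Ht). cont.
Qed.

Notation time := (fun e => RInt (fun mu => Rpower (K mu) (2 * lam)) 0 e).

Lemma time_derive e : eta_low < e < es -> is_derive time e (Rpower (K e) (2 * lam)).
Proof.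
  intros He. apply (is_derive_primitive_open (fun mu => Rpower (K mu) (2 * lam)) eta_low es e); auto.
  - intros x Hx. assert (H1 := kernel_pos x Hx).
    assert (H2 := is_derive_continuous _ _ _ (kernel_derive x Hx)). cont.
  - split; [apply eta_low_neg|apply eta_star_pos].
Qed.

Lemma time_0 : RInt (fun mu => Rpower (K mu) (2 * lam)) 0 0 = 0.
Proof. rewrite RInt_point. reflexivity. Qed.

Lemma time_increasing e e' : eta_low < e -> e < e' -> e' < es -> time e < time e'.
Proof.
  intros H1 H2 H3. apply (derive_pos_lt time (fun e => Rpower (K e) (2 * lam))); auto.
  - intros x Hx. apply time_derive. lra.
  - intros; apply Rpower_gt0.
Qed.

(** ** The variables [eta] and [remaining] *)

Lemma J_factored e a : 0 < e -> 1 - lam * e * f a = Rabs lam * e * (remaining lam M0 m0 e + h a).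
Proof.
  intros He. unfold remaining, gap. assert (Hl := abs_lam_pos).
  rewrite lam_sgn at 1. field. lra.
Qed.

Lemma remaining_eq e : 0 < e -> remaining lam M0 m0 e = A * (es - e) / e.
Proof.
  intros He. unfold remaining. rewrite eta_star_eq. assert (Hl := abs_lam_pos). assert (HA := peak_pos).
  field. lra.
Qed.

Lemma remaining_pos e : 0 < e < es -> 0 < remaining lam M0 m0 e.
Proof.
  intros He. rewrite remaining_eq by lra. assert (HA := peak_pos).
  apply Rdiv_lt_0_compat; [apply Rmult_lt_0_compat|]; lra.
Qed.

Lemma remaining_limit : filterlim (remaining lam M0 m0) (at_left es) (at_right 0).
Proof.
  assert (He := eta_star_pos). assert (HA := peak_pos).
  intros P HP. destruct (at_right_elim _ _ HP) as [r [Hr HrP]].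
  assert (Hx : 0 < es * r / (2 * A)) by (apply Rdiv_lt_0_compat; [apply Rmult_lt_0_compat|]; lra).
  apply (at_left_intro _ es (Rmin (es / 2) (es * r / (2 * A)))).
  - apply Rmin_glb_lt; lra.
  - intros e Hee. assert (H1 := Rmin_l (es / 2) (es * r / (2 * A))).
    assert (H2 := Rmin_r (es / 2) (es * r / (2 * A))).
    apply HrP. split; [apply remaining_pos; lra|]. rewrite remaining_eq by lra.
    apply Rmult_lt_reg_r with e; [lra|].
    replace (A * (es - e) / e * e) with (A * (es - e)) by (field; lra).
    assert (A * (es - e) < A * (es * r / (2 * A))) by (apply Rmult_lt_compat_l; lra).
    replace (A * (es * r / (2 * A))) with (r * (es / 2)) in * by (field; lra).
    assert (r * (es / 2) < r * e) by (apply Rmult_lt_compat_l; lra). lra.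
Qed.

Lemma J_power e a p : 0 < e < es -> Rpower (1 - lam * e * f a) p =
  Rpower (Rabs lam * e) p * Rpower (remaining lam M0 m0 e + h a) p.
Proof.
  intros He. assert (Hr := remaining_pos e He). assert (Hh := gap_nonneg a).
  assert (Hl := abs_lam_pos).
  rewrite J_factored by lra. symmetry. apply Rpower_mult_distr; [apply Rmult_lt_0_compat|]; lra.
Qed.

Lemma kernel_factored e p : 0 < e < es ->
  RInt (fun a => Rpower (1 - lam * e * f a) (- p)) 0 1 =
  Rpower (Rabs lam * e) (- p) * sing_int h p (remaining lam M0 m0 e).
Proof.
  intros He. unfold sing_int. rewrite <- RInt_mult_l.
  - apply RInt_ext. intros a _. apply J_power, He.
  - apply integrand_ex; [apply gap_cont|apply gap_nonneg|apply remaining_pos, He].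
Qed.

Lemma kernel_as_sing_int e : 0 < e < es ->
  K e = Rpower (Rabs lam * e) (- / lam) * sing_int h (/ lam) (remaining lam M0 m0 e).
Proof. intros He. apply kernel_factored, He. Qed.

Lemma sing_int_gap_pos p e : 0 < e < es -> 0 < sing_int h p (remaining lam M0 m0 e).
Proof.
  intros He. apply sing_int_pos; [apply gap_cont|apply gap_nonneg|apply remaining_pos, He].
Qed.

Lemma kernel_power e c : 0 < e < es -> Rpower (K e) (c * lam) =
  Rpower (Rabs lam * e) (- c) * Rpower (sing_int h (/ lam) (remaining lam M0 m0 e)) (c * lam).
Proof.
  intros He. rewrite kernel_as_sing_int by exact He.
  rewrite <- Rpower_mult_distr; [|apply Rpower_gt0|apply sing_int_gap_pos, He].
  rewrite Rpower_mult. do 2 f_equal. field. exact lam_ne.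
Qed.

Lemma jacobian_is_density e a : 0 < e < es ->
  label_jacobian lam f e a = density h lam (remaining lam M0 m0 e) a.
Proof.
  intros He. unfold label_jacobian, density.
  rewrite kernel_as_sing_int, J_power by exact He.
  assert (H1 := sing_int_gap_pos (/ lam) e He).
  assert (H2 : 0 < Rpower (Rabs lam * e) (- / lam)) by apply Rpower_gt0. field. lra.
Qed.

Lemma slope_is_profile e a : 0 < e < es ->
  label_slope lam f e a = sgn lam * profile h lam (remaining lam M0 m0 e) a.
Proof.
  intros He. assert (Hl := abs_lam_pos). assert (Hr := remaining_pos e He).
  assert (Hes : eta_low < e < es) by (generalize eta_low_neg; lra).
  set (x := Rabs lam * e). assert (Hx : 0 < x) by (apply Rmult_lt_0_compat; lra).
  set (d := remaining lam M0 m0 e) in *. set (s := / lam).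
  assert (HS := sing_int_gap_pos s e He). fold d in HS.
  assert (Hfx : forall a, f a = sgn lam * (1 - (1 - lam * e * f a)) / x).
  { intros b. unfold x. rewrite lam_sgn at 2. generalize sgn_sq. intros E.
    replace (sgn lam * (1 - (1 - sgn lam * Rabs lam * e * f b)) / (Rabs lam * e))
      with (sgn lam * sgn lam * f b) by (field; lra). rewrite E. ring. }
  assert (Hmom : kernel_moment lam f e =
    sgn lam / x * (Rpower x (- (s + 1)) * sing_int h (s + 1) d - Rpower x (- s) * sing_int h s d)).
  { unfold kernel_moment. fold s.
    unfold d, x. rewrite <- !kernel_factored by exact He. fold x.
    transitivity (RInt (fun a => sgn lam / x * (Rpower (1 - lam * e * f a) (- (s + 1)) +
                     -1 * Rpower (1 - lam * e * f a) (- s))) 0 1).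
    - apply RInt_ext. intros b _. eqR. rewrite (Hfx b) at 1.
      replace (- (s + 1)) with (- s - 1) by ring.
      assert (HJ := J_pos e b Hes).
      rewrite <- Rpower_scale_inv by exact HJ. field. lra.
    - set (w1 := fun a => Rpower (1 - lam * e * f a) (- (s + 1))).
      set (w0 := fun a => Rpower (1 - lam * e * f a) (- s)).
      assert (E1 : ex_RInt w1 0 1) by (apply kernel_ex, Hes).
      assert (E0 : ex_RInt w0 0 1) by (apply kernel_ex, Hes).
      assert (E2 : ex_RInt (fun a => -1 * w0 a) 0 1) by (apply (ex_RInt_scal w0), E0).
      rewrite (RInt_mult_l (fun a => w1 a + -1 * w0 a)) by (apply (ex_RInt_plus w1); assumption).
      rewrite (RInt_add w1 (fun a => -1 * w0 a)) by assumption.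
      rewrite (RInt_mult_l w0) by assumption. f_equal. lra. }
  unfold label_slope, profile. rewrite kernel_power, Hmom by exact He. fold s d x.
  rewrite kernel_as_sing_int by exact He. fold s d x.
  rewrite (Hfx a) at 1. rewrite J_factored by lra. fold x d.
  assert (Hh := gap_nonneg a).
  replace (Rpower x (- -2)) with (x ^ 2).
  2:{ rewrite Rpower_as_pow by exact Hx. f_equal. simpl. ring. }
  replace (- (s + 1)) with (- s - 1) by ring. rewrite <- Rpower_scale_inv by exact Hx.
  assert (HP : 0 < Rpower x (- s)) by apply Rpower_gt0.
  assert (HQ : Rpower x (- s) * sing_int h s d <> 0) by (apply Rgt_not_eq, Rmult_lt_0_compat; lra).
  field. repeat split; try lra.
Qed.

(** ** Finite and infinite maximal times *)

Definition eta_of (d : R) : R := / (Rabs lam * (d + A)).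

Lemma eta_of_range d : 0 < d -> 0 < eta_of d < es.
Proof.
  intros Hd. assert (Hl := abs_lam_pos). assert (HA := peak_pos). rewrite eta_star_eq. unfold eta_of.
  split; [apply Rinv_0_lt_compat|apply Rinv_lt_contravar; repeat apply Rmult_lt_0_compat];
    try apply Rmult_lt_compat_l; try apply Rmult_lt_0_compat; lra.
Qed.

Lemma remaining_eta_of d : 0 < d -> remaining lam M0 m0 (eta_of d) = d.
Proof.
  intros Hd. assert (Hl := abs_lam_pos). assert (HA := peak_pos). unfold remaining, eta_of. field. lra.
Qed.

Lemma eta_of_remaining e : 0 < e -> eta_of (remaining lam M0 m0 e) = e.
Proof. intros He. assert (Hl := abs_lam_pos). unfold remaining, eta_of. field. lra. Qed.

(** In the variable [remaining] the time elapses at the rate [H^(2 lam) / |lam|], so that the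
    maximal time is finite if and only if [H^(2 lam)] is integrable at 0. *)
Lemma time_eta_of_derive d : 0 < d -> is_derive (fun d => time (eta_of d)) d
  (- (/ Rabs lam * Rpower (sing_int h (/ lam) d) (2 * lam))).
Proof.
  intros Hd. assert (Hl := abs_lam_pos). assert (HA := peak_pos). assert (He := eta_of_range d Hd).
  apply is_derive_eq with (- (Rabs lam / (Rabs lam * (d + A)) ^ 2) * Rpower (K (eta_of d)) (2 * lam)).
  - apply (is_derive_comp time eta_of).
    + apply time_derive. generalize eta_low_neg. lra.
    + unfold eta_of. auto_derive; [|field; lra]. apply Rgt_not_eq, Rmult_lt_0_compat; lra.
  - rewrite kernel_power, remaining_eta_of by assumption.
    replace (Rpower (Rabs lam * eta_of d) (- (2))) with ((d + A) ^ 2).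
    + field. lra.
    + replace (Rabs lam * eta_of d) with (/ (d + A)) by (unfold eta_of; field; lra).
      unfold Rpower. rewrite ln_Rinv by lra. rewrite Rpower_as_pow by lra. unfold Rpower.
      f_equal. simpl. ring.
Qed.

Lemma time_limit (l : Rbar) : filterlim (fun d => time (eta_of d)) (at_right 0) (Rbar_locally l) ->
  filterlim time (at_left es) (Rbar_locally l).
Proof.
  intros H. generalize (filterlim_comp _ _ _ _ _ _ _ _ remaining_limit H). apply filterlim_ext_loc.
  assert (Hes := eta_star_pos). apply (at_left_intro _ es es Hes). intros e He.
  rewrite eta_of_remaining by lra. reflexivity.
Qed.

Lemma time_bounded C r : 0 < C -> 0 < r < 1 ->
  at_right 0 (fun d => Rpower (sing_int h (/ lam) d) (2 * lam) <= C * Rpower d (- r)) ->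
  exists T : R, 0 < T /\ filterlim time (at_left es) (locally T).
Proof.
  intros HC Hr Hup. assert (Hl := abs_lam_pos). assert (Hli := Rinv_0_lt_compat _ Hl).
  destruct (at_right_elim _ _ Hup) as [rho [Hrho Hup']].
  set (d1 := rho / 2). assert (Hd1 : 0 < d1 < rho) by (unfold d1; lra).
  set (C' := / Rabs lam * C / (1 - r)).
  assert (HC' : 0 < C') by (apply Rdiv_lt_0_compat; [apply Rmult_lt_0_compat|]; lra).
  set (F := fun d => time (eta_of d) + C' * Rpower d (1 - r)).
  assert (HF : forall d, 0 < d < d1 -> F d <= F d1).
  { intros d Hd.
    apply (derive_nonneg_le F (fun d => - (/ Rabs lam * Rpower (sing_int h (/ lam) d) (2 * lam)) +
       C' * ((1 - r) * Rpower d (1 - r - 1)))); [lra|..].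
    - intros x Hx. apply (is_derive_plus (fun d => time (eta_of d))).
      + apply time_eta_of_derive. lra.
      + apply (is_derive_scal (fun d => Rpower d (1 - r))), is_derive_Rpower. lra.
    - intros x Hx. assert (Hx0 : 0 < x) by lra.
      apply cont_plus; [apply (is_derive_continuous _ _ _ (time_eta_of_derive x Hx0))|cont].
    - intros x Hx. replace (1 - r - 1) with (- r) by ring.
      replace (C' * ((1 - r) * Rpower x (- r))) with (/ Rabs lam * (C * Rpower x (- r)))
        by (unfold C'; field; lra).
      assert (/ Rabs lam * Rpower (sing_int h (/ lam) x) (2 * lam) <= / Rabs lam * (C * Rpower x (- r))).
      { apply Rmult_le_compat_l; [lra|]. apply Hup'. lra. }
      lra. }
  assert (Hpos : forall d, 0 < d -> 0 < time (eta_of d)).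
  { intros d Hd. assert (He := eta_of_range d Hd). apply Rle_lt_trans with (time 0); [right; symmetry; apply time_0|].
    apply time_increasing; [apply eta_low_neg|lra|lra]. }
  destruct (monotone_bounded_limit (at_right 0) _ (fun d => time (eta_of d)) (fun d => 0 < d < d1) (F d1))
    as [T [HT1 HT2]].
  - apply at_right_0_lt. lra.
  - intros x Hx. apply (at_right_intro _ 0 x); [lra|]. intros y Hy. left.
    assert (Hx' := eta_of_range x (proj1 Hx)). assert (Hy0 : 0 < y) by lra.
    assert (Hy' := eta_of_range y Hy0). assert (HA := peak_pos).
    apply time_increasing; [generalize eta_low_neg; lra| |lra].
    unfold eta_of. apply Rinv_lt_contravar; [repeat apply Rmult_lt_0_compat; lra|].
    apply Rmult_lt_compat_l; lra.
  - intros x Hx. specialize (HF x Hx). unfold F at 1 in HF.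
    assert (0 < C' * Rpower x (1 - r)) by (apply Rmult_lt_0_compat; [lra|apply Rpower_gt0]). lra.
  - exists T. split; [|exact (time_limit T HT1)].
    apply Rlt_le_trans with (1 := Hpos (d1 / 2) ltac:(lra)). apply HT2. lra.
Qed.

Lemma time_unbounded c : 0 < c ->
  at_right 0 (fun d => c * / d <= Rpower (sing_int h (/ lam) d) (2 * lam)) ->
  filterlim time (at_left es) (Rbar_locally p_infty).
Proof.
  intros Hc Hlow. assert (Hl := abs_lam_pos). assert (Hli := Rinv_0_lt_compat _ Hl).
  destruct (at_right_elim _ _ Hlow) as [rho [Hrho Hlow']].
  set (d1 := rho / 2). assert (Hd1 : 0 < d1 < rho) by (unfold d1; lra).
  set (c' := / Rabs lam * c). assert (Hc' : 0 < c') by (apply Rmult_lt_0_compat; lra).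
  set (F := fun d => - (time (eta_of d) + c' * ln d)).
  assert (HF : forall d, 0 < d < d1 -> F d <= F d1).
  { intros d Hd.
    apply (derive_nonneg_le F (fun d => - (- (/ Rabs lam * Rpower (sing_int h (/ lam) d) (2 * lam)) +
       c' * / d))); [lra|..].
    - intros x Hx. apply (is_derive_opp (fun d => time (eta_of d) + c' * ln d)).
      apply (is_derive_plus (fun d => time (eta_of d))).
      + apply time_eta_of_derive. lra.
      + apply (is_derive_scal ln), is_derive_ln. lra.
    - intros x Hx. assert (Hx0 : 0 < x) by lra.
      apply cont_opp, cont_plus; [apply (is_derive_continuous _ _ _ (time_eta_of_derive x Hx0))|cont].
    - intros x Hx.
      assert (/ Rabs lam * (c * / x) <= / Rabs lam * Rpower (sing_int h (/ lam) x) (2 * lam)).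
      { apply Rmult_le_compat_l; [lra|]. apply Hlow'. lra. }
      unfold c'. lra. }
  apply time_limit. apply (lim_pinfty_ge (fun d => c' * (- ln d) - F d1)).
  - generalize (at_right_0_lt d1 (proj1 Hd1)). apply filter_imp. intros d Hd.
    specialize (HF d Hd). unfold F at 1 in HF. lra.
  - apply lim_pinfty_minus_const, lim_pinfty_scal; [exact Hc'|].
    apply lim_pinfty. intros B. generalize (proj1 (lim_minfty _) is_lim_ln_0 (- B)).
    apply filter_imp. intros; lra.
Qed.

End Reparametrization.

(** * Behaviour of solutions at the end of their life span *)

Definition at_end (T : Rbar) : (R -> Prop) -> Prop :=
  match T with Finite x => at_left x | _ => Rbar_locally T end.

Lemma at_end_intro (T : Rbar) (P : R -> Prop) t0 : Rbar_lt (Finite t0) T ->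
  (forall t, t0 < t -> Rbar_lt (Finite t) T -> P t) -> at_end T P.
Proof.
  intros Ht0 HP. destruct T as [T| |]; simpl in *.
  - apply (at_left_intro _ T (T - t0)); [lra|]. intros t Ht. apply HP; lra.
  - exists t0. intros t Ht. apply HP; auto.
  - contradiction.
Qed.

Instance at_end_filter T : ProperFilter (at_end T).
Proof. destruct T; simpl; apply _. Qed.

Section EndOfLife.
Context (lam : R) (u0 : R -> R) (M0 m0 : R) (T : Rbar) (u gam : R -> R -> R).
Context (lam_ne : lam <> 0).
Context (f_cont : forall x, continuous (Derive u0) x).
Context (f_bounds : forall x, m0 <= Derive u0 x <= M0) (M0_pos : 0 < M0) (m0_neg : m0 < 0).
Context (M0_att : exists a, 0 <= a <= 1 /\ Derive u0 a = M0).
Context (m0_att : exists a, 0 <= a <= 1 /\ Derive u0 a = m0).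
Context (T_pos : Rbar_lt 0 T).
Context (HT : filterlim (time_of_eta lam u0) (at_left (eta_star lam M0 m0)) (Rbar_locally T)).
Context (Hsol : solution lam u0 T u) (Hchar : characteristics T u gam).
Notation h := (gap lam M0 m0 (Derive u0)).
Notation es := (eta_star lam M0 m0).

Lemma mean_value_attained : exists a, 0 <= a <= 1 /\ Derive u0 a = 0.
Proof.
  destruct M0_att as [a [Ha Hfa]]. destruct m0_att as [b [Hb Hfb]].
  destruct (IVT_gen (Derive u0) a b 0) as [c [Hc Hfc]].
  - intros x. apply continuity_pt_filterlim, f_cont.
  - rewrite Hfa, Hfb. unfold Rmin, Rmax. destruct (Rle_dec M0 m0); lra.
  - exists c. split; [|exact Hfc]. unfold Rmin, Rmax in Hc. destruct (Rle_dec a b); lra.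
Qed.

Lemma time_lt_end e : 0 <= e < es -> Rbar_lt (Finite (time_of_eta lam u0 e)) T.
Proof.
  intros He. set (e' := (e + es) / 2).
  assert (Hlow := eta_low_neg lam M0 m0 lam_ne M0_pos m0_neg).
  assert (H1 : time_of_eta lam u0 e < time_of_eta lam u0 e').
  { apply (time_increasing lam (Derive u0) M0 m0); auto; unfold e'; lra. }
  apply Rbar_lt_le_trans with (Finite (time_of_eta lam u0 e')); [exact H1|].
  apply (filterlim_le (F := at_left es) (fun _ => time_of_eta lam u0 e') (time_of_eta lam u0)).
  - apply (at_left_intro _ es (es - e')); [unfold e'; lra|]. intros x Hx. left.
    apply (time_increasing lam (Derive u0) M0 m0); auto; unfold e' in *; lra.
  - apply filterlim_const.
  - exact HT.
Qed.

(** The time change of [flow_formula] inverts [time_of_eta], hence reaches [eta_star] exactly at the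
    end of the life span. *)
Theorem solution_as_profile : exists dl : R -> R,
  filterlim dl (at_end T) (at_right 0) /\
  forall t, 0 < t -> Rbar_lt (Finite t) T -> 0 < dl t /\
    (forall a, 0 <= a <= 1 -> ux_along u gam a t = sgn lam * profile h lam (dl t) a) /\
    (forall phi, (forall x, continuous phi x) ->
       RInt (fun x => phi (dx u x t)) 0 1 =
       RInt (fun a => phi (sgn lam * profile h lam (dl t) a) * density h lam (dl t) a) 0 1).
Proof.
  destruct (flow_formula lam u0 T u gam T_pos Hsol Hchar m0 M0 lam_ne f_cont f_bounds
              M0_att m0_att mean_value_attained) as [tau [Htau0 Htau]].
  assert (Hlow := eta_low_neg lam M0 m0 lam_ne M0_pos m0_neg).
  assert (Hes := eta_star_pos lam M0 m0 lam_ne M0_pos m0_neg).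
  assert (Hnn : forall t, 0 <= t -> Rbar_lt (Finite t) T -> 0 <= tau t).
  { intros t H0 Ht. destruct (Rle_lt_or_eq_dec _ _ H0) as [Hlt|<-]; [|lra].
    left. apply (proj1 (Htau t H0 Ht)), Hlt. }
  assert (Hdom : forall t, 0 <= t -> Rbar_lt (Finite t) T -> 0 <= tau t < es).
  { intros t H0 Ht. split; [auto|]. destruct (Htau t H0 Ht) as [_ [HJ _]].
    assert (HA : 0 < 1 - Rabs lam * peak lam M0 m0 * tau t).
    { destruct (sgn_cases lam M0 m0 lam_ne) as [[Hl [_ ->]]|[Hl [_ ->]]].
      - rewrite Rabs_pos_eq by lra. destruct M0_att as [a [_ Ha]]. specialize (HJ a). rewrite Ha in HJ. lra.
      - rewrite Rabs_left by lra. destruct m0_att as [a [_ Ha]]. specialize (HJ a). rewrite Ha in HJ. lra. }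
    rewrite <- (eta_star_mult lam M0 m0) in HA by auto.
    assert (HlA : 0 < Rabs lam * peak lam M0 m0).
    { apply Rmult_lt_0_compat; [apply Rabs_pos_lt, lam_ne|apply peak_pos; auto]. }
    nra. }
  assert (Htime : forall t, 0 <= t -> Rbar_lt (Finite t) T -> time_of_eta lam u0 (tau t) = t).
  { intros t H0 Ht.
    assert (E : time_of_eta lam u0 (tau 0) - 0 = time_of_eta lam u0 (tau t) - t).
    { assert (Hd : forall s, 0 <= s <= t -> is_derive (fun s => time_of_eta lam u0 (tau s) - s) s 0).
      { intros s Hs. assert (HsT : Rbar_lt (Finite s) T) by (apply (Rbar_lt_of_le s t); [lra|auto]).
        destruct (Htau s ltac:(lra) HsT) as [_ [_ [Hd _]]].
        assert (Hds := Hdom s ltac:(lra) HsT).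
        assert (HK : 0 < kernel_int lam (Derive u0) (tau s)) by (apply (kernel_pos lam (Derive u0) M0 m0); auto; lra).
        apply is_derive_eq with (Rpower (kernel_int lam (Derive u0) (tau s)) (- 2 * lam) *
                                 Rpower (kernel_int lam (Derive u0) (tau s)) (2 * lam) - 1).
        - apply (is_derive_minus (fun s => time_of_eta lam u0 (tau s)) (fun s => s)).
          + apply (is_derive_comp (time_of_eta lam u0) tau); [|exact Hd].
            apply (time_derive lam (Derive u0) M0 m0); auto; lra.
          + apply (is_derive_id (K := R_AbsRing)).
        - rewrite <- Rpower_plus. replace (-2 * lam + 2 * lam) with 0 by ring.
          rewrite Rpower_O by exact HK. ring. }
      apply (derive_zero_const (fun s => time_of_eta lam u0 (tau s) - s)); auto.
      - intros s Hs. apply Hd; lra.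
      - intros s Hs. apply (is_derive_continuous _ _ _ (Hd s Hs)). }
    rewrite Htau0 in E. assert (E0 : time_of_eta lam u0 0 = 0) by apply time_0.
    lra. }
  exists (fun t => remaining lam M0 m0 (tau t)). split.
  - apply (filterlim_comp _ _ _ tau (remaining lam M0 m0) (at_end T) (at_left es)).
    + intros P HP. destruct (at_left_elim _ _ HP) as [r [Hr HrP]].
      set (e := Rmax 0 (es - r)). assert (He0 : 0 <= e) by apply Rmax_l.
      assert (He1 : es - r <= e) by apply Rmax_r. assert (He2 : e < es) by (apply Rmax_lub_lt; lra).
      apply (at_end_intro T _ (time_of_eta lam u0 e)); [apply time_lt_end; lra|].
      intros t Ht HtT.
      assert (Ht0 : 0 <= t).
      { apply Rle_trans with (time_of_eta lam u0 e); [|lra].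
        destruct (Rle_lt_or_eq_dec _ _ He0) as [Hlt|<-].
        - left. apply Rle_lt_trans with (time_of_eta lam u0 0); [right; symmetry; apply time_0|].
          apply (time_increasing lam (Derive u0) M0 m0); auto; lra.
        - right. symmetry. apply time_0. }
      assert (Hd := Hdom t Ht0 HtT). apply HrP. split; [|lra].
      apply Rle_lt_trans with (1 := He1). apply Rnot_le_lt. intros Hle.
      assert (time_of_eta lam u0 (tau t) <= time_of_eta lam u0 e).
      { destruct (Rle_lt_or_eq_dec _ _ Hle) as [Hlt|Heq].
        - left. apply (time_increasing lam (Derive u0) M0 m0); auto; lra.
        - right. f_equal. exact Heq. }
      rewrite Htime in H by assumption. lra.
    + apply remaining_limit; auto.
  - intros t H0 Ht. destruct (Htau t (Rlt_le _ _ H0) Ht) as [Hp [_ [_ [Hux Hint]]]].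
    assert (Hd : 0 < tau t < es) by (split; [auto|apply Hdom; auto; lra]).
    split; [|split].
    + apply remaining_pos; auto.
    + intros a Ha. rewrite Hux by exact Ha. apply slope_is_profile; auto.
    + intros phi Hphi. rewrite Hint by exact Hphi. apply RInt_ext. intros a _.
      rewrite <- (slope_is_profile lam (Derive u0) M0 m0), <- (jacobian_is_density lam (Derive u0) M0 m0);
        auto.
Qed.

Lemma lub_attained (E : R -> Prop) y : E y -> (forall z, E z -> z <= y) -> real (Lub_Rbar E) = y.
Proof.
  intros Hy Hub. rewrite (is_lub_Rbar_unique E (Finite y)); [reflexivity|]. split.
  - intros z Hz. apply Hub, Hz.
  - intros b Hb. apply Hb, Hy.
Qed.

Lemma glb_attained (E : R -> Prop) y : E y -> (forall z, E z -> y <= z) -> real (Glb_Rbar E) = y.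
Proof.
  intros Hy Hub. rewrite (is_glb_Rbar_unique E (Finite y)); [reflexivity|]. split.
  - intros z Hz. apply Hub, Hz.
  - intros b Hb. apply Hb, Hy.
Qed.

Lemma profile_antitone d a b : 0 < d -> h a <= h b -> profile h lam d b <= profile h lam d a.
Proof.
  intros Hd Hab. assert (Ha := gap_nonneg lam (Derive u0) M0 m0 lam_ne f_bounds a).
  apply Rmult_le_compat_l; [left; apply Rpower_gt0|].
  assert (/ (d + h b) <= / (d + h a)) by (apply Rinv_le_contravar; lra). lra.
Qed.

Lemma profile_monotone d a b : 0 < d -> Derive u0 a <= Derive u0 b ->
  sgn lam * profile h lam d a <= sgn lam * profile h lam d b.
Proof.
  intros Hd Hab.
  destruct (sgn_cases lam M0 m0 lam_ne) as [[_ [Es _]]|[_ [Es _]]].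
  - assert (profile h lam d a <= profile h lam d b); [|rewrite Es; lra].
    apply profile_antitone; auto. unfold gap. rewrite Es. lra.
  - assert (profile h lam d b <= profile h lam d a); [|rewrite Es; lra].
    apply profile_antitone; auto. unfold gap. rewrite Es. lra.
Qed.

Lemma profile_sup t dl b : 0 < dl -> 0 <= b <= 1 -> Derive u0 b = M0 ->
  (forall a, 0 <= a <= 1 -> ux_along u gam a t = sgn lam * profile h lam dl a) ->
  Msup u gam t = sgn lam * profile h lam dl b.
Proof.
  intros Hd Hb HM Hux. apply lub_attained.
  - exists b. rewrite Hux by exact Hb. auto.
  - intros z [a [Ha ->]]. rewrite Hux by exact Ha. apply profile_monotone; auto.
    rewrite HM. apply f_bounds.
Qed.

Lemma profile_inf t dl b : 0 < dl -> 0 <= b <= 1 -> Derive u0 b = m0 ->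
  (forall a, 0 <= a <= 1 -> ux_along u gam a t = sgn lam * profile h lam dl a) ->
  minf u gam t = sgn lam * profile h lam dl b.
Proof.
  intros Hd Hb Hm Hux. apply glb_attained.
  - exists b. rewrite Hux by exact Hb. auto.
  - intros z [a [Ha ->]]. rewrite Hux by exact Ha. apply profile_monotone; auto.
    rewrite Hm. apply f_bounds.
Qed.

Lemma Lp_norm_profile p t dl : 0 < p -> 0 < dl ->
  (forall phi, (forall x, continuous phi x) ->
       RInt (fun x => phi (dx u x t)) 0 1 =
       RInt (fun a => phi (sgn lam * profile h lam dl a) * density h lam dl a) 0 1) ->
  Lp_ux p u t = pow0 (profile_mass h lam p dl) (/ p).
Proof.
  intros Hp Hd Hint. unfold Lp_ux, Lp_norm. f_equal.
  rewrite (Hint (fun x => pow0 (Rabs x) p)).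
  - apply RInt_ext. intros a _. rewrite Rabs_mult.
    replace (Rabs (sgn lam)) with 1; [rewrite Rmult_1_l; reflexivity|].
    unfold sgn. destruct (Rlt_dec 0 lam); [rewrite Rabs_pos_eq|rewrite Rabs_left]; lra.
  - intros x. apply (continuous_comp Rabs (fun y => pow0 y p)); [apply continuous_Rabs|].
    apply pow0_continuous, Hp.
Qed.

(** [u_x] is bounded on a period, and every value along a characteristic is one of its values. *)
Lemma Linf_ge_along a t : 0 <= a <= 1 -> 0 <= t -> Rbar_lt (Finite t) T ->
  Rabs (ux_along u gam a t) <= Linf_ux u t.
Proof.
  intros Ha H0 Ht.
  destruct (ux_bounded lam u0 T u T_pos Hsol t H0 Ht) as [L [HL HLb]].
  set (E := fun y => exists x, 0 <= x <= 1 /\ y = Rabs (dx u x t)).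
  unfold Linf_ux, Linf_norm. fold E.
  destruct (Lub_Rbar_correct E) as [Hub Hlub].
  assert (Hfin : Rbar_le (Lub_Rbar E) L).
  { apply Hlub. intros y [x [_ ->]]. apply HLb. lra. }
  assert (HE : E (Rabs (ux_along u gam a t))).
  { unfold ux_along. destruct (period_representative (gam a t)) as [y [n [Hy ->]]].
    exists y. split; [lra|]. f_equal. apply (periodic_IZR (fun y => dx u y t)).
    intros x. apply (ux_periodic lam u0 T u Hsol); assumption. }
  specialize (Hub _ HE). destruct (Lub_Rbar E); simpl in *; [exact Hub|contradiction|contradiction].
Qed.

End EndOfLife.

(** * Construction of solutions *)

(** ** Inverting an increasing family of maps *)

(** This serves twice: for the labels as functions of position and time, and, with a family
    that is constant in the second variable, for [eta] as a function of time. *)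
Section Inverse.
Context (Phi Phi1 : R -> R -> R) (lo hi : Rbar) (L : R -> Prop).
Let D a := Rbar_lt lo (Finite a) /\ Rbar_lt (Finite a) hi.
Context (L_open : forall t, L t -> locally t L).
Context (Phi_d1 : forall a t, D a -> L t -> is_derive (fun z => Phi z t) a (Phi1 a t)).
Context (Phi1_pos : forall a t, D a -> L t -> 0 < Phi1 a t).
Context (Phi1_cont : forall a t, D a -> L t ->
  continuous (fun p : R * R => Phi1 (fst p) (snd p)) (a, t)).
Context (Phi_cont2 : forall a t, D a -> L t -> continuous (Phi a) t).

Lemma dom_between a b c : D a -> D b -> a <= c <= b -> D c.
Proof. unfold D. destruct lo, hi; simpl; intuition lra. Qed.

Lemma dom_open a : D a -> exists r, 0 < r /\ forall c, Rabs (c - a) <= r -> D c.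
Proof.
  intros [H1 H2]. unfold D.
  assert (E1 : exists r, 0 < r /\ forall c, a - r <= c -> Rbar_lt lo (Finite c)).
  { destruct lo as [l| |]; simpl in *; [|contradiction|].
    - exists ((a - l) / 2). split; [lra|]. intros; lra.
    - exists 1. split; [lra|auto]. }
  assert (E2 : exists r, 0 < r /\ forall c, c <= a + r -> Rbar_lt (Finite c) hi).
  { destruct hi as [l| |]; simpl in *; [| |contradiction].
    - exists ((l - a) / 2). split; [lra|]. intros; lra.
    - exists 1. split; [lra|auto]. }
  destruct E1 as [r1 [Hr1 H1']]. destruct E2 as [r2 [Hr2 H2']].
  exists (Rmin r1 r2). assert (G1 := Rmin_l r1 r2). assert (G2 := Rmin_r r1 r2).
  split; [apply Rmin_glb_lt; auto|]. intros c Hc. apply Rabs_le_between in Hc.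
  split; [apply H1'; lra|apply H2'; lra].
Qed.

Lemma family_increasing t a b : L t -> D a -> D b -> a < b -> Phi a t < Phi b t.
Proof.
  intros Ht Ha Hb Hab. apply (derive_pos_lt (fun z => Phi z t) (fun z => Phi1 z t)); auto;
    intros x Hx; [apply Phi_d1|apply Phi1_pos]; auto; apply (dom_between a b); auto.
Qed.

Context (A : R -> R -> R) (x0 t0 : R) (Lt0 : L t0).
Context (A_inv : locally (x0, t0) (fun p : R * R =>
  D (A (fst p) (snd p)) /\ Phi (A (fst p) (snd p)) (snd p) = fst p)).

Lemma inverse_at : D (A x0 t0) /\ Phi (A x0 t0) t0 = x0.
Proof. exact (locally_singleton _ _ A_inv). Qed.

Lemma inverse_continuous : continuous (fun p : R * R => A (fst p) (snd p)) (x0, t0).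
Proof.
  destruct inverse_at as [Da Ea]. set (a := A x0 t0) in *.
  destruct (dom_open a Da) as [r [Hr HrD]].
  apply lim_eps. intros eps Heps. simpl. fold a.
  set (e := Rmin eps r / 2).
  assert (He1 := Rmin_l eps r). assert (He2 := Rmin_r eps r).
  assert (He3 : 0 < Rmin eps r) by (apply Rmin_glb_lt; auto).
  assert (He : 0 < e) by (unfold e; lra).
  assert (Dm : D (a - e)).
  { apply HrD. replace (a - e - a) with (- e) by ring. rewrite Rabs_Ropp, Rabs_pos_eq; unfold e; lra. }
  assert (Dp : D (a + e)).
  { apply HrD. replace (a + e - a) with e by ring. rewrite Rabs_pos_eq; unfold e; lra. }
  assert (Hm : Phi (a - e) t0 < x0).
  { rewrite <- Ea. apply family_increasing; auto; lra. }
  assert (Hp : x0 < Phi (a + e) t0).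
  { rewrite <- Ea at 1. apply family_increasing; auto; lra. }
  set (xm := (Phi (a - e) t0 + x0) / 2). set (xp := (Phi (a + e) t0 + x0) / 2).
  assert (Gm : Phi (a - e) t0 < xm) by (unfold xm; lra).
  assert (Gp : xp < Phi (a + e) t0) by (unfold xp; lra).
  assert (Em : locally t0 (fun t => Phi (a - e) t < xm))
    by (apply (lim_eventually_lt (Phi (a - e)) (Phi (a - e) t0)); [apply Phi_cont2; auto|exact Gm]).
  assert (Ep : locally t0 (fun t => xp < Phi (a + e) t))
    by (apply (lim_eventually_gt (Phi (a + e)) (Phi (a + e) t0)); [apply Phi_cont2; auto|exact Gp]).
  assert (Ex : locally x0 (fun x => xm < x < xp)).
  { apply (locally_ball_intro _ x0 (Rmin (x0 - xm) (xp - x0))).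
    - apply Rmin_glb_lt; unfold xm, xp; lra.
    - intros x Hx. assert (G1 := Rmin_l (x0 - xm) (xp - x0)). assert (G2 := Rmin_r (x0 - xm) (xp - x0)).
      apply Rabs_def2 in Hx. lra. }
  assert (H1 := continuous_snd x0 t0 _ (filter_and _ _ (L_open t0 Lt0) (filter_and _ _ Em Ep))).
  assert (H2 := continuous_fst x0 t0 _ Ex). unfold filtermap in H1, H2.
  generalize (filter_and _ _ A_inv (filter_and _ _ H1 H2)). apply filter_imp.
  intros [x t] [[DA EA] [[Lt [Hmt Hpt]] Hx]]. simpl in *.
  assert (Hlo : a - e < A x t).
  { apply Rnot_le_lt. intros Hle. destruct (Rle_lt_or_eq_dec _ _ Hle) as [Hlt|Heq].
    - generalize (family_increasing t _ _ Lt DA Dm Hlt). lra.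
    - rewrite <- Heq in Hmt. lra. }
  assert (Hhi : A x t < a + e).
  { apply Rnot_le_lt. intros Hle. destruct (Rle_lt_or_eq_dec _ _ Hle) as [Hlt|Heq].
    - generalize (family_increasing t _ _ Lt Dp DA Hlt). lra.
    - rewrite Heq in Hpt. lra. }
  apply Rabs_def1; unfold e in *; lra.
Qed.

(** The mean value theorem between two points of the domain: [m] is a value of [Phi1] near the base
    point. *)
Lemma inverse_slope eps : 0 < eps -> locally (x0, t0) (fun p : R * R => exists m,
  Rabs (m - Phi1 (A x0 t0) t0) < eps /\
  Phi (A (fst p) (snd p)) (snd p) - Phi (A x0 t0) (snd p) = m * (A (fst p) (snd p) - A x0 t0)).
Proof.
  intros Heps. destruct inverse_at as [Da Ea]. set (a := A x0 t0) in *.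
  destruct (dom_open a Da) as [r [Hr HrD]].
  destruct (locally_2d_elim _ _ _ (proj1 (lim_eps _ _) (Phi1_cont a t0 Da Lt0) eps Heps))
    as [r1 [Hr1 H1]]. simpl in H1.
  assert (Hr2 : 0 < Rmin r r1) by (apply Rmin_glb_lt; auto).
  assert (HA := proj1 (lim_eps _ _) inverse_continuous (Rmin r r1) Hr2). simpl in HA. fold a in HA.
  assert (HL := continuous_snd x0 t0 _ (filter_and _ _ (L_open t0 Lt0)
    (locally_ball_intro (fun t => Rabs (t - t0) < r1) t0 r1 Hr1 (fun x H => H)))).
  unfold filtermap in HL.
  generalize (filter_and _ _ A_inv (filter_and _ _ HA HL)). apply filter_imp.
  intros [x t] [[DA EA] [Hd [Lt Htr]]]. simpl in *.
  assert (G1 := Rmin_l r r1). assert (G2 := Rmin_r r r1).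
  destruct (MVT_gen (fun z => Phi z t) a (A x t) (fun z => Phi1 z t)) as [c [Hc1 Hc2]].
  - intros z Hz. apply Phi_d1; auto. apply HrD.
    apply Rabs_def2 in Hd. apply Rabs_le. unfold Rmin, Rmax in Hz. destruct (Rle_dec a (A x t)); lra.
  - intros z Hz. apply continuity_pt_filterlim.
    apply (is_derive_continuous (fun z => Phi z t) z (Phi1 z t)), Phi_d1; auto. apply HrD.
    apply Rabs_def2 in Hd. apply Rabs_le. unfold Rmin, Rmax in Hz. destruct (Rle_dec a (A x t)); lra.
  - exists (Phi1 c t). split; [|exact Hc2]. apply H1; auto.
    apply Rabs_def2 in Hd. apply Rabs_def1; unfold Rmin, Rmax in Hc1; destruct (Rle_dec a (A x t)); lra.
Qed.

Lemma is_derive_of_quotient (F : R -> R) y l :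
  filterlim (fun z => (F z - F y) / (z - y)) (locally' y) (locally l) -> is_derive F y l.
Proof.
  intros H. apply is_derive_of_increment. intros eps Heps.
  destruct (proj1 (lim_eps _ _) H eps Heps) as [r Hr]. exists r. split; [apply cond_pos|].
  intros c Hc. destruct (Req_dec c y) as [->|Hne].
  - replace (F y - F y - l * (y - y)) with 0 by ring. rewrite Rabs_R0.
    apply Rmult_le_pos; [lra|apply Rabs_pos].
  - assert (Hcy : c - y <> 0) by lra. specialize (Hr c Hc Hne).
    replace (F c - F y - l * (c - y)) with (((F c - F y) / (c - y) - l) * (c - y)) by (field; exact Hcy).
    rewrite Rabs_mult. apply Rmult_le_compat_r; [apply Rabs_pos|lra].
Qed.

Lemma inverse_derive_space : is_derive (fun x => A x t0) x0 (/ Phi1 (A x0 t0) t0).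
Proof.
  destruct inverse_at as [Da Ea]. set (a := A x0 t0) in *. set (k := Phi1 a t0).
  assert (Hk : 0 < k) by (apply Phi1_pos; auto).
  apply is_derive_of_quotient. fold a.
  (* the inverse of the difference quotient is a mean slope of [Phi] *)
  set (m := fun x => (x - x0) / (A x t0 - a)).
  assert (Hcur : forall P : R * R -> Prop, locally (x0, t0) P -> locally x0 (fun x => P (x, t0))).
  { intros P HP. destruct (locally_2d_elim _ _ _ HP) as [r [Hr H]].
    apply (locally_ball_intro _ x0 r Hr). intros x Hx. apply H; auto.
    rewrite Rminus_diag, Rabs_R0. exact Hr. }
  assert (Hm : filterlim m (locally' x0) (locally k)).
  { apply lim_eps. intros eps Heps.
    assert (E := filter_and _ _ (Hcur _ (inverse_slope eps Heps)) (Hcur _ A_inv)).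
    destruct E as [r Hr']. exists r. intros x Hx Hne. destruct (Hr' x Hx) as [[s [Hs1 Hs2]] [DA EA]].
    simpl in *. fold a in Hs1, Hs2. fold k in Hs1. rewrite EA, Ea in Hs2.
    assert (Hda : A x t0 - a <> 0).
    { intros E0. rewrite E0, Rmult_0_r in Hs2. apply Hne. lra. }
    unfold m. replace ((x - x0) / (A x t0 - a)) with s; [exact Hs1|].
    rewrite Hs2. field. exact Hda. }
  apply filterlim_ext_loc with (fun x => / m x).
  - assert (E := Hcur _ A_inv). destruct E as [r Hr']. exists r. intros x Hx Hne.
    destruct (Hr' x Hx) as [DA EA]. simpl in *.
    assert (Hda : A x t0 - a <> 0).
    { intros E0. apply Hne. rewrite <- EA, <- Ea. f_equal. lra. }
    unfold m. field. split; lra.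
  - apply lim_inv; [lra|exact Hm].
Qed.

Lemma inverse_derive_time v : is_derive (Phi (A x0 t0)) t0 v ->
  is_derive (A x0) t0 (- v / Phi1 (A x0 t0) t0).
Proof.
  intros Hv. destruct inverse_at as [Da Ea]. set (a := A x0 t0) in *. set (k := Phi1 a t0).
  assert (Hk : 0 < k) by (apply Phi1_pos; auto).
  assert (Hcur : forall P : R * R -> Prop, locally (x0, t0) P -> locally t0 (fun t => P (x0, t))).
  { intros P HP. destruct (locally_2d_elim _ _ _ HP) as [r [Hr H]].
    apply (locally_ball_intro _ t0 r Hr). intros x Hx. apply H; auto.
    rewrite Rminus_diag, Rabs_R0. exact Hr. }
  (* mean slope in the label, defined to be [k] where the label does not move *)
  set (m := fun t => if Req_EM_T (A x0 t) a then k else (Phi (A x0 t) t - Phi a t) / (A x0 t - a)).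
  assert (Hm : filterlim m (locally' t0) (locally k)).
  { apply lim_eps. intros eps Heps.
    assert (E := Hcur _ (inverse_slope eps Heps)).
    destruct E as [r Hr']. exists r. intros t Ht _. destruct (Hr' t Ht) as [s [Hs1 Hs2]].
    simpl in *. fold a in Hs1, Hs2. fold k in Hs1. unfold m.
    destruct (Req_EM_T (A x0 t) a) as [E0|E0].
    - rewrite Rminus_diag, Rabs_R0. exact Heps.
    - rewrite Hs2. replace (s * (A x0 t - a) / (A x0 t - a)) with s; [exact Hs1|field; lra]. }
  assert (Hq : filterlim (fun t => (Phi a t - Phi a t0) / (t - t0)) (locally' t0) (locally v)).
  { apply is_derive_Reals in Hv. apply lim_eps. intros eps Heps.
    destruct (Hv eps Heps) as [r Hr']. exists r. intros t Ht Hne.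
    assert (Ht' : t - t0 <> 0) by lra. specialize (Hr' (t - t0) Ht' Ht).
    rewrite Rplus_minus in Hr'. exact Hr'. }
  assert (Hk0 : 0 < k / 2 < k) by lra.
  apply is_derive_of_quotient. fold a.
  apply filterlim_ext_loc with (fun t => - ((Phi a t - Phi a t0) / (t - t0)) / m t).
  - assert (E := Hcur _ A_inv). destruct E as [r1 Hr1].
    destruct (lim_eventually_gt _ _ _ Hm (proj2 Hk0)) as [r2 Hr2].
    exists (mkposreal _ (Rmin_stable_in_posreal r1 r2)). intros t Ht Hne. simpl in Ht.
    destruct (Hr1 t) as [DA EA].
    { apply Rlt_le_trans with (1 := Ht). apply Rmin_l. }
    assert (Hmt : k / 2 < m t).
    { apply Hr2; auto. apply Rlt_le_trans with (1 := Ht). apply Rmin_r. }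
    simpl in *. unfold m in *. destruct (Req_EM_T (A x0 t) a) as [E0|E0].
    + rewrite E0 in *. rewrite EA, Ea, !Rminus_diag. unfold Rdiv. ring.
    + rewrite EA in *. rewrite Ea in *.
      assert (Hx : x0 - Phi a t <> 0).
      { intros Hx. rewrite Hx in Hmt. unfold Rdiv in Hmt. rewrite Rmult_0_l in Hmt. lra. }
      field. repeat split; lra.
  - apply lim_div; [lra|apply lim_opp, Hq|exact Hm].
Qed.

End Inverse.

(** ** From Lagrangian data to a solution *)

Lemma continuous_of_partials (F F1 F2 : R -> R -> R) a t :
  locally (a, t) (fun p : R * R => is_derive (fun z => F z (snd p)) (fst p) (F1 (fst p) (snd p))) ->
  continuous (fun p : R * R => F1 (fst p) (snd p)) (a, t) ->
  is_derive (F a) t (F2 a t) -> continuous (fun p : R * R => F (fst p) (snd p)) (a, t).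
Proof.
  intros H1 Hc H2. assert (HF := is_derive_filterdiff F a t F1 (F2 a t) H1 H2 Hc).
  apply (filterdiff_continuous (K := R_AbsRing) (U := prod_NormedModule R_AbsRing R_NormedModule R_NormedModule)
    (V := R_NormedModule)).
  eexists. exact HF.
Qed.

(** Here [g] is the Jacobian of the flow and [w] is [u_x] along characteristics.  Integrating [g] gives
    the characteristics [Gam], and [u] is their velocity [V] at the label [A x t].  The freedom of
    translation is removed by letting the label 0 move at the constant velocity [u0 0]. *)
Section Lagrangian.
Context (lam : R) (u0 : R -> R) (T : Rbar) (tlow : R).
Context (g w w1 : R -> R -> R) (I : R -> R).
Let life t := tlow < t /\ Rbar_lt (Finite t) T.
Context (tlow_neg : tlow < 0) (T_pos : Rbar_lt 0 T).
Context (u0_diff : forall x, ex_derive u0 x) (u0_cont : forall x, continuous (Derive u0) x).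
Context (g_pos : forall a t, life t -> 0 < g a t).
Context (g_cont : forall a t, life t -> continuous (fun p : R * R => g (fst p) (snd p)) (a, t)).
Context (g_t : forall a t, life t -> is_derive (g a) t (w a t * g a t)).
Context (g_per : forall a t, life t -> g (a + 1) t = g a t).
Context (g_mean : forall t, life t -> RInt (fun a => g a t) 0 1 = 1).
Context (g_init : forall a, g a 0 = 1).
Context (w_cont : forall a t, life t -> continuous (fun p : R * R => w (fst p) (snd p)) (a, t)).
Context (w_a : forall a t, life t -> is_derive (fun z => w z t) a (w1 a t)).
Context (w1_cont : forall a t, life t -> continuous (fun p : R * R => w1 (fst p) (snd p)) (a, t)).
Context (w_t : forall a t, life t -> is_derive (w a) t (lam * w a t ^ 2 + I t)).
Context (I_cont : forall t, life t -> continuous I t).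
Context (w_per : forall a t, life t -> w (a + 1) t = w a t).
Context (w_init : forall a, w a 0 = Derive u0 a).

Let V a t := u0 0 + RInt (fun s => w s t * g s t) 0 a.
Let Gam a t := u0 0 * t + RInt (fun s => g s t) 0 a.
Let A x t := epsilon (inhabits 0) (fun a => Gam a t = x).

Lemma life_open t : life t -> locally t life.
Proof.
  intros [H1 H2]. apply filter_and; [|apply before_locally, H2].
  apply (locally_ball_intro _ t (t - tlow)); [lra|]. intros s Hs. apply Rabs_def2 in Hs. lra.
Qed.

Lemma life_nonneg t : 0 <= t -> Rbar_lt (Finite t) T -> life t.
Proof. intros H0 Ht. split; [lra|exact Ht]. Qed.

Lemma section_cont (F : R -> R -> R) a t :
  continuous (fun p : R * R => F (fst p) (snd p)) (a, t) -> continuous (fun z => F z t) a.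
Proof.
  intros H. apply (continuous_comp_2 (fun z : R => z) (fun _ : R => t) F); [apply continuous_id|apply continuous_const|exact H].
Qed.

Lemma swap_cont (F : R -> R -> R) a t :
  continuous (fun p : R * R => F (fst p) (snd p)) (a, t) ->
  continuous (fun p : R * R => F (snd p) (fst p)) (t, a).
Proof.
  intros H. apply (continuous_comp_2 (fun p : R * R => snd p) (fun p : R * R => fst p) F).
  apply continuous_snd. apply continuous_fst. exact H.
Qed.

Lemma g_section a t : life t -> continuous (fun z => g z t) a.
Proof. intros Ht. apply section_cont, g_cont, Ht. Qed.

Lemma w_section a t : life t -> continuous (fun z => w z t) a.
Proof. intros Ht. apply section_cont, w_cont, Ht. Qed.

Lemma wg_section a t : life t -> continuous (fun z => w z t * g z t) a.
Proof. intros Ht. apply cont_mult; [apply w_section|apply g_section]; exact Ht. Qed.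

Lemma Gam_label a t : life t -> is_derive (fun z => Gam z t) a (g a t).
Proof.
  intros Ht. apply is_derive_eq with (0 + g a t); [|ring].
  apply (is_derive_plus (fun _ => u0 0 * t) (fun z => RInt (fun s => g s t) 0 z)).
  - apply (is_derive_const (V := R_NormedModule)).
  - apply (is_derive_primitive (fun s => g s t)). intros; apply g_section, Ht.
Qed.

Lemma V_label a t : life t -> is_derive (fun z => V z t) a (w a t * g a t).
Proof.
  intros Ht. apply is_derive_eq with (0 + w a t * g a t); [|ring].
  apply (is_derive_plus (fun _ => u0 0) (fun z => RInt (fun s => w s t * g s t) 0 z)).
  - apply (is_derive_const (V := R_NormedModule)).
  - apply (is_derive_primitive (fun s => w s t * g s t)). intros; apply wg_section, Ht.
Qed.

Lemma integral_g_time a b t : life t ->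
  is_derive (fun t => RInt (fun s => g s t) a b) t (RInt (fun s => w s t * g s t) a b).
Proof.
  intros Ht. apply (is_derive_RInt_under (fun t s => g s t) (fun t s => w s t * g s t) life).
  - apply life_open, Ht.
  - intros z s Hz. apply g_t, Hz.
  - intros s. apply (swap_cont (fun s t => w s t * g s t)). apply cont_mult; [apply w_cont|apply g_cont]; exact Ht.
  - intros z s Hz. apply g_section, Hz.
Qed.

Lemma integral_wg_time a b t : life t ->
  is_derive (fun t => RInt (fun s => w s t * g s t) a b) t
    (RInt (fun s => (lam * w s t ^ 2 + I t) * g s t + w s t * (w s t * g s t)) a b).
Proof.
  intros Ht. apply (is_derive_RInt_under (fun t s => w s t * g s t)
    (fun t s => (lam * w s t ^ 2 + I t) * g s t + w s t * (w s t * g s t)) life).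
  - apply life_open, Ht.
  - intros z s Hz. apply (is_derive_mult (w s) (g s)); [apply w_t, Hz|apply g_t, Hz|].
    intros; apply Rmult_comm.
  - intros s. apply (swap_cont (fun s t => (lam * w s t ^ 2 + I t) * g s t + w s t * (w s t * g s t))).
    assert (Hw := w_cont s t Ht). assert (Hg := g_cont s t Ht).
    assert (HI : continuous (fun p : R * R => I (snd p)) (s, t)).
    { apply (continuous_comp snd I); [apply continuous_snd|apply I_cont, Ht]. }
    apply cont_plus.
    + apply cont_mult; [|exact Hg]. apply cont_plus; [|exact HI].
      apply cont_mult; [apply continuous_const|]. apply cont_pow, Hw.
    + apply cont_mult; [exact Hw|]. apply cont_mult; assumption.
  - intros z s Hz. apply wg_section, Hz.
Qed.

Lemma Gam_time a t : life t -> is_derive (Gam a) t (V a t).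
Proof.
  intros Ht. apply (is_derive_plus (fun t => u0 0 * t) (fun t => RInt (fun s => g s t) 0 a)).
  - auto_derive; auto; ring.
  - apply integral_g_time, Ht.
Qed.

Lemma mean_wg_zero t : life t -> RInt (fun s => w s t * g s t) 0 1 = 0.
Proof.
  intros Ht. transitivity (Derive (fun t => RInt (fun s => g s t) 0 1) t).
  - symmetry. apply is_derive_unique, integral_g_time, Ht.
  - transitivity (Derive (fun _ : R => 1) t); [|apply Derive_const].
    apply Derive_ext_loc. generalize (life_open t Ht). apply filter_imp. exact g_mean.
Qed.

(** Differentiating [int g = 1] twice in time yields the nonlocal term. *)
Lemma nonlocal_term t : life t -> I t = - (lam + 1) * RInt (fun s => w s t ^ 2 * g s t) 0 1.
Proof.
  intros Ht.
  assert (E : RInt (fun s => (lam * w s t ^ 2 + I t) * g s t + w s t * (w s t * g s t)) 0 1 = 0).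
  { transitivity (Derive (fun t => RInt (fun s => w s t * g s t) 0 1) t).
    - symmetry. apply is_derive_unique, integral_wg_time, Ht.
    - transitivity (Derive (fun _ : R => 0) t); [|apply Derive_const].
      apply Derive_ext_loc. generalize (life_open t Ht). apply filter_imp. exact mean_wg_zero. }
  assert (E2 : RInt (fun s => (lam * w s t ^ 2 + I t) * g s t + w s t * (w s t * g s t)) 0 1 =
     (lam + 1) * RInt (fun s => w s t ^ 2 * g s t) 0 1 + I t * RInt (fun s => g s t) 0 1).
  { assert (C1 : ex_RInt (fun s => w s t ^ 2 * g s t) 0 1).
    { apply continuous_ex_RInt. intros s. apply cont_mult; [apply cont_pow, w_section|apply g_section]; exact Ht. }
    assert (C2 : ex_RInt (fun s => g s t) 0 1) by (apply continuous_ex_RInt; intros; apply g_section, Ht).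
    rewrite <- (RInt_mult_l (fun s => w s t ^ 2 * g s t)) by exact C1.
    rewrite <- (RInt_mult_l (fun s => g s t)) by exact C2.
    rewrite <- (RInt_add (fun s => (lam + 1) * (w s t ^ 2 * g s t)) (fun s => I t * g s t)).
    - apply RInt_ext. intros s _. eqR. ring.
    - apply (ex_RInt_scal (fun s => w s t ^ 2 * g s t)), C1.
    - apply (ex_RInt_scal (fun s => g s t)), C2. }
  rewrite E2, g_mean in E by exact Ht. lra.
Qed.

Lemma wg_step a t : life t -> RInt (fun s => w s t * g s t) 0 (a + 1) = RInt (fun s => w s t * g s t) 0 a.
Proof.
  intros Ht.
  rewrite (RInt_split (fun s => w s t * g s t) 0 a (a + 1)) by (apply continuous_ex_RInt; intros; apply wg_section, Ht).
  rewrite (RInt_period (fun s => w s t * g s t)).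
  - rewrite mean_wg_zero by exact Ht. lra.
  - intros; apply wg_section, Ht.
  - intros x. rewrite w_per, g_per by exact Ht. reflexivity.
Qed.

Lemma V_period a t : life t -> V (a + 1) t = V a t.
Proof. intros Ht. unfold V. rewrite wg_step by exact Ht. reflexivity. Qed.

Lemma Gam_period a t : life t -> Gam (a + 1) t = Gam a t + 1.
Proof.
  intros Ht. unfold Gam.
  rewrite (RInt_split (fun s => g s t) 0 a (a + 1)) by (apply continuous_ex_RInt; intros; apply g_section, Ht).
  rewrite (RInt_period (fun s => g s t)).
  - rewrite g_mean by exact Ht. lra.
  - intros; apply g_section, Ht.
  - intros x. apply g_per, Ht.
Qed.

Lemma Gam_IZR n t : life t -> Gam (IZR n) t = Gam 0 t + IZR n.
Proof.
  intros Ht.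
  assert (H := periodic_IZR (fun a => Gam a t - a) 0 n).
  rewrite Rplus_0_l in H. assert (E : Gam (IZR n) t - IZR n = Gam 0 t - 0); [|lra].
  apply H. intros a. rewrite Gam_period by exact Ht. ring.
Qed.

Lemma Gam_increasing a b t : life t -> a < b -> Gam a t < Gam b t.
Proof.
  intros Ht Hab. apply (derive_pos_lt (fun z => Gam z t) (fun z => g z t)); auto.
  intros; apply Gam_label, Ht.
Qed.

Lemma A_right x t : life t -> Gam (A x t) t = x.
Proof.
  intros Ht. unfold A. apply epsilon_spec.
  destruct (archimed (Rabs (x - Gam 0 t))) as [HN _].
  set (n := up (Rabs (x - Gam 0 t))) in *.
  assert (Hx : - IZR n < x - Gam 0 t < IZR n) by (apply Rabs_def2 in HN; lra).
  assert (Hn : 0 < IZR n) by (generalize (Rabs_pos (x - Gam 0 t)); lra).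
  destruct (IVT_gen (fun a => Gam a t) (IZR (- n)) (IZR n) x) as [a [_ Ha]].
  - intros a. apply continuity_pt_filterlim.
    apply (is_derive_continuous (fun z => Gam z t) a (g a t)), Gam_label, Ht.
  - rewrite (Gam_IZR (- n)), (Gam_IZR n), opp_IZR by exact Ht. unfold Rmin, Rmax.
    destruct (Rle_dec (Gam 0 t + - IZR n) (Gam 0 t + IZR n)); lra.
  - exists a. exact Ha.
Qed.

Lemma Gam_injective a b t : life t -> Gam a t = Gam b t -> a = b.
Proof.
  intros Ht E. destruct (total_order_T a b) as [[H|H]|H]; auto.
  - generalize (Gam_increasing a b t Ht H). lra.
  - generalize (Gam_increasing b a t Ht H). lra.
Qed.

Lemma A_left a t : life t -> A (Gam a t) t = a.
Proof. intros Ht. apply (Gam_injective _ _ t Ht), A_right, Ht. Qed.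

Lemma A_step x t : life t -> A (x + 1) t = A x t + 1.
Proof.
  intros Ht. apply (Gam_injective _ _ t Ht). rewrite A_right, Gam_period, A_right by exact Ht. reflexivity.
Qed.

Lemma life_open_2 x t : life t -> locally (x, t) (fun p : R * R => life (snd p)).
Proof. intros Ht. exact (continuous_snd x t _ (life_open t Ht)). Qed.

Lemma A_inverse_near x t : life t -> locally (x, t) (fun p : R * R =>
  (Rbar_lt m_infty (Finite (A (fst p) (snd p))) /\ Rbar_lt (Finite (A (fst p) (snd p))) p_infty) /\
  Gam (A (fst p) (snd p)) (snd p) = fst p).
Proof.
  intros Ht. generalize (life_open_2 x t Ht). apply filter_imp. intros p Hp.
  split; [split; exact Logic.I|]. apply A_right, Hp.
Qed.

Lemma A_cont x t : life t -> continuous (fun p : R * R => A (fst p) (snd p)) (x, t).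
Proof.
  intros Ht. apply (inverse_continuous Gam g m_infty p_infty life); auto.
  - exact life_open.
  - intros a s _ Hs. apply Gam_label, Hs.
  - intros a s _ Hs. apply (is_derive_continuous _ _ _ (Gam_time a s Hs)).
  - apply A_inverse_near, Ht.
Qed.

Lemma A_space x t : life t -> is_derive (fun y => A y t) x (/ g (A x t) t).
Proof.
  intros Ht. apply (inverse_derive_space Gam g m_infty p_infty life); auto.
  - exact life_open.
  - intros a s _ Hs. apply Gam_label, Hs.
  - intros a s _ Hs. apply (is_derive_continuous _ _ _ (Gam_time a s Hs)).
  - apply A_inverse_near, Ht.
Qed.

Lemma A_time x t : life t -> is_derive (A x) t (- V (A x t) t / g (A x t) t).
Proof.
  intros Ht. apply (inverse_derive_time Gam g m_infty p_infty life); auto.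
  - exact life_open.
  - intros a s _ Hs. apply Gam_label, Hs.
  - intros a s _ Hs. apply (is_derive_continuous _ _ _ (Gam_time a s Hs)).
  - apply A_inverse_near, Ht.
  - apply Gam_time, Ht.
Qed.

Lemma Eulerian_cont (F : R -> R -> R) x t : life t ->
  continuous (fun p : R * R => F (fst p) (snd p)) (A x t, t) ->
  continuous (fun p : R * R => F (A (fst p) (snd p)) (snd p)) (x, t).
Proof.
  intros Ht HF. apply (continuous_comp_2 (fun p : R * R => A (fst p) (snd p)) snd F).
  - apply A_cont, Ht.
  - apply continuous_snd.
  - exact HF.
Qed.

Lemma V_cont a t : life t -> continuous (fun p : R * R => V (fst p) (snd p)) (a, t).
Proof.
  intros Ht. apply (continuous_of_partials V (fun a t => w a t * g a t)
    (fun a t => 0 + RInt (fun s => (lam * w s t ^ 2 + I t) * g s t + w s t * (w s t * g s t)) 0 a)).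
  - generalize (life_open_2 a t Ht). apply filter_imp. intros p Hp. apply V_label, Hp.
  - apply cont_mult; [apply w_cont|apply g_cont]; exact Ht.
  - apply (is_derive_plus (fun _ => u0 0) (fun t => RInt (fun s => w s t * g s t) 0 a)).
    + apply (is_derive_const (V := R_NormedModule)).
    + apply integral_wg_time, Ht.
Qed.

Let u x t := V (A x t) t.

Lemma u_space x t : life t -> is_derive (fun y => u y t) x (w (A x t) t).
Proof.
  intros Ht. assert (Hg := g_pos (A x t) t Ht).
  apply is_derive_eq with (/ g (A x t) t * (w (A x t) t * g (A x t) t)); [|field; lra].
  apply (is_derive_comp (fun z => V z t) (fun y => A y t)); [apply V_label, Ht|apply A_space, Ht].
Qed.

Lemma dx_u x t : life t -> dx u x t = w (A x t) t.
Proof. intros Ht. apply is_derive_unique, u_space, Ht. Qed.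

Lemma dx_u_space x t : life t -> is_derive (fun y => dx u y t) x (w1 (A x t) t / g (A x t) t).
Proof.
  intros Ht. apply is_derive_ext with (fun y => w (A y t) t).
  - intros y. symmetry. apply dx_u, Ht.
  - apply is_derive_eq with (/ g (A x t) t * w1 (A x t) t); [|apply Rmult_comm].
    apply (is_derive_comp (fun z => w z t) (fun y => A y t)); [apply w_a, Ht|apply A_space, Ht].
Qed.

Lemma dx_u_time x t : life t -> is_derive (fun s => dx u x s) t
  (w1 (A x t) t * (- V (A x t) t / g (A x t) t) + (lam * w (A x t) t ^ 2 + I t)).
Proof.
  intros Ht. apply is_derive_ext_loc with (fun s => w (A x s) s).
  - generalize (life_open t Ht). apply filter_imp. intros s Hs. symmetry. apply dx_u, Hs.
  - apply (is_derive_along w w1 (A x)).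
    + generalize (life_open_2 (A x t) t Ht). apply filter_imp. intros p Hp. apply w_a, Hp.
    + apply w1_cont, Ht.
    + apply w_t, Ht.
    + apply A_time, Ht.
Qed.

Lemma energy_integral t : life t -> RInt (fun y => dx u y t ^ 2) 0 1 = RInt (fun s => w s t ^ 2 * g s t) 0 1.
Proof.
  intros Ht.
  assert (Hc : forall y, continuous (fun y => dx u y t ^ 2) y).
  { intros y. apply cont_pow, (is_derive_continuous _ _ _ (dx_u_space y t Ht)). }
  rewrite <- (RInt_period (fun y => dx u y t ^ 2) (Gam 0 t)); auto.
  2:{ intros y. rewrite !dx_u, A_step, w_per by exact Ht. reflexivity. }
  rewrite <- Gam_period, Rplus_0_l by exact Ht.
  rewrite <- (RInt_comp (fun y => dx u y t ^ 2) (fun a => Gam a t) (fun a => g a t)).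
  - apply RInt_ext. intros a _. rewrite dx_u, A_left by exact Ht. unfold scal; simpl; unfold mult; simpl. ring.
  - intros; apply Hc.
  - intros a _. split; [apply Gam_label, Ht|apply g_section, Ht].
Qed.

Lemma continuous_strip_of (F : R -> R -> R) :
  (forall x t, life t -> continuous (fun p : R * R => F (fst p) (snd p)) (x, t)) -> continuous_strip T F.
Proof.
  intros HF [x t] [H0 Ht]. simpl in *.
  apply (filterlim_filter_le_1 (G := within (strip T) (locally (x, t))) (F := locally (x, t))).
  - intros P HP. unfold within. revert HP. apply filter_imp. auto.
  - apply (HF x t), life_nonneg; assumption.
Qed.

Lemma continuous_eulerian_ext (F F' : R -> R -> R) x t : life t ->
  (forall y s, life s -> F y s = F' y s) ->
  continuous (fun p : R * R => F' (fst p) (snd p)) (x, t) ->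
  continuous (fun p : R * R => F (fst p) (snd p)) (x, t).
Proof.
  intros Ht E. apply continuous_ext_loc.
  generalize (life_open_2 x t Ht). apply filter_imp. intros p Hp. symmetry. apply E, Hp.
Qed.

Lemma life_0 : life 0.
Proof. split; [exact tlow_neg|exact T_pos]. Qed.

Lemma Gam_init a : Gam a 0 = a.
Proof.
  unfold Gam. rewrite (RInt_ext _ (fun _ => 1)) by (intros; apply g_init). rewrite RInt_constR. lra.
Qed.

Lemma V_init a : V a 0 = u0 a.
Proof.
  unfold V. rewrite (RInt_ext _ (Derive u0)).
  - rewrite RInt_Derive; [lra| |]; intros; auto.
  - intros s _. rewrite g_init, w_init. eqR. ring.
Qed.

Theorem lagrangian_solution : solution lam u0 T u /\ characteristics T u Gam.
Proof.
  split.
  - split.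
    + intros x t H0 Ht. assert (L := life_nonneg t H0 Ht). unfold u. rewrite A_step, V_period by exact L.
      reflexivity.
    + intros x. unfold u. rewrite <- (Gam_init x) at 1. rewrite (A_left x 0 life_0). apply V_init.
    + intros x t H0 Ht. eexists. apply u_space, life_nonneg; assumption.
    + intros x t H0 Ht. eexists. apply dx_u_space, life_nonneg; assumption.
    + intros x t H0 Ht. eexists. apply dx_u_time, life_nonneg; [lra|assumption].
    + apply continuous_strip_of. intros x t L. apply Eulerian_cont; [exact L|]. apply V_cont, L.
    + apply continuous_strip_of. intros x t L.
      apply (continuous_eulerian_ext _ (fun y s => w (A y s) s)); [exact L|intros; apply dx_u; assumption|].
      apply Eulerian_cont; [exact L|]. apply w_cont, L.
    + apply continuous_strip_of. intros x t L.
      apply (continuous_eulerian_ext _ (fun y s => w1 (A y s) s / g (A y s) s)); [exact L| |].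
      * intros y s Ls. apply is_derive_unique, dx_u_space, Ls.
      * apply (Eulerian_cont (fun a s => w1 a s / g a s)); [exact L|].
        apply cont_div; [simpl; apply Rgt_not_eq, g_pos, L|apply w1_cont, L|apply g_cont, L].
    + intros x t H0 Ht. assert (L := life_nonneg t (Rlt_le _ _ H0) Ht).
      rewrite energy_integral by exact L.
      assert (E1 : dt (dx u) x t = _) by (apply is_derive_unique, dx_u_time, L).
      assert (E2 : dx (dx u) x t = _) by (apply is_derive_unique, dx_u_space, L).
      rewrite E1, E2, dx_u by exact L. rewrite (nonlocal_term t L). unfold u.
      assert (Hg := g_pos (A x t) t L). field. lra.
  - intros a Ha. split; [apply Gam_init|]. split.
    + intros t [H0 Ht]. assert (L := life_nonneg t H0 Ht).
      apply (filterlim_filter_le_1 (G := within (fun t : R => 0 <= t /\ Rbar_lt t T) (locally t)) (F := locally t)).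
      * intros P HP. unfold within. revert HP. apply filter_imp. auto.
      * apply (is_derive_continuous _ _ _ (Gam_time a t L)).
    + intros t H0 Ht. assert (L := life_nonneg t (Rlt_le _ _ H0) Ht).
      unfold u. rewrite A_left by exact L. apply Gam_time, L.
Qed.

End Lagrangian.

(** ** The explicit Lagrangian data *)

Lemma RInt_param_continuous (F : R -> R -> R) (L : R -> Prop) t0 : locally t0 L ->
  (forall s t, L t -> continuous (fun s => F s t) s) ->
  (forall s, continuous (fun q : R * R => F (fst q) (snd q)) (s, t0)) ->
  continuous (fun t => RInt (fun s => F s t) 0 1) t0.
Proof.
  intros HL Hs Hc. assert (L0 := locally_singleton _ _ HL).
  apply lim_eps. intros eps Heps. assert (He2 : 0 < eps / 2) by lra.
  destruct (tube_uniform (fun s t => Rabs (F s t - F s t0) < eps / 2) 0 1 t0) as [r [Hr Hu]]; [lra| |].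
  { intros x _.
    assert (He4 : 0 < eps / 4) by lra.
    destruct (locally_2d_elim _ _ _ (proj1 (lim_eps _ _) (Hc x) _ He4)) as [r [Hr H]]. simpl in H.
    exists r. split; [exact Hr|]. intros y s Hy Hst.
    assert (H1 := H y s Hy Hst).
    assert (H2 : Rabs (F y t0 - F x t0) < eps / 4).
    { apply H; [exact Hy|]. rewrite Rminus_diag, Rabs_R0. exact Hr. }
    apply Rabs_def2 in H1, H2. apply Rabs_def1; lra. }
  generalize (filter_and _ _ HL (locally_ball_intro (fun t => Rabs (t - t0) < r) t0 r Hr (fun x H => H))).
  apply filter_imp. intros t [Lt Htr].
  assert (E1 : ex_RInt (fun s => F s t) 0 1) by (apply continuous_ex_RInt; intros; apply Hs, Lt).
  assert (E0 : ex_RInt (fun s => F s t0) 0 1) by (apply continuous_ex_RInt; intros; apply Hs, L0).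
  assert (H1 : RInt (fun s => F s t) 0 1 <= RInt (fun s => F s t0 + eps / 2) 0 1).
  { apply RInt_le; [lra|exact E1| |].
    - apply (ex_RInt_plus (fun s => F s t0) (fun _ => eps / 2)); [exact E0|apply ex_RInt_const].
    - intros s Hsx. assert (H := Hu s t ltac:(lra) Htr). apply Rabs_def2 in H. lra. }
  assert (H2 : RInt (fun s => F s t0) 0 1 <= RInt (fun s => F s t + eps / 2) 0 1).
  { apply RInt_le; [lra|exact E0| |].
    - apply (ex_RInt_plus (fun s => F s t) (fun _ => eps / 2)); [exact E1|apply ex_RInt_const].
    - intros s Hsx. assert (H := Hu s t ltac:(lra) Htr). apply Rabs_def2 in H. lra. }
  rewrite (RInt_add (fun s => F s t0) (fun _ => eps / 2)), RInt_constR in H1 by (auto; apply ex_RInt_const).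
  rewrite (RInt_add (fun s => F s t) (fun _ => eps / 2)), RInt_constR in H2 by (auto; apply ex_RInt_const).
  apply Rabs_def1; lra.
Qed.

(** [Psi] stands for [(1 - lam z)^(-1/lam)], or for [exp] when [lam = 0]; its logarithmic derivative
    [1 / (1 - lam z)] is all that matters.  The moments [M n] are closed under differentiation in
    time, which makes the Jacobian [p 0 / M 0] and the slope satisfy the required equations. *)
Section ExplicitData.
Context (lam : R) (u0 f1 : R -> R) (T : Rbar) (tlow : R) (Psi eta : R -> R).
Let f := Derive u0.
Let life t := tlow < t /\ Rbar_lt (Finite t) T.
Let J t a := 1 - lam * (eta t * f a).
Let p (n : nat) a t := f a ^ n * (Psi (eta t * f a) / J t a ^ n).
Let M n t := RInt (fun a => p n a t) 0 1.
Let th t := Rpower (M 0%nat t) (- 2 * lam).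
Context (tlow_neg : tlow < 0) (T_pos : Rbar_lt 0 T).
Context (u0_per : periodic1 u0) (u0_diff : forall x, ex_derive u0 x).
Context (f_d : forall x, is_derive f x (f1 x)) (f1_cont : forall x, continuous f1 x).
Context (Psi_0 : Psi 0 = 1) (Psi_pos : forall z, 0 < 1 - lam * z -> 0 < Psi z).
Context (Psi_d : forall z, 0 < 1 - lam * z -> is_derive Psi z (Psi z / (1 - lam * z))).
Context (eta_0 : eta 0 = 0) (J_gt0 : forall t a, life t -> 0 < J t a).
Context (eta_d : forall t, life t -> is_derive eta t (th t)).

Lemma label_f_cont x : continuous f x.
Proof. exact (is_derive_continuous _ _ _ (f_d x)). Qed.

Lemma f_per : periodic1 f.
Proof.
  intros x. unfold f. transitivity (Derive (fun z => u0 (z + 1)) x).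
  - symmetry. unfold Derive. f_equal. apply Lim_ext. intros d.
    replace (x + d + 1) with (x + 1 + d) by ring. reflexivity.
  - apply Derive_ext. exact u0_per.
Qed.

Lemma f_mean : RInt f 0 1 = 0.
Proof.
  unfold f. rewrite RInt_Derive.
  - replace 1 with (0 + 1) by ring. rewrite u0_per. eqR. ring.
  - intros; apply u0_diff.
  - intros; apply label_f_cont.
Qed.

Lemma eta_cont t : life t -> continuous eta t.
Proof. intros Ht. exact (is_derive_continuous _ _ _ (eta_d t Ht)). Qed.

Lemma arg_cont a t : life t -> continuous (fun q : R * R => eta (snd q) * f (fst q)) (a, t).
Proof.
  intros Ht. apply cont_mult.
  - apply (continuous_comp snd eta); [apply continuous_snd|apply eta_cont, Ht].
  - apply (continuous_comp fst f); [apply continuous_fst|apply label_f_cont].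
Qed.

Lemma J_cont a t : life t -> continuous (fun q : R * R => J (snd q) (fst q)) (a, t).
Proof.
  intros Ht. unfold J. apply cont_minus; [apply continuous_const|].
  apply cont_mult; [apply continuous_const|]. apply arg_cont, Ht.
Qed.

Lemma p_cont n a t : life t -> continuous (fun q : R * R => p n (fst q) (snd q)) (a, t).
Proof.
  intros Ht. assert (HJ := J_gt0 t a Ht). unfold p. apply cont_mult.
  - apply cont_pow. apply (continuous_comp fst f); [apply continuous_fst|apply label_f_cont].
  - apply cont_div.
    + simpl. apply pow_nonzero. lra.
    + apply (continuous_comp (fun q : R * R => eta (snd q) * f (fst q)) Psi); [apply arg_cont, Ht|].
      exact (is_derive_continuous _ _ _ (Psi_d _ HJ)).
    + apply cont_pow, J_cont, Ht.
Qed.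

Lemma quotient_derive n z : 0 < 1 - lam * z ->
  is_derive (fun z => Psi z / (1 - lam * z) ^ n) z
    ((1 + INR n * lam) * (Psi z / (1 - lam * z) ^ S n)).
Proof.
  intros Hz. assert (Hn : (1 - lam * z) ^ n <> 0) by (apply pow_nonzero; lra).
  apply is_derive_eq with (Psi z / (1 - lam * z) * / (1 - lam * z) ^ n +
    Psi z * (- (INR n * (- lam) * (1 - lam * z) ^ pred n) / ((1 - lam * z) ^ n) ^ 2)).
  - apply (is_derive_mult Psi (fun z => / (1 - lam * z) ^ n)).
    + apply Psi_d, Hz.
    + apply (is_derive_inv (fun z => (1 - lam * z) ^ n)); [|exact Hn].
      apply (is_derive_pow (fun z => 1 - lam * z) n).
      auto_derive; auto; ring.
    + intros; apply Rmult_comm.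
  - destruct n as [|n].
    + simpl. field. lra.
    + rewrite S_INR. simpl pred. simpl pow in Hn |- *.
      assert (Hn' : (1 - lam * z) ^ n <> 0) by (apply pow_nonzero; lra).
      field. split; [exact Hn'|lra].
Qed.

Lemma p_time n a t : life t -> is_derive (p n a) t (th t * (1 + INR n * lam) * p (S n) a t).
Proof.
  intros Ht. assert (HJ := J_gt0 t a Ht). unfold J in HJ.
  apply is_derive_eq with (f a ^ n * (th t * f a *
    ((1 + INR n * lam) * (Psi (eta t * f a) / (1 - lam * (eta t * f a)) ^ S n)))).
  - apply (is_derive_scal (fun t => Psi (eta t * f a) / (1 - lam * (eta t * f a)) ^ n)).
    apply (is_derive_comp (fun z => Psi z / (1 - lam * z) ^ n) (fun t => eta t * f a)).
    + apply quotient_derive, HJ.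
    + apply is_derive_eq with (f a * th t); [|ring].
      apply is_derive_ext with (fun t => f a * eta t); [intros; apply Rmult_comm|].
      apply (is_derive_scal eta), eta_d, Ht.
  - unfold p, J. simpl (f a ^ S n). ring.
Qed.

Lemma p_section n a t : life t -> continuous (fun a => p n a t) a.
Proof. intros Ht. apply (section_cont (p n)), p_cont, Ht. Qed.

Lemma M_cont n t : life t -> continuous (M n) t.
Proof.
  intros Ht. apply (RInt_param_continuous (p n) life).
  - apply life_open, Ht.
  - intros s z Hz. apply p_section, Hz.
  - intros s. apply p_cont, Ht.
Qed.

Lemma p0_eq a t : p 0 a t = Psi (eta t * f a).
Proof. unfold p. simpl. field. Qed.

Lemma M0_pos t : life t -> 0 < M 0 t.
Proof.
  intros Ht. apply RInt_gt_0; [lra| |].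
  - intros b _. rewrite p0_eq. apply Psi_pos, J_gt0, Ht.
  - intros b _. apply p_section, Ht.
Qed.

Lemma th_cont t : life t -> continuous th t.
Proof.
  intros Ht. apply cont_Rpower; [apply M0_pos, Ht|apply M_cont, Ht|apply continuous_const].
Qed.

Lemma M_time n t : life t -> is_derive (M n) t (th t * (1 + INR n * lam) * M (S n) t).
Proof.
  intros Ht.
  assert (Hex : ex_RInt (fun a => p (S n) a t) 0 1).
  { apply continuous_ex_RInt. intros a. apply p_section, Ht. }
  unfold M at 2. rewrite <- RInt_mult_l by exact Hex.
  apply (is_derive_RInt_under (fun t a => p n a t) (fun t a => th t * (1 + INR n * lam) * p (S n) a t) life).
  - apply life_open, Ht.
  - intros s a Hs. apply p_time, Hs.
  - intros a. apply cont_mult; [|apply swap_cont, p_cont, Ht].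
    apply cont_mult; [|apply continuous_const].
    apply (continuous_comp fst th); [apply continuous_fst|apply th_cont, Ht].
  - intros s a Hs. apply p_section, Hs.
Qed.

Let g a t := p 0 a t / M 0 t.
Let w a t := th t * (f a / J t a - M 1 t / M 0 t).
Let w1 a t := th t * (f1 a / J t a ^ 2).
Let nonlocal t := th t ^ 2 * ((1 + lam) * ((M 1 t / M 0 t) ^ 2 - M 2 t / M 0 t)).

Lemma M0_time t : life t -> is_derive (M 0) t (th t * M 1 t).
Proof. intros Ht. apply is_derive_eq with (1 := M_time 0 t Ht). simpl. ring. Qed.

Lemma M1_time t : life t -> is_derive (M 1) t (th t * (1 + lam) * M 2 t).
Proof. intros Ht. apply is_derive_eq with (1 := M_time 1 t Ht). simpl. ring. Qed.

Lemma th_time t : life t -> is_derive th t (- 2 * lam * th t ^ 2 * M 1 t / M 0 t).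
Proof.
  intros Ht. assert (HM := M0_pos t Ht).
  apply is_derive_eq with (th t * M 1 t * (- 2 * lam * Rpower (M 0 t) (- 2 * lam - 1))).
  - apply (is_derive_comp (fun y => Rpower y (- 2 * lam)) (M 0)).
    + apply is_derive_Rpower, HM.
    + apply M0_time, Ht.
  - rewrite <- Rpower_scale_inv by exact HM. fold (th t). field. lra.
Qed.

Lemma quotient_time a t : life t ->
  is_derive (fun t => f a / J t a) t (lam * th t * f a ^ 2 / J t a ^ 2).
Proof.
  intros Ht. assert (HJ := J_gt0 t a Ht). unfold J in *.
  apply is_derive_eq with (th t * (lam * f a ^ 2 / (1 - lam * (eta t * f a)) ^ 2)); [|field; lra].
  apply (is_derive_comp (fun e => f a / (1 - lam * (e * f a))) eta); [|apply eta_d, Ht].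
  auto_derive; [lra|]. field. lra.
Qed.

Lemma ratio_time t : life t ->
  is_derive (fun t => M 1 t / M 0 t) t (th t * ((1 + lam) * (M 2 t / M 0 t) - (M 1 t / M 0 t) ^ 2)).
Proof.
  intros Ht. assert (HM := M0_pos t Ht).
  apply is_derive_eq with ((th t * (1 + lam) * M 2 t * M 0 t - M 1 t * (th t * M 1 t)) / M 0 t ^ 2).
  - apply is_derive_div; [apply M1_time, Ht|apply M0_time, Ht|lra].
  - field. lra.
Qed.

Lemma comp_snd_cont (F : R -> R) a t : continuous F t -> continuous (fun q : R * R => F (snd q)) (a, t).
Proof. intros HF. apply (continuous_comp snd F); [apply continuous_snd|exact HF]. Qed.

Lemma comp_fst_cont (F : R -> R) a t : continuous F a -> continuous (fun q : R * R => F (fst q)) (a, t).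
Proof. intros HF. apply (continuous_comp fst F); [apply continuous_fst|exact HF]. Qed.

Lemma M0_init : M 0 0 = 1.
Proof.
  unfold M. rewrite (RInt_ext _ (fun _ => 1)).
  - rewrite RInt_constR. eqR; ring.
  - intros a _. rewrite p0_eq, eta_0, Rmult_0_l. exact Psi_0.
Qed.

Lemma M1_init : M 1 0 = 0.
Proof.
  transitivity (RInt f 0 1); [|apply f_mean]. apply RInt_ext. intros a _. eqR.
  unfold p, J. rewrite eta_0, Rmult_0_l, Psi_0. field.
Qed.

Lemma th_init : th 0 = 1.
Proof. unfold th. rewrite M0_init. unfold Rpower. rewrite ln_1, Rmult_0_r. apply exp_0. Qed.

Theorem explicit_solution : exists u gam, solution lam u0 T u /\ characteristics T u gam.
Proof.
  assert (H := lagrangian_solution lam u0 T tlow g w w1 nonlocal tlow_neg T_pos u0_diff label_f_cont).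
  eexists. eexists. apply H; clear H.
  - intros a t Ht. apply Rdiv_lt_0_compat; [|apply M0_pos, Ht]. rewrite p0_eq. apply Psi_pos, J_gt0, Ht.
  - intros a t Ht. apply cont_div; [simpl; apply Rgt_not_eq, M0_pos, Ht|apply p_cont, Ht|].
    apply (comp_snd_cont (M 0)), M_cont, Ht.
  - intros a t Ht. assert (HM := M0_pos t Ht). assert (HJ := J_gt0 t a Ht).
    apply is_derive_eq with ((th t * (1 + INR 0 * lam) * p 1 a t * M 0 t - p 0 a t * (th t * M 1 t)) / M 0 t ^ 2).
    + apply is_derive_div; [apply p_time, Ht|apply M0_time, Ht|lra].
    + unfold w, g. replace (p 1 a t) with (p 0 a t * (f a / J t a)) by (unfold p; simpl; field; lra).
      simpl INR. field. lra.
  - intros a t Ht. unfold g, p, J. rewrite f_per. reflexivity.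
  - intros t Ht. assert (HM := M0_pos t Ht). unfold g, Rdiv.
    transitivity (RInt (fun a => / M 0 t * p 0 a t) 0 1).
    + apply RInt_ext. intros; eqR; ring.
    + rewrite (RInt_mult_l (fun a => p 0 a t)) by (apply continuous_ex_RInt; intros; apply p_section, Ht).
      fold (M 0 t). apply Rinv_l. lra.
  - intros a. unfold g. rewrite M0_init, p0_eq, eta_0, Rmult_0_l, Psi_0. field.
  - intros a t Ht. assert (HM := M0_pos t Ht). assert (HJ := J_gt0 t a Ht).
    apply cont_mult; [apply (comp_snd_cont th), th_cont, Ht|]. apply cont_minus.
    + apply cont_div; [simpl; lra|apply (comp_fst_cont f), label_f_cont|apply J_cont, Ht].
    + apply cont_div; [simpl; lra|apply (comp_snd_cont (M 1)), M_cont, Ht|apply (comp_snd_cont (M 0)), M_cont, Ht].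
  - intros a t Ht. assert (HJ := J_gt0 t a Ht). unfold J in HJ.
    apply is_derive_eq with (th t * (f1 a / J t a ^ 2 - 0)); [|unfold w1; ring].
    apply (is_derive_scal (fun z => f z / J t z - M 1 t / M 0 t)).
    apply (is_derive_minus (fun z => f z / J t z) (fun _ => M 1 t / M 0 t)).
    2: apply (is_derive_const (V := R_NormedModule)).
    apply is_derive_eq with (f1 a * (1 / (1 - lam * (eta t * f a)) ^ 2)); [|unfold J; field; lra].
    apply (is_derive_comp (fun y => y / (1 - lam * (eta t * y))) f); [|apply f_d].
    auto_derive; [lra|]. field. lra.
  - intros a t Ht. assert (HJ := J_gt0 t a Ht).
    apply cont_mult; [apply (comp_snd_cont th), th_cont, Ht|]. apply cont_div.
    + simpl. apply Rgt_not_eq. apply Rmult_lt_0_compat; lra.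
    + apply (comp_fst_cont f1), f1_cont.
    + apply cont_pow, J_cont, Ht.
  - intros a t Ht. assert (HM := M0_pos t Ht). assert (HJ := J_gt0 t a Ht).
    apply is_derive_eq with ((- 2 * lam * th t ^ 2 * M 1 t / M 0 t) * (f a / J t a - M 1 t / M 0 t) +
      th t * (lam * th t * f a ^ 2 / J t a ^ 2 -
              th t * ((1 + lam) * (M 2 t / M 0 t) - (M 1 t / M 0 t) ^ 2))).
    + apply (is_derive_mult th (fun t => f a / J t a - M 1 t / M 0 t)); [apply th_time, Ht| |intros; apply Rmult_comm].
      apply (is_derive_minus (fun t => f a / J t a) (fun t => M 1 t / M 0 t)).
      * apply quotient_time, Ht.
      * apply ratio_time, Ht.
    + unfold w, nonlocal. field. lra.
  - intros t Ht. assert (HM := M0_pos t Ht). unfold nonlocal.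
    assert (C0 := M_cont 0 t Ht). assert (C1 := M_cont 1 t Ht). assert (C2 := M_cont 2 t Ht).
    assert (Ct := th_cont t Ht).
    apply cont_mult; [apply cont_pow, Ct|]. apply cont_mult; [apply continuous_const|].
    apply cont_minus; [apply cont_pow|]; apply cont_div; auto; lra.
  - intros a t Ht. unfold w, J. rewrite f_per. reflexivity.
  - intros a. unfold w, J. rewrite th_init, M1_init, eta_0. fold (f a). field. rewrite M0_init. lra.
Qed.

End ExplicitData.

(** ** Existence up to the maximal time *)

Section TimeInverse.
Context (lam : R) (f : R -> R) (M0 m0 : R) (T : Rbar).
Context (lam_ne : lam <> 0) (f_cont : forall x, continuous f x).
Context (f_bounds : forall x, m0 <= f x <= M0) (M0_pos : 0 < M0) (m0_neg : m0 < 0).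
Notation es := (eta_star lam M0 m0).
Notation el := (eta_low lam M0 m0).
Notation K := (kernel_int lam f).
Notation time := (fun e => RInt (fun mu => Rpower (K mu) (2 * lam)) 0 e).
Context (T_pos : Rbar_lt 0 T) (HT : filterlim time (at_left es) (Rbar_locally T)).

Lemma time_reaches t : Rbar_lt (Finite t) T -> exists e, el < e < es /\ t < time e.
Proof.
  intros Ht. assert (Hl := eta_low_neg lam M0 m0 lam_ne M0_pos m0_neg).
  assert (Hs := eta_star_pos lam M0 m0 lam_ne M0_pos m0_neg).
  assert (E1 : at_left es (fun e => t < time e)).
  { apply HT. destruct T as [x| |]; simpl in *.
    - apply (locally_ball_intro _ x (x - t)); [lra|]. intros y Hy. apply Rabs_def2 in Hy. lra.
    - exists t. auto.
    - contradiction. }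
  destruct (at_left_elim _ _ E1) as [r [Hr Hr']].
  exists (Rmax 0 (es - r / 2)). assert (G1 := Rmax_l 0 (es - r / 2)). assert (G2 := Rmax_r 0 (es - r / 2)).
  assert (G3 : Rmax 0 (es - r / 2) < es) by (apply Rmax_lub_lt; lra).
  split; [lra|]. apply Hr'. lra.
Qed.

Lemma time_onto t : time (el / 2) < t -> Rbar_lt (Finite t) T -> exists e, el < e < es /\ time e = t.
Proof.
  intros Hlo Ht. assert (Hl := eta_low_neg lam M0 m0 lam_ne M0_pos m0_neg).
  destruct (time_reaches t Ht) as [e2 [He2 Hte2]].
  assert (Hlt : el / 2 < e2).
  { apply Rnot_le_lt. intros Hle. destruct (Rle_lt_or_eq_dec _ _ Hle) as [H|H].
    - assert (time e2 < time (el / 2)); [|lra].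
      apply (time_increasing lam f M0 m0); auto; try lra.
      generalize (eta_star_pos lam M0 m0 lam_ne M0_pos m0_neg). lra.
    - rewrite H in Hte2. lra. }
  destruct (IVT_interv (fun e => time e - t) (el / 2) e2) as [e [He Ee]]; [|lra|lra|lra|].
  - intros x Hx. apply continuity_pt_filterlim.
    apply (cont_minus time (fun _ => t) x); [|apply continuous_const].
    apply (is_derive_continuous _ _ _ (time_derive lam f M0 m0 lam_ne f_cont f_bounds M0_pos m0_neg x ltac:(lra))).
  - exists e. split; [lra|]. lra.
Qed.

Lemma time_inverse : exists tlow (eta : R -> R), tlow < 0 /\ eta 0 = 0 /\
  forall t, tlow < t -> Rbar_lt (Finite t) T ->
    el < eta t < es /\ is_derive eta t (Rpower (K (eta t)) (- 2 * lam)).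
Proof.
  assert (Hl := eta_low_neg lam M0 m0 lam_ne M0_pos m0_neg).
  assert (Hs := eta_star_pos lam M0 m0 lam_ne M0_pos m0_neg).
  set (eta := fun t => epsilon (inhabits 0) (fun e => el < e < es /\ time e = t)).
  assert (Heta : forall t, time (el / 2) < t -> Rbar_lt (Finite t) T -> el < eta t < es /\ time (eta t) = t).
  { intros t H1 H2. unfold eta. apply epsilon_spec, time_onto; assumption. }
  assert (Hlow : time (el / 2) < 0).
  { apply Rlt_le_trans with (time 0); [|right; apply time_0].
    apply (time_increasing lam f M0 m0); auto; lra. }
  exists (time (el / 2)), eta. split; [exact Hlow|]. split.
  - destruct (Heta 0 Hlow T_pos) as [H1 H2].
    assert (E0 := time_0 lam f).
    destruct (total_order_T (eta 0) 0) as [[H|H]|H]; auto.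
    + assert (time (eta 0) < time 0); [|lra]. apply (time_increasing lam f M0 m0); auto; lra.
    + assert (time 0 < time (eta 0)); [|lra]. apply (time_increasing lam f M0 m0); auto; lra.
  - intros t H1 H2. destruct (Heta t H1 H2) as [H3 H4]. split; [exact H3|].
    assert (Kp := kernel_pos lam f M0 m0 lam_ne f_cont f_bounds M0_pos m0_neg).
    assert (Kd := kernel_derive lam f M0 m0 lam_ne f_cont f_bounds M0_pos m0_neg).
    replace (- 2 * lam) with (- (2 * lam)) by ring. rewrite Rpower_Ropp.
    apply (inverse_derive_space (fun e _ => time e) (fun e _ => Rpower (K e) (2 * lam))
             (Finite el) (Finite es) (fun _ => True)) with (A := fun x _ => eta x) (t0 := 0); auto.
    + intros; apply filter_true.
    + intros a s [Ha1 Ha2] _. apply (time_derive lam f M0 m0); auto.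
    + intros; apply Rpower_gt0.
    + intros a s [Ha1 Ha2] _. assert (Ka := Kp a (conj Ha1 Ha2)).
      apply (comp_fst_cont (fun e => Rpower (K e) (2 * lam))).
      apply cont_Rpower; [exact Ka| |apply continuous_const].
      exact (is_derive_continuous _ _ _ (Kd a (conj Ha1 Ha2))).
    + intros; apply continuous_const.
    + assert (E : locally t (fun x => time (el / 2) < x /\ Rbar_lt (Finite x) T)).
      { apply filter_and; [|apply before_locally, H2].
        apply (locally_ball_intro _ t (t - time (el / 2))); [lra|]. intros s Hs'. apply Rabs_def2 in Hs'. lra. }
      generalize (continuous_fst t 0 _ E). unfold filtermap. apply filter_imp.
      intros p [Hp1 Hp2]. destruct (Heta _ Hp1 Hp2) as [[G1 G2] G3]. split; [split; assumption|exact G3].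
Qed.

End TimeInverse.

Lemma solution_exists (lam : R) (u0 f1 : R -> R) (M0 m0 : R) (T : Rbar) :
  lam <> 0 -> periodic1 u0 -> (forall x, ex_derive u0 x) ->
  (forall x, is_derive (Derive u0) x (f1 x)) -> (forall x, continuous f1 x) ->
  (forall x, m0 <= Derive u0 x <= M0) -> 0 < M0 -> m0 < 0 -> Rbar_lt 0 T ->
  filterlim (time_of_eta lam u0) (at_left (eta_star lam M0 m0)) (Rbar_locally T) ->
  exists u gam, solution lam u0 T u /\ characteristics T u gam.
Proof.
  intros Hlam Hper Hdiff Hf Hf1 Hb HM Hm HT Htime.
  assert (Hfc : forall x, continuous (Derive u0) x) by (intros x; exact (is_derive_continuous _ _ _ (Hf x))).
  destruct (time_inverse lam (Derive u0) M0 m0 T Hlam Hfc Hb HM Hm HT Htime)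
    as [tlow [eta [Hlow [Heta0 Heta]]]].
  assert (HJ : forall t a, tlow < t /\ Rbar_lt (Finite t) T -> 0 < 1 - lam * (eta t * Derive u0 a)).
  { intros t a [H1 H2]. rewrite <- Rmult_assoc. apply (J_pos lam (Derive u0) M0 m0); auto.
    apply Heta; assumption. }
  apply (explicit_solution lam u0 f1 T tlow (fun z => Rpower (1 - lam * z) (- / lam)) eta); auto.
  - rewrite Rmult_0_r, Rminus_0_r. unfold Rpower. rewrite ln_1, Rmult_0_r. apply exp_0.
  - intros; apply Rpower_gt0.
  - intros z Hz.
    apply is_derive_eq with (- lam * (- / lam * Rpower (1 - lam * z) (- / lam - 1))).
    + apply (is_derive_comp (fun y => Rpower y (- / lam)) (fun z => 1 - lam * z)).
      * apply is_derive_Rpower, Hz.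
      * auto_derive; auto; ring.
    + rewrite <- Rpower_scale_inv by exact Hz. field. split; [lra|exact Hlam].
  - intros t [H1 H2]. apply is_derive_eq with (1 := proj2 (Heta t H1 H2)). f_equal.
    apply RInt_ext. intros a _. eqR. rewrite !pow_O, Rmult_1_l, Rdiv_1_r, Rmult_assoc. reflexivity.
Qed.

(** For [lam = 0] the reparametrized time is the time itself. *)
Lemma solution_exists_0 (u0 f1 : R -> R) :
  periodic1 u0 -> (forall x, ex_derive u0 x) ->
  (forall x, is_derive (Derive u0) x (f1 x)) -> (forall x, continuous f1 x) ->
  exists u gam, solution 0 u0 p_infty u /\ characteristics p_infty u gam.
Proof.
  intros Hper Hdiff Hf Hf1.
  apply (explicit_solution 0 u0 f1 p_infty (-1) exp (fun t => t)); auto; simpl; auto.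
  - lra.
  - apply exp_0.
  - intros; apply exp_pos.
  - intros z _. apply is_derive_eq with (1 := is_derive_exp z). field.
  - intros; lra.
  - intros t _. apply is_derive_eq with 1; [apply (is_derive_id (K := R_AbsRing))|].
    rewrite Rmult_0_r. unfold Rpower. rewrite Rmult_0_l, exp_0. reflexivity.
Qed.

(** * Zeros of finite order *)

Lemma sum_first_term (g : nat -> R) n :
  (forall i, (1 <= i <= n)%nat -> g i = 0) -> sum_f_R0 g n = g 0%nat.
Proof.
  induction n as [|n IH]; intros Hg; simpl; [reflexivity|].
  rewrite IH by (intros; apply Hg; lia). rewrite (Hg (S n)) by lia. ring.
Qed.

Lemma taylor_right (f : R -> R) k a x : smooth f -> a < x ->
  (forall i, (1 <= i <= k)%nat -> Derive_n f i a = 0) ->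
  exists z, a < z < x /\ f x - f a = (x - a) ^ S k / INR (fact (S k)) * Derive_n f (S k) z.
Proof.
  intros Hs Hx Hz. destruct (Taylor_Lagrange f k a x Hx) as [z [Hz1 Hz2]].
  - intros; apply Hs.
  - exists z. split; [exact Hz1|]. rewrite Hz2, sum_first_term.
    + simpl pow at 1. simpl fact at 1. simpl (Derive_n f 0 a). simpl INR at 1. field.
      apply INR_fact_neq_0.
    + intros i Hi. rewrite Hz by exact Hi. ring.
Qed.

Lemma taylor_abs (f : R -> R) k a x : smooth f -> x <> a ->
  (forall i, (1 <= i <= k)%nat -> Derive_n f i a = 0) ->
  exists z, Rabs (z - a) < Rabs (x - a) /\
    Rabs (f x - f a) = Rabs (x - a) ^ S k / INR (fact (S k)) * Rabs (Derive_n f (S k) z).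
Proof.
  intros Hs Hx Hz. assert (HF : 0 < INR (fact (S k))) by apply INR_fact_lt_0.
  destruct (Rle_lt_dec a x) as [H|H].
  - destruct (taylor_right f k a x Hs) as [z [Hz1 Hz2]]; [lra|exact Hz|].
    exists z. split; [rewrite !Rabs_pos_eq; lra|].
    rewrite Hz2, Rabs_mult. f_equal. unfold Rdiv. rewrite Rabs_mult, RPow_abs.
    f_equal. apply Rabs_pos_eq. left; apply Rinv_0_lt_compat, HF.
  - assert (Hopp : forall n y, Derive_n (fun y => f (- y)) n y = (-1) ^ n * Derive_n f n (- y)).
    { intros n y. apply Derive_n_comp_opp. apply filter_forall. intros; apply Hs. }
    destruct (taylor_right (fun y => f (- y)) k (- a) (- x)) as [z [Hz1 Hz2]].
    + intros n y. apply ex_derive_n_comp_opp. apply filter_forall. intros; apply Hs.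
    + lra.
    + intros i Hi. rewrite Hopp, Ropp_involutive, Hz by exact Hi. ring.
    + exists (- z). split.
      { rewrite !Rabs_left; lra. }
      rewrite !Ropp_involutive, Hopp in Hz2. rewrite Hz2, Rabs_mult, Rabs_mult.
      replace (Rabs ((-1) ^ S k)) with 1 by (symmetry; apply pow_1_abs).
      rewrite Rmult_1_l. f_equal. unfold Rdiv. rewrite Rabs_mult.
      rewrite (Rabs_pos_eq (/ _)) by (left; apply Rinv_0_lt_compat, HF). f_equal.
      rewrite <- RPow_abs. f_equal.
      replace (- x - - a) with (- (x - a)) by ring. apply Rabs_Ropp.
Qed.

(** By Taylor's formula with the remainder of Lagrange, the constant is
    [|f^(k+1)(a)| / (k + 1)!]. *)
Lemma power_zero_of_derivatives (f h : R -> R) k a : smooth f ->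
  (forall i, (1 <= i <= k)%nat -> Derive_n f i a = 0) -> Derive_n f (S k) a <> 0 ->
  (forall x, h x = Rabs (f x - f a)) -> power_zero h (S k) a.
Proof.
  intros Hs Hz Hnz Hh. assert (HF : 0 < INR (fact (S k))) by apply INR_fact_lt_0.
  set (D := fun x => Rabs (Derive_n f (S k) x)).
  assert (HD : 0 < D a) by apply Rabs_pos_lt, Hnz.
  assert (HDc : continuous D a).
  { apply cont_Rabs. apply (ex_derive_continuous (V := R_NormedModule)). apply (Hs (S (S k)) a). }
  exists (D a / INR (fact (S k))). split; [apply Rdiv_lt_0_compat; assumption|].
  intros kap Hk.
  assert (G1 : D a / (1 + kap) < D a).
  { apply Rmult_lt_reg_r with (1 + kap); [lra|]. unfold Rdiv. rewrite Rmult_assoc, Rinv_l; nra. }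
  assert (G2 : D a < (1 + kap) * D a) by nra.
  destruct (locally_ball_elim _ _ (filter_and _ _ (lim_eventually_gt D _ _ HDc G1)
    (lim_eventually_lt D _ _ HDc G2))) as [r [Hr Hr']].
  exists (r / 2). split; [lra|]. intros x Hx. rewrite Hh.
  destruct (Req_dec x a) as [->|Hne].
  - rewrite !Rminus_diag, Rabs_R0, pow_i by lia. lra.
  - destruct (taylor_abs f k a x Hs Hne Hz) as [z [Hz1 Hz2]]. rewrite Hz2. fold (D z).
    destruct (Hr' z) as [H1 H2]; [lra|].
    assert (HP : 0 <= Rabs (x - a) ^ S k / INR (fact (S k))).
    { apply Rmult_le_pos; [apply pow_Rabs_nonneg|left; apply Rinv_0_lt_compat, HF]. }
    assert (H1' : D a <= (1 + kap) * D z).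
    { apply (Rmult_lt_compat_l (1 + kap)) in H1; [|lra].
      replace ((1 + kap) * (D a / (1 + kap))) with (D a) in H1 by (field; lra). lra. }
    unfold Rdiv in *.
    set (X := Rabs (x - a) ^ S k) in *. set (F := / INR (fact (S k))) in *.
    split; nra.
Qed.

(** * The regimes of the parameter *)

Lemma pow0_large (F : (R -> Prop) -> Prop) (FF : Filter F) (f : R -> R) e : 0 < e ->
  filterlim f F (Rbar_locally p_infty) -> filterlim (fun t => pow0 (f t) e) F (Rbar_locally p_infty).
Proof.
  intros He Hf. apply lim_pinfty. intros B.
  set (B' := Rmax B 1). assert (HB := Rmax_l B 1). assert (HB1 := Rmax_r B 1). fold B' in HB, HB1.
  generalize (proj1 (lim_pinfty f) Hf (Rpower B' (/ e))). apply filter_imp. intros t Ht.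
  assert (H0 : 0 < Rpower B' (/ e)) by apply Rpower_gt0.
  rewrite pow0_pos by lra. apply Rle_lt_trans with (1 := HB).
  replace B' with (Rpower (Rpower B' (/ e)) e) at 1.
  - apply Rlt_Rpower_l; lra.
  - rewrite Rpower_mult, Rinv_l, Rpower_1; lra.
Qed.

Section InitialData.
Context (u0 : R -> R) (M0 m0 : R).
Context (u0_smooth : smooth u0) (u0_periodic : periodic1 u0).
Context (M0_max : greatest_value (Derive u0) M0) (m0_min : least_value (Derive u0) m0).
Context (M0_pos : 0 < M0) (m0_neg : m0 < 0).
Let f := Derive u0.

Lemma u0_derivable x : ex_derive u0 x.
Proof. exact (u0_smooth 1%nat x). Qed.

Lemma f_derive x : is_derive f x (Derive_n u0 2 x).
Proof. apply Derive_correct. exact (u0_smooth 2%nat x). Qed.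

Lemma f_continuous x : continuous f x.
Proof. exact (is_derive_continuous _ _ _ (f_derive x)). Qed.

Lemma f_derivative_continuous x : continuous (Derive_n u0 2) x.
Proof. apply (ex_derive_continuous (V := R_NormedModule)). exact (u0_smooth 3%nat x). Qed.

Lemma f_smooth : smooth f.
Proof.
  intros n x. destruct n as [|n]; [exact Logic.I|].
  simpl. apply ex_derive_ext with (Derive_n u0 (S n)).
  - intros y. replace (S n) with (n + 1)%nat by lia. symmetry. exact (Derive_n_comp u0 n 1%nat y).
  - exact (u0_smooth (S (S n)) x).
Qed.

Lemma f_range x : m0 <= f x <= M0.
Proof.
  destruct M0_max as [_ HM]. destruct m0_min as [_ Hm].
  destruct (period_representative x) as [y [n [Hy ->]]].
  rewrite (periodic_IZR f) by (apply f_per; exact u0_periodic).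
  split; [apply Hm|apply HM]; lra.
Qed.

(** [u0''] is the derivative of [f], which shifts the order by one. *)
Lemma order_flatness k a : zero_of_order (Derive_n u0 2) k a ->
  (forall i, (1 <= i <= k)%nat -> Derive_n f i a = 0) /\ Derive_n f (S k) a <> 0.
Proof.
  assert (E : forall j, Derive_n (Derive_n u0 2) j a = Derive_n f (S j) a).
  { intros j. rewrite Derive_n_comp. replace (j + 2)%nat with (S j + 1)%nat by lia.
    symmetry. exact (Derive_n_comp u0 (S j) 1%nat a). }
  intros [H1 H2]. split.
  - intros i Hi. replace i with (S (i - 1)) by lia. rewrite <- E. apply H1. lia.
  - rewrite <- E. exact H2.
Qed.

Section FixedParameter.
Context (lam : R) (k : nat) (k_pos : (1 <= k)%nat) (lam_ne : lam <> 0).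
Notation h := (gap lam M0 m0 f).
Context (peak_order : forall a, 0 <= a <= 1 -> h a = 0 -> zero_of_order (Derive_n u0 2) k a).
Let q := S k.

Lemma q_ge_2 : (2 <= q)%nat.
Proof. unfold q. lia. Qed.

Lemma h_continuous x : continuous h x.
Proof. apply gap_cont, f_continuous. Qed.

Lemma h_nonneg x : 0 <= h x.
Proof. apply gap_nonneg; auto. exact f_range. Qed.

Lemma h_power_zeros a : 0 <= a <= 1 -> h a = 0 -> power_zero h q a.
Proof.
  intros Ha Hz. destruct (order_flatness k a (peak_order a Ha Hz)) as [H1 H2].
  apply (power_zero_of_derivatives f); auto; [exact f_smooth|].
  intros x. assert (Hx := h_nonneg x). unfold gap in *.
  replace (peak lam M0 m0 - sgn lam * f x) with (sgn lam * (f a - f x)) in * by lra.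
  rewrite <- (Rabs_pos_eq (sgn lam * (f a - f x))) by exact Hx.
  rewrite Rabs_mult, (Rabs_minus_sym (f a)).
  replace (Rabs (sgn lam)) with 1; [ring|].
  unfold sgn. destruct (Rlt_dec 0 lam); [rewrite Rabs_pos_eq|rewrite Rabs_left]; lra.
Qed.

Lemma M0_attained : exists a, 0 <= a <= 1 /\ f a = M0.
Proof. exact (proj1 M0_max). Qed.

Lemma m0_attained : exists a, 0 <= a <= 1 /\ f a = m0.
Proof. exact (proj1 m0_min). Qed.

Lemma h_zero_exists : exists a, 0 <= a <= 1 /\ h a = 0.
Proof.
  unfold gap. destruct (sgn_cases lam M0 m0 lam_ne) as [[_ [-> ->]]|[_ [-> ->]]].
  - destruct M0_attained as [a [Ha Hf]]. exists a. split; [exact Ha|]. rewrite Hf. ring.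
  - destruct m0_attained as [a [Ha Hf]]. exists a. split; [exact Ha|]. rewrite Hf. ring.
Qed.

Lemma h_pos_exists : exists a, 0 <= a <= 1 /\ 0 < h a.
Proof.
  unfold gap. destruct (sgn_cases lam M0 m0 lam_ne) as [[_ [-> ->]]|[_ [-> ->]]].
  - destruct m0_attained as [a [Ha Hf]]. exists a. split; [exact Ha|]. rewrite Hf. lra.
  - destruct M0_attained as [a [Ha Hf]]. exists a. split; [exact Ha|]. rewrite Hf. lra.
Qed.

#[local] Hint Resolve h_continuous h_nonneg q_ge_2 h_power_zeros h_zero_exists h_pos_exists
  f_continuous f_range M0_attained m0_attained : core.

Lemma life_span T (P : (R -> R -> R) -> (R -> R -> R) -> Prop) : Rbar_lt 0 T ->
  filterlim (time_of_eta lam u0) (at_left (eta_star lam M0 m0)) (Rbar_locally T) ->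
  (forall u gam, solution lam u0 T u -> characteristics T u gam -> P u gam) ->
  solution_up_to lam u0 M0 m0 T P.
Proof.
  intros H0 HT HP. split; [|split; [|exact HP]].
  - split; [intros; contradiction|]. intros _. exact HT.
  - apply (solution_exists lam u0 (Derive_n u0 2) M0 m0 T); auto.
    + exact u0_derivable.
    + exact f_derive.
    + exact f_derivative_continuous.
Qed.

(** All that the regimes below use of a solution: its gradient is a profile with parameter
    [dl t], which tends to 0 at the end of the life span. *)
Definition described_by (T : Rbar) (u gam : R -> R -> R) (dl : R -> R) (t : R) : Prop :=
  0 < t /\ Rbar_lt (Finite t) T /\ 0 < dl t /\
  (forall a, 0 <= a <= 1 -> ux_along u gam a t = sgn lam * profile h lam (dl t) a) /\
  (forall p, 0 < p -> Lp_ux p u t = pow0 (profile_mass h lam p (dl t)) (/ p)).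

Lemma solution_described T u gam : Rbar_lt 0 T ->
  filterlim (time_of_eta lam u0) (at_left (eta_star lam M0 m0)) (Rbar_locally T) ->
  solution lam u0 T u -> characteristics T u gam ->
  exists dl : R -> R, filterlim dl (at_end T) (at_right 0) /\ at_end T (described_by T u gam dl).
Proof.
  intros H0 HT Hs Hc.
  destruct (solution_as_profile lam u0 M0 m0 T u gam lam_ne f_continuous f_range M0_pos m0_neg
    M0_attained m0_attained H0 HT Hs Hc) as [dl [Hdl H]].
  exists dl. split; [exact Hdl|]. apply (at_end_intro T _ 0 H0). intros t Ht HtT.
  destruct (H t Ht HtT) as [H1 [H2 H3]]. repeat split; auto.
  intros p Hp. apply (Lp_norm_profile lam u0 M0 m0 u); auto.
Qed.

Section Described.
Context (T : Rbar) (u gam : R -> R -> R) (dl : R -> R).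
Context (dl_lim : filterlim dl (at_end T) (at_right 0)).
Context (dl_desc : at_end T (described_by T u gam dl)).

Lemma limit_of (F G : R -> R) (l : Rbar) :
  (forall t, described_by T u gam dl t -> F t = G (dl t)) ->
  filterlim G (at_right 0) (Rbar_locally l) -> filterlim F (at_end T) (Rbar_locally l).
Proof.
  intros HF HG. apply (lim_ext (fun t => G (dl t))).
  - revert dl_desc. apply filter_imp. intros t Ht. symmetry. apply HF, Ht.
  - exact (filterlim_comp _ _ _ dl G _ _ _ dl_lim HG).
Qed.

Lemma limit_along a (l : Rbar) : 0 <= a <= 1 ->
  filterlim (fun d => sgn lam * profile h lam d a) (at_right 0) (Rbar_locally l) ->
  filterlim (ux_along u gam a) (at_end T) (Rbar_locally l).
Proof. intros Ha. apply limit_of. intros t [_ [_ [_ [Hux _]]]]. apply Hux, Ha. Qed.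

Lemma limit_Lp p (l : Rbar) : 0 < p ->
  filterlim (fun d => pow0 (profile_mass h lam p d) (/ p)) (at_right 0) (Rbar_locally l) ->
  filterlim (Lp_ux p u) (at_end T) (Rbar_locally l).
Proof. intros Hp. apply limit_of. intros t [_ [_ [_ [_ HL]]]]. apply HL, Hp. Qed.

(** Along characteristics [u_x] is an increasing function of [u0'], at every time. *)
Lemma limit_sup a (l : Rbar) : 0 <= a <= 1 -> f a = M0 ->
  filterlim (fun d => sgn lam * profile h lam d a) (at_right 0) (Rbar_locally l) ->
  filterlim (Msup u gam) (at_end T) (Rbar_locally l).
Proof.
  intros Ha Hf. apply limit_of. intros t [_ [_ [Hd [Hux _]]]].
  apply (profile_sup lam u0 M0 m0 u gam); auto.
Qed.

Lemma limit_inf a (l : Rbar) : 0 <= a <= 1 -> f a = m0 ->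
  filterlim (fun d => sgn lam * profile h lam d a) (at_right 0) (Rbar_locally l) ->
  filterlim (minf u gam) (at_end T) (Rbar_locally l).
Proof.
  intros Ha Hf. apply limit_of. intros t [_ [_ [Hd [Hux _]]]].
  apply (profile_inf lam u0 M0 m0 u gam); auto.
Qed.

End Described.

Lemma INR_q : INR q = 1 + INR k.
Proof. unfold q. rewrite S_INR. ring. Qed.

(** ** Positive [lam] *)

Lemma gap_pos_lam a : 0 < lam -> h a = M0 - f a.
Proof. intros Hl. unfold gap, peak, sgn. destruct (Rlt_dec 0 lam); [ring|contradiction]. Qed.

Lemma limit_sgn_pos (G : R -> R) (l : Rbar) : 0 < lam ->
  filterlim G (at_right 0) (Rbar_locally l) ->
  filterlim (fun d => sgn lam * G d) (at_right 0) (Rbar_locally l).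
Proof.
  intros Hl. apply filterlim_ext. intros d. unfold sgn. destruct (Rlt_dec 0 lam); [ring|contradiction].
Qed.

(** The life span is infinite because the rate of time is at least a multiple of [1 / d]. *)
Theorem global_regime : 0 < lam <= (1 + INR k) / 2 ->
  solution_up_to lam u0 M0 m0 p_infty (fun u gam =>
    (lam < (1 + INR k) / 2 ->
       forall a, 0 <= a <= 1 -> is_lim (ux_along u gam a) p_infty 0) /\
    (lam = (1 + INR k) / 2 ->
       exists v : R -> R,
         (forall a, 0 <= a <= 1 -> is_lim (ux_along u gam a) p_infty (v a)) /\
         (exists a, 0 <= a <= 1 /\ v a <> 0))).
Proof.
  intros [Hl0 Hl]. rewrite <- INR_q in *.
  destruct (inverse_time_lower h q h_continuous h_nonneg q_ge_2 h_power_zeros h_zero_exists lam Hl0 Hl)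
    as [c [Hc0 Hlow]].
  assert (HT := time_unbounded lam f M0 m0 lam_ne f_continuous f_range M0_pos m0_neg c Hc0 Hlow).
  apply life_span; [exact Logic.I|exact HT|]. intros u gam Hs Hch.
  destruct (solution_described p_infty u gam Logic.I HT Hs Hch) as [dl [Hdl Hall]].
  split.
  - intros Hlt a Ha. apply (limit_along p_infty u gam dl Hdl Hall a 0 Ha), limit_sgn_pos; [exact Hl0|].
    apply (profile_vanishes h q); auto.
  - intros Heq.
    assert (Hcrit := fun a => profile_critical_limit h q h_continuous h_nonneg q_ge_2 h_power_zeros
                                h_zero_exists lam a Heq).
    exists (fun a => proj1_sig (constructive_indefinite_description _ (Hcrit a))). split.
    + intros a Ha. destruct (constructive_indefinite_description _ (Hcrit a)) as [v [Hv Hv0]]. simpl.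
      apply (limit_along p_infty u gam dl Hdl Hall a v Ha), limit_sgn_pos; assumption.
    + destruct h_pos_exists as [a [Ha Hp]]. exists a. split; [exact Ha|].
      destruct (constructive_indefinite_description _ (Hcrit a)) as [v [Hv0 Hv]]. simpl. auto.
Qed.

(** The peaks of [u0'] blow up to plus infinity; the mean value that is subtracted drags all other
    labels, the minima of [u0'] included, to minus infinity. *)
Theorem two_sided_blowup_pos : (1 + INR k) / 2 < lam -> exists T : R, 0 < T /\
  solution_up_to lam u0 M0 m0 T (fun u gam =>
    tends_left (Msup u gam) T p_infty /\
    tends_left (minf u gam) T m_infty /\
    (forall a, 0 <= a <= 1 -> f a <> M0 -> tends_left (ux_along u gam a) T m_infty) /\
    (forall p, 1 < p -> tends_left (Lp_ux p u) T p_infty)).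
Proof.
  intros Hl. rewrite <- INR_q in Hl.
  assert (Hl0 : 0 < lam) by (generalize (pos_INR q); lra).
  destruct (inverse_time_upper h q h_continuous h_nonneg q_ge_2 h_power_zeros h_zero_exists lam Hl)
    as [C [r [HC [Hr Hup]]]].
  destruct (time_bounded lam f M0 m0 lam_ne f_continuous f_range M0_pos m0_neg C r HC Hr Hup) as [T [HT0 HT]].
  exists T. split; [exact HT0|]. apply life_span; [exact HT0|exact HT|]. intros u gam Hs Hch.
  destruct (solution_described T u gam HT0 HT Hs Hch) as [dl [Hdl Hall]].
  assert (Hoff : forall a, f a <> M0 ->
    filterlim (fun d => sgn lam * profile h lam d a) (at_right 0) (Rbar_locally m_infty)).
  { intros a Hfa. apply limit_sgn_pos; [exact Hl0|].
    apply (profile_off_zero_diverges_pos h q); auto.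
    rewrite gap_pos_lam by exact Hl0. generalize (f_range a). lra. }
  destruct M0_attained as [aM [HaM HfM]]. destruct m0_attained as [am [Ham Hfm]].
  split; [|split; [|split]].
  - apply (limit_sup T u gam dl Hdl Hall aM p_infty HaM HfM), limit_sgn_pos; [exact Hl0|].
    apply (profile_at_zero_diverges_pos h q); auto. rewrite gap_pos_lam by exact Hl0. lra.
  - apply (limit_inf T u gam dl Hdl Hall am m_infty Ham Hfm), Hoff. lra.
  - intros a Ha Hfa. apply (limit_along T u gam dl Hdl Hall a m_infty Ha), Hoff, Hfa.
  - intros p Hp. apply (limit_Lp T u gam dl Hdl Hall p p_infty); [lra|].
    apply pow0_large; [apply at_right_proper_filter|apply Rinv_0_lt_compat; lra|].
    apply (lim_pinfty_ge (fun d => profile_mass h lam 1 d - 1)).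
    2: apply lim_pinfty_minus_const, (profile_mass_diverges_pos h q); auto.
    generalize (at_right_0_lt 1 Rlt_0_1). apply filter_imp. intros d Hd.
    apply (profile_mass_ge_first h); auto; lra.
Qed.

(** ** Negative [lam] *)

Lemma gap_neg_lam a : lam < 0 -> h a = f a - m0.
Proof. intros Hl. unfold gap, peak, sgn. destruct (Rlt_dec 0 lam); [lra|ring]. Qed.

Lemma limit_sgn_neg (G : R -> R) (l : Rbar) : lam < 0 ->
  filterlim (fun d => - G d) (at_right 0) (Rbar_locally l) ->
  filterlim (fun d => sgn lam * G d) (at_right 0) (Rbar_locally l).
Proof.
  intros Hl. apply filterlim_ext. intros d. unfold sgn. destruct (Rlt_dec 0 lam); [lra|ring].
Qed.

Lemma negative_life_span (P : R -> (R -> R -> R) -> (R -> R -> R) -> Prop) : lam < 0 ->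
  (forall (T : R) u gam (dl : R -> R), 0 < T -> solution lam u0 T u ->
     filterlim dl (at_left T) (at_right 0) -> at_left T (described_by T u gam dl) -> P T u gam) ->
  exists T : R, 0 < T /\ solution_up_to lam u0 M0 m0 T (P T).
Proof.
  intros Hl HP.
  destruct (inverse_time_upper_neg h q h_continuous h_nonneg q_ge_2 h_power_zeros h_zero_exists
              h_pos_exists lam Hl) as [C [r [HC [Hr Hup]]]].
  destruct (time_bounded lam f M0 m0 lam_ne f_continuous f_range M0_pos m0_neg C r HC Hr Hup)
    as [T [HT0 HT]].
  exists T. split; [exact HT0|]. apply life_span; [exact HT0|exact HT|]. intros u gam Hs Hch.
  destruct (solution_described T u gam HT0 HT Hs Hch) as [dl [Hdl Hall]]. eapply HP; eauto.
Qed.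

(** For [lam < 0] the minima of [u0'] are the zeros of [h], and the sign is reversed. *)
Lemma minimum_diverges a : lam < 0 -> f a = m0 ->
  filterlim (fun d => sgn lam * profile h lam d a) (at_right 0) (Rbar_locally m_infty).
Proof.
  intros Hl Ha. apply limit_sgn_neg; [exact Hl|].
  apply lim_opp_pinfty, (profile_at_zero_diverges_neg h q); auto.
  rewrite gap_neg_lam by exact Hl. lra.
Qed.

Lemma inv_neg_lt x c : x < 0 -> c < 0 -> c < x -> / x < / c.
Proof. intros. apply Rinv_lt_contravar; nra. Qed.

(** With [q = k + 1] the two conditions on [lam] say that [1/lam + 1 < 1/q] and [1/lam + p < 1/q]: the
    integrals that decide about the values off the minima and about the norm are subcritical. *)
Theorem one_sided_blowup : - ((1 + INR k) / INR k) < lam < 0 -> exists T : R, 0 < T /\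
  solution_up_to lam u0 M0 m0 T (fun u gam =>
    tends_left (minf u gam) T m_infty /\
    (forall a, 0 <= a <= 1 -> f a = m0 -> tends_left (ux_along u gam a) T m_infty) /\
    (forall a, 0 <= a <= 1 -> f a <> m0 ->
       exists C : R, at_left T (fun t => Rabs (ux_along u gam a t) <= C)) /\
    (exists l : R, tends_left (Msup u gam) T l) /\
    (forall p, 1 <= p -> (1 + INR k) / (1 - p * (1 + INR k)) < lam ->
       exists l : R, tends_left (Lp_ux p u) T l)).
Proof.
  intros [Hlk Hl]. assert (Hk : 1 <= INR k) by (apply (le_INR 1); exact k_pos).
  apply (negative_life_span (fun T u gam => _) Hl). intros T u gam dl _ _ Hdl Hall.
  assert (Hexp : / lam + 1 < / INR q).
  { assert (G1 : 0 < (1 + INR k) / INR k) by (apply Rdiv_lt_0_compat; lra).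
    assert (G := inv_neg_lt lam (- ((1 + INR k) / INR k)) Hl ltac:(lra) Hlk).
    replace (/ - ((1 + INR k) / INR k)) with (/ (1 + INR k) - 1) in G by (field; lra).
    rewrite INR_q. lra. }
  assert (Hconv : forall a, f a <> m0 -> exists v,
    filterlim (fun d => sgn lam * profile h lam d a) (at_right 0) (Rbar_locally (Finite v))).
  { intros a Hfa. destruct (profile_off_zero_converges_neg h q) with (lam := lam) (a := a) as [v Hv]; auto.
    - rewrite gap_neg_lam by exact Hl. generalize (f_range a). lra.
    - exists (- v). apply limit_sgn_neg; [exact Hl|]. apply lim_opp, Hv. }
  destruct M0_attained as [aM [HaM HfM]]. destruct m0_attained as [am [Ham Hfm]].
  split; [|split; [|split; [|split]]].
  - apply (limit_inf T u gam dl Hdl Hall am m_infty Ham Hfm), minimum_diverges; assumption.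
  - intros a Ha Hfa. apply (limit_along T u gam dl Hdl Hall a m_infty Ha), minimum_diverges; assumption.
  - intros a Ha Hfa. destruct (Hconv a Hfa) as [v Hv].
    assert (Hlim := limit_along T u gam dl Hdl Hall a v Ha Hv).
    exists (Rabs v + 1). generalize (proj1 (lim_eps _ _) Hlim 1 Rlt_0_1). apply filter_imp.
    intros t Ht. apply Rabs_def2 in Ht. unfold Rabs in *.
    destruct (Rcase_abs (ux_along u gam a t)), (Rcase_abs v); lra.
  - destruct (Hconv aM) as [v Hv]; [lra|]. exists v.
    exact (limit_sup T u gam dl Hdl Hall aM v HaM HfM Hv).
  - intros p Hp Hpl. rewrite <- INR_q in Hpl.
    assert (Hq1 : 2 <= INR q) by (rewrite INR_q; lra).
    assert (Hexp' : / lam + p < / INR q).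
    { assert (G1 : 1 - p * INR q < 0) by nra.
      assert (G2 : INR q / (1 - p * INR q) < 0).
      { unfold Rdiv. assert (/ (1 - p * INR q) < 0) by (apply Rinv_lt_0_compat, G1). nra. }
      assert (G := inv_neg_lt lam _ Hl G2 Hpl).
      replace (/ (INR q / (1 - p * INR q))) with (/ INR q - p) in G by (field; lra). lra. }
    destruct (profile_mass_converges h q) with (lam := lam) (p := p) as [l Hlim]; auto.
    exists (pow0 l (/ p)).
    apply (limit_Lp T u gam dl Hdl Hall p (Finite (pow0 l (/ p)))); [lra|].
    apply (lim_cont (fun x => pow0 x (/ p))); [exact Hlim|].
    apply pow0_continuous, Rinv_0_lt_compat. lra.
Qed.

(** Now [1/lam + 1 > 1/q]: the mean that is subtracted is supercritical, and drives all labels but the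
    minima of [u0']. *)
Theorem two_sided_blowup_neg : lam < - ((1 + INR k) / INR k) -> exists T : R, 0 < T /\
  solution_up_to lam u0 M0 m0 T (fun u gam =>
    tends_left (Msup u gam) T p_infty /\
    tends_left (minf u gam) T m_infty /\
    (forall a, 0 <= a <= 1 -> f a <> m0 -> tends_left (ux_along u gam a) T p_infty)).
Proof.
  intros Hlk. assert (Hk : 1 <= INR k) by (apply (le_INR 1); exact k_pos).
  assert (G1 : 0 < (1 + INR k) / INR k) by (apply Rdiv_lt_0_compat; lra).
  assert (Hl : lam < 0) by lra.
  apply (negative_life_span (fun T u gam => _) Hl). intros T u gam dl _ _ Hdl Hall.
  assert (Hexp : / INR q < / lam + 1).
  { assert (G := inv_neg_lt (- ((1 + INR k) / INR k)) lam ltac:(lra) Hl Hlk).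
    replace (/ - ((1 + INR k) / INR k)) with (/ (1 + INR k) - 1) in G by (field; lra).
    rewrite INR_q. lra. }
  assert (Hdiv : forall a, f a <> m0 ->
    filterlim (fun d => sgn lam * profile h lam d a) (at_right 0) (Rbar_locally p_infty)).
  { intros a Hfa. apply limit_sgn_neg; [exact Hl|].
    assert (Hoff : 0 < h a) by (rewrite gap_neg_lam by exact Hl; generalize (f_range a); lra).
    assert (H := profile_off_zero_diverges_neg h q h_continuous h_nonneg q_ge_2 h_power_zeros
                   h_zero_exists h_pos_exists lam a Hl Hexp Hoff).
    apply lim_pinfty. intros B.
    generalize (proj1 (lim_minfty _) H (- B)). apply filter_imp. intros; lra. }
  destruct M0_attained as [aM [HaM HfM]]. destruct m0_attained as [am [Ham Hfm]].
  split; [|split].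
  - apply (limit_sup T u gam dl Hdl Hall aM p_infty HaM HfM), Hdiv. lra.
  - apply (limit_inf T u gam dl Hdl Hall am m_infty Ham Hfm), minimum_diverges; assumption.
  - intros a Ha Hfa. apply (limit_along T u gam dl Hdl Hall a p_infty Ha), Hdiv, Hfa.
Qed.

(** The condition says [1/lam + p > p/q], and [p/q > 1/q]: the integral in [profile_mass_factored] is
    supercritical. *)
Theorem Lp_blowup_neg p : 1 < p -> lam < - ((1 + INR k) / (p * INR k)) -> exists T : R, 0 < T /\
  solution_up_to lam u0 M0 m0 T (fun u gam =>
    tends_left (Linf_ux u) T p_infty /\ tends_left (Lp_ux p u) T p_infty).
Proof.
  intros Hp Hlk. assert (Hk : 1 <= INR k) by (apply (le_INR 1); exact k_pos).
  assert (Hpk : 0 < p * INR k) by (apply Rmult_lt_0_compat; lra).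
  assert (G1 : 0 < (1 + INR k) / (p * INR k)) by (apply Rdiv_lt_0_compat; lra).
  assert (Hl : lam < 0) by lra.
  apply (negative_life_span (fun T u gam => _) Hl). intros T u gam dl HT0 Hs Hdl Hall.
  assert (Hexp : / INR q < / lam + p).
  { assert (G := inv_neg_lt (- ((1 + INR k) / (p * INR k))) lam ltac:(lra) Hl Hlk).
    replace (/ - ((1 + INR k) / (p * INR k))) with (p * / (1 + INR k) - p) in G by (field; lra).
    rewrite INR_q. assert (0 < / (1 + INR k)) by (apply Rinv_0_lt_compat; lra). nra. }
  split.
  - destruct m0_attained as [am [Ham Hfm]]. apply lim_pinfty. intros B.
    assert (Hmin := limit_along T u gam dl Hdl Hall am m_infty Ham (minimum_diverges am Hl Hfm)).
    generalize (filter_and _ _ Hall (proj1 (lim_minfty _) Hmin (- B))). apply filter_imp.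
    intros t [[Ht0 [HtT _]] HB].
    apply Rlt_le_trans with (Rabs (ux_along u gam am t)).
    + assert (H := Rle_abs (- ux_along u gam am t)). rewrite Rabs_Ropp in H. lra.
    + apply (Linf_ge_along lam u0 (Finite T) u gam); auto; simpl; lra.
  - apply (limit_Lp T u gam dl Hdl Hall p p_infty); [lra|].
    apply pow0_large; [apply at_right_proper_filter|apply Rinv_0_lt_compat; lra|].
    apply (profile_mass_diverges_neg h q); auto. lra.
Qed.

End FixedParameter.

End InitialData.

Theorem corollary3p109 (u0 : R -> R) (M0 m0 : R) (amax amin : list R) (k : nat)
  (u0_smooth : smooth u0)
  (u0_periodic : periodic1 u0)
  (u0_mean : RInt u0 0 1 = 0)
  (M0_max : greatest_value (Derive u0) M0)
  (m0_min : least_value (Derive u0) m0)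
  (M0_pos : 0 < M0)
  (m0_neg : m0 < 0)
  (amax_spec : attained_exactly_at (Derive u0) M0 amax)
  (amin_spec : attained_exactly_at (Derive u0) m0 amin)
  (k_pos : (1 <= k)%nat) :
  ((forall a, In a amax -> zero_of_order (Derive_n u0 2) k a) ->
     (forall lam, 0 <= lam <= (1 + INR k) / 2 ->
        solution_up_to lam u0 M0 m0 p_infty (fun u gam =>
          (0 < lam < (1 + INR k) / 2 ->
             forall a, 0 <= a <= 1 -> is_lim (ux_along u gam a) p_infty 0) /\
          (lam = (1 + INR k) / 2 ->
             exists v : R -> R,
               (forall a, 0 <= a <= 1 ->
                  is_lim (ux_along u gam a) p_infty (v a)) /\
               (exists a, 0 <= a <= 1 /\ v a <> 0))))
     /\
     (forall lam, (1 + INR k) / 2 < lam ->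
        exists T : R, 0 < T /\
        solution_up_to lam u0 M0 m0 T (fun u gam =>
          tends_left (Msup u gam) T p_infty /\
          tends_left (minf u gam) T m_infty /\
          (forall a, 0 <= a <= 1 -> ~ In a amax -> ~ In a amin ->
             tends_left (ux_along u gam a) T m_infty) /\
          (forall p, 1 < p -> tends_left (Lp_ux p u) T p_infty))))
  /\
  ((forall a, In a amin -> zero_of_order (Derive_n u0 2) k a) ->
     (forall lam, - ((1 + INR k) / INR k) < lam < 0 ->
        exists T : R, 0 < T /\
        solution_up_to lam u0 M0 m0 T (fun u gam =>
          tends_left (minf u gam) T m_infty /\
          (forall a, In a amin -> tends_left (ux_along u gam a) T m_infty) /\
          (forall a, 0 <= a <= 1 -> ~ In a amin ->
             exists C : R, at_left T (fun t => Rabs (ux_along u gam a t) <= C)) /\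
          (exists l : R, tends_left (Msup u gam) T l) /\
          (forall p, 1 <= p -> (1 + INR k) / (1 - p * (1 + INR k)) < lam ->
             exists l : R, tends_left (Lp_ux p u) T l)))
     /\
     (forall lam, lam < - ((1 + INR k) / INR k) ->
        exists T : R, 0 < T /\
        solution_up_to lam u0 M0 m0 T (fun u gam =>
          tends_left (Msup u gam) T p_infty /\
          tends_left (minf u gam) T m_infty /\
          (forall a, 0 <= a <= 1 -> ~ In a amax -> ~ In a amin ->
             tends_left (ux_along u gam a) T p_infty)))
     /\
     (forall p lam, 1 < p -> lam < - ((1 + INR k) / (p * INR k)) ->
        exists T : R, 0 < T /\
        solution_up_to lam u0 M0 m0 T (fun u gam =>
          tends_left (Linf_ux u) T p_infty /\
          tends_left (Lp_ux p u) T p_infty))).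
Proof.
  assert (weaken : forall lam T (P Q : (R -> R -> R) -> (R -> R -> R) -> Prop),
    (forall u gam, P u gam -> Q u gam) ->
    solution_up_to lam u0 M0 m0 T P -> solution_up_to lam u0 M0 m0 T Q).
  { intros lam T P Q H [H1 [H2 H3]]. split; [exact H1|]. split; [exact H2|]. auto. }
  split.
  - intros Hord.
    assert (Hpeak : forall lam, 0 < lam -> forall a, 0 <= a <= 1 ->
      gap lam M0 m0 (Derive u0) a = 0 -> zero_of_order (Derive_n u0 2) k a).
    { intros lam Hl a Ha Hg. rewrite (gap_pos_lam u0 M0 m0 lam a Hl) in Hg.
      apply Hord, amax_spec. split; [exact Ha|lra]. }
    split.
    + intros lam [Hl0 Hl]. destruct (Rle_lt_or_eq_dec _ _ Hl0) as [Hlt| <-].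
      * assert (H : 0 < lam <= (1 + INR k) / 2) by lra.
        eapply weaken; [|apply (global_regime u0 M0 m0) with (k := k); auto; solve [lra | apply Hpeak, Hlt]].
        intros u gam [H1 H2]. split; [intros [_ H']; auto|exact H2].
      * split; [split; [reflexivity|intros H; contradiction]|]. split.
        -- apply (solution_exists_0 u0 (Derive_n u0 2)); auto.
           ++ apply u0_derivable, u0_smooth.
           ++ apply f_derive, u0_smooth.
           ++ apply f_derivative_continuous, u0_smooth.
        -- intros u gam _ _. assert (Hk := pos_INR k). split; intros; lra.
    + intros lam Hl. assert (Hl0 : 0 < lam) by (generalize (pos_INR k); lra).
      destruct (two_sided_blowup_pos u0 M0 m0) with (k := k) (lam := lam) as [T [HT H]]; auto;
        [lra|apply Hpeak, Hl0|].
      exists T. split; [exact HT|]. revert H. apply weaken. intros u gam [H1 [H2 [H3 H4]]].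
      repeat split; auto. intros a Ha Hn _. apply H3; [exact Ha|]. intros E. apply Hn, amax_spec. auto.
  - intros Hord.
    assert (Hpeak : forall lam, lam < 0 -> forall a, 0 <= a <= 1 ->
      gap lam M0 m0 (Derive u0) a = 0 -> zero_of_order (Derive_n u0 2) k a).
    { intros lam Hl a Ha Hg. rewrite (gap_neg_lam u0 M0 m0 lam (Rlt_not_eq _ _ Hl) a Hl) in Hg.
      apply Hord, amin_spec. split; [exact Ha|lra]. }
    assert (Hk : 1 <= INR k) by (apply (le_INR 1); exact k_pos).
    split; [|split].
    + intros lam Hl.
      destruct (one_sided_blowup u0 M0 m0) with (k := k) (lam := lam) as [T [HT H]]; auto;
        [lra|apply Hpeak, Hl|].
      exists T. split; [exact HT|]. revert H. apply weaken. intros u gam [H1 [H2 [H3 [H4 H5]]]].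
      repeat split; auto.
      * intros a Ha. apply amin_spec in Ha. apply H2; apply Ha.
      * intros a Ha Hn. apply H3; [exact Ha|]. intros E. apply Hn, amin_spec. auto.
    + intros lam Hl.
      assert (0 < (1 + INR k) / INR k) by (apply Rdiv_lt_0_compat; lra).
      assert (Hl0 : lam < 0) by lra.
      destruct (two_sided_blowup_neg u0 M0 m0) with (k := k) (lam := lam) as [T [HT H']]; auto;
        [lra|apply Hpeak, Hl0|].
      exists T. split; [exact HT|]. revert H'. apply weaken. intros u gam [H1 [H2 H3]].
      repeat split; auto. intros a Ha _ Hn. apply H3; [exact Ha|]. intros E. apply Hn, amin_spec. auto.
    + intros p lam Hp Hl.
      assert (0 < (1 + INR k) / (p * INR k)) by (apply Rdiv_lt_0_compat; nra).
      assert (Hl0 : lam < 0) by lra.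
      apply (Lp_blowup_neg u0 M0 m0) with (k := k); auto; [lra|apply Hpeak, Hl0].
Qed.
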